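(* Let $\mu,\nu\in\mathcal P_2(\mathbb R^d)$ with $\mu$ dominated by $\nu$ in convex order. Assume that $\int e^{q|y|}\,\nu(dy)<\infty$ for all $q\in\mathbb R_+$ and that $\nu$ is not concentrated on any (affine) hyperplane. Suppose that the problem (VP) has finite value and that $\bar\mu\in\mathcal P_2(\mathbb R^d)$ solves (VP). Let $\pi$ be the solution of $SP(\bar\mu,\nu)$, let $(\bar\varphi,\psi)$ be the Schrödinger potentials associated to $(\bar\mu,\nu)$, let $T:\bar x\mapsto\int y\,d\pi_{\bar x}(y)$ be the barycentric map, and let $m=(T,\mathrm{id})_\#\pi$, i.e. the push-forward of $\pi$ under $(\bar x,y)\mapsto(T(\bar x),y)$. Then: (1) The map $\bar\varphi$ is finite, strictly concave, infinitely differentiable, and for all $\bar x\in\mathbb R^d$ $$-\nabla\bar\varphi(\bar x)=T(\bar x)\qquad\text{and}\qquad \nabla^2\bar\varphi(\bar x)=-\mathrm{Cov}_{\pi_{\bar x}}(Y),$$ where $\mathrm{Cov}_{\pi_{\bar x}}(Y)$ is the covariance matrix of a random vector $Y\sim\pi_{\bar x}$. Moreover, $T$ is injective and $T_\#\bar\mu=\mu$. (2) Let $A$ denote the image of $-\nabla\bar\varphi$ and $h:A\to\mathbb R^d$ its inverse. Then $m_x=\pi_{h(x)}$ for $\mu$-a.e. $x$. (3) $m$ attains (P). (4) $\psi$ attains (D). Moreover, for $\mu$-a.e. $x\in\mathbb R^d$, $h(x)$ is the unique solution of the problem $$\sup_{h\in\mathbb R^d}\left\{h\cdot x-\log\int e^{\psi(y)+h\cdot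 y}\,\nu(dy)\right\}.$$
   Context: $\mathcal P_2(\mathbb R^d)$: Borel probability measures on $\mathbb R^d$ with finite second moment. Convex order: $\int\phi\,d\mu\le\int\phi\,d\nu$ for all convex $\phi:\mathbb R^d\to\mathbb R$. $\mathsf{Cpl}(\alpha,\beta)$: couplings with first marginal $\alpha$ and second marginal $\beta$. $\mathsf{MT}(\mu,\nu)$: couplings $m(dx,dy)=\mu(dx)m_x(dy)\in\mathsf{Cpl}(\mu,\nu)$ with $\int y\,m_x(dy)=x$ for $\mu$-a.e. $x$. For a measure $\pi$ on $\mathbb R^d\times\mathbb R^d$, $\pi_x$ denotes its disintegration with respect to its first marginal. $H(Q\mid R)=\int\log\frac{dQ}{dR}\,dQ$ if $Q\ll R$, $+\infty$ otherwise. $\mathrm{MCov}(\bar\mu,\mu)=\sup_{\pi\in\mathsf{Cpl}(\bar\mu,\mu)}\int\bar x\cdot x\,\pi(d\bar x,dx)$. Problems: (P) $\ \inf_{m\in\mathsf{MT}(\mu,\nu)}H(m\mid\mu\otimes\nu)$. (D) $\ \sup_{\psi\in C_b(\mathbb R^d)}\mathcal D(\psi)$, where $\mathcal D(\psi)=\int\psi\,d\nu+\int\sup_{h\in\mathbb R^d}\big[h\cdot x-\log\int e^{h\cdot y+\psi(y)}\nu(dy)\big]\mu(dx)$. ''$\psi$ attains (D)'' means that $\mathcal D(\psi)$ equals the value of (D) ($\psi$ need not be bounded or continuous). $SP(\bar\mu,\nu)$: $\ \inf_{\pi\in\mathsf{Cpl}(\bar\mu,\nu)}\big[H(\pi\mid\bar\mu\otimes\nu)-\int\bar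 x\cdot y\,\pi(d\bar x,dy)\big]$. (VP) $\ \sup_{\bar\mu\in\mathcal P_2(\mathbb R^d)}\{SP(\bar\mu,\nu)+\mathrm{MCov}(\bar\mu,\mu)\}$, where $SP(\bar\mu,\nu)$ here denotes the value of that problem. Schrödinger potentials: the unique minimizer $\pi$ of $SP(\bar\mu,\nu)$ has the form $\frac{d\pi}{d\bar\mu\otimes\nu}(\bar x,y)=\exp(\bar\varphi(\bar x)+\psi(y)+\bar x\cdot y)$, where $(\bar\varphi,\psi)$, unique up to $(\bar\varphi+c,\psi-c)$ with $c\in\mathbb R$, solves the Schrödinger system $$\int e^{\bar\varphi(\bar x)+\psi(y)+\bar x\cdot y}\,\nu(dy)=1\ (\bar\mu\text{-a.e. }\bar x),\qquad \int e^{\bar\varphi(\bar x)+\psi(y)+\bar x\cdot y}\,\bar\mu(d\bar x)=1\ (\nu\text{-a.e. }y).$$ By convention $\bar\varphi$ is extended to all of $\mathbb R^d$ by $\bar\varphi(\bar x)=-\log\int e^{\psi(y)+\bar x\cdot y}\nu(dy)$, similarly $\psi(y)=-\log\int e^{\bar\varphi(\bar x)+\bar x\cdot y}\bar\mu(d\bar x)$ for all $y$, and accordingly $\pi_{\bar x}$ is defined for every $\bar x\in\mathbb R^d$ by $\frac{d\pi_{\bar x}}{d\nu}(y)=e^{\bar\varphi(\bar x)+\psi(y)+\bar x\cdot y}$. *)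

(* Defs.v *)
From HB Require Import structures.
From mathcomp Require Import all_boot all_order all_algebra.
From mathcomp Require Import all_classical all_reals all_analysis.
From mathcomp Require Import measurable_realfun.

Set Implicit Arguments.
Unset Strict Implicit.
Unset Printing Implicit Defensive.

Import Order.TTheory GRing.Theory Num.Theory.
Import numFieldNormedType.Exports.

Local Open Scope classical_set_scope.
Local Open Scope ring_scope.

(* R^d is 'rV[R]_d, with its Borel sigma-algebra.  R^d being second countable,
   the library's product sigma-algebra on 'rV[R]_d * 'rV[R]_d is the Borel
   sigma-algebra of R^d x R^d. *)
Section borel_rV.
Context (R : realType) (d : nat).

Let borel0 : <<s @open 'rV[R]_d >> set0.
Proof. exact: sigma_algebra0. Qed.

Let borelC (A : set 'rV[R]_d) :
  <<s @open 'rV[R]_d >> A -> <<s @open 'rV[R]_d >> (~` A).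
Proof. exact: sigma_algebraC. Qed.

Let borel_bigcup (F : (set 'rV[R]_d)^nat) :
  (forall i, <<s @open 'rV[R]_d >> (F i)) ->
  <<s @open 'rV[R]_d >> (\bigcup_i F i).
Proof. exact: sigma_algebra_bigcup. Qed.

HB.instance Definition _ := @isMeasurable.Build default_measure_display
  'rV[R]_d <<s @open 'rV[R]_d >> borel0 borelC borel_bigcup.

End borel_rV.

Section euclidean.
Context {R : realType} {d : nat}.
Implicit Types (x y : 'rV[R]_d) (f : 'rV[R]_d -> R).

Definition dot x y : R := \sum_(i < d) x 0 i * y 0 i.

(* The norm of the library on 'rV[R]_d is the sup norm. *)
Definition enorm x : R := Num.sqrt (dot x x).

Definition basis_vec (i : 'I_d) : 'rV[R]_d := delta_mx 0 i.

Definition gradient f x : 'rV[R]_d := \row_i 'D_(basis_vec i) f x.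

Definition hessian f x : 'M[R]_d :=
  \matrix_(i, j) 'D_(basis_vec i) ('D_(basis_vec j) f) x.

Fixpoint continuously_differentiable (n : nat) f : Prop :=
  if n is n'.+1 then
    (forall x, differentiable f x) /\
    (forall i, continuously_differentiable n' ('D_(basis_vec i) f))
  else continuous f.

Definition smooth f : Prop := forall n, continuously_differentiable n f.

Definition strictly_concave f : Prop :=
  forall (t : R) x y, 0 < t < 1 -> x != y ->
    t * f x + (1 - t) * f y < f (t *: x + (1 - t) *: y).

End euclidean.

(* H(Q | S); the value is lne (dQ/dS) integrated against Q, where dQ/dS is
   positive Q-almost everywhere. *)
Definition entropy (R : realType) disp (T : measurableType disp)
    (Q S : probability T R) : \bar R :=
  if pselect (Q `<< S) then
    (\int[Q]_z lne (Radon_Nikodym (charge_of_finite_measure Q) S z))%E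
  else +oo%E.

Section problems.
Context {R : realType} {d : nat}.
Local Notation E := ('rV[R]_d).
Local Open Scope ereal_scope.

Definition finite_second_moment (P : {measure set E -> \bar R}) : Prop :=
  \int[P]_x ((enorm x) ^+ 2)%:E < +oo.

Definition convex_order (mu nu : probability E R) : Prop :=
  forall phi : E -> R, convex_function setT phi ->
    \int[mu]_x (phi x)%:E <= \int[nu]_x (phi x)%:E.

Definition exponential_moments (nu : probability E R) : Prop :=
  forall q : R, (0 <= q)%R -> \int[nu]_y (expR (q * enorm y))%:E < +oo.

Definition concentrated_on_hyperplane (nu : probability E R) : Prop :=
  exists (a : E) (b : R), a != 0%R /\ nu [set y | dot a y = b] = 1.

(* This is the vector of the integrals of the coordinates only if these are
   integrable under P; otherwise Rintegral returns the default value 0. *)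
Definition barycenter (P : {measure set E -> \bar R}) : E :=
  (\row_i \int[P]_y y 0 i)%R.

(* The covariance of the library is only defined for bundled probability
   measures. *)
Definition covariance_matrix (P : {measure set E -> \bar R}) : 'M[R]_d :=
  (\matrix_(i, j) \int[P]_y
     ((y 0 i - barycenter P 0 i) * (y 0 j - barycenter P 0 j)))%R.

Definition coupling (alpha beta : probability E R)
    (p : probability (E * E)%type R) : Prop :=
  (forall A, measurable A -> pushforward p fst A = alpha A) /\
  (forall B, measurable B -> pushforward p snd B = beta B).

Definition disintegration (p : probability (E * E)%type R)
    (alpha : probability E R) (k : R.-pker E ~> E) : Prop :=
  forall A B, measurable A -> measurable B ->
    p (A `*` B) = \int[alpha]_(x in A) k x B.

(* Under a coupling of mu and nu with nu in P_2, k x has a finite second moment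
   for mu-almost every x, so that barycenter (k x) is a genuine integral. *)
Definition martingale_coupling (mu nu : probability E R)
    (p : probability (E * E)%type R) : Prop :=
  coupling mu nu p /\
  exists k : R.-pker E ~> E,
    disintegration p mu k /\ {ae mu, forall x, barycenter (k x) = x}.

Definition MCov (mubar mu : probability E R) : \bar R :=
  ereal_sup [set \int[p]_z (dot z.1 z.2)%:E | p in coupling mubar mu].

Definition P_value (mu nu : probability E R) : \bar R :=
  ereal_inf [set entropy m (mu \x nu) | m in martingale_coupling mu nu].

Definition solves_P (mu nu : probability E R)
    (m : probability (E * E)%type R) : Prop :=
  martingale_coupling mu nu m /\ entropy m (mu \x nu) = P_value mu nu.

Definition SP_objective (mubar nu : probability E R)
    (p : probability (E * E)%type R) : \bar R :=
  entropy p (mubar \x nu) - \int[p]_z (dot z.1 z.2)%:E.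

Definition SP_value (mubar nu : probability E R) : \bar R :=
  ereal_inf [set SP_objective mubar nu p | p in coupling mubar nu].

Definition solves_SP (mubar nu : probability E R)
    (p : probability (E * E)%type R) : Prop :=
  coupling mubar nu p /\ SP_objective mubar nu p = SP_value mubar nu.

Definition VP_objective (mu nu mubar : probability E R) : \bar R :=
  SP_value mubar nu + MCov mubar mu.

Definition VP_value (mu nu : probability E R) : \bar R :=
  ereal_sup [set VP_objective mu nu mubar |
    mubar in [set mubar : probability E R | finite_second_moment mubar]].

Definition solves_VP (mu nu mubar : probability E R) : Prop :=
  finite_second_moment mubar /\ VP_objective mu nu mubar = VP_value mu nu.

(* Dual potentials are allowed to take infinite values: psi, when extended to
   all y by [extended_potentials], may equal -oo on a nu-null set. *)
Definition D_inner (nu : probability E R) (psi : E -> \bar R) (x h : E) : \bar R :=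
  (dot h x)%:E - lne (\int[nu]_y expeR (psi y + (dot h y)%:E)).

Definition D_objective (mu nu : probability E R) (psi : E -> \bar R) : \bar R :=
  \int[nu]_y psi y + \int[mu]_x ereal_sup (range (D_inner nu psi x)).

Definition bounded_continuous (psi : E -> R) : Prop :=
  continuous psi /\ exists M : R, forall y, (`|psi y| <= M)%R.

Definition D_value (mu nu : probability E R) : \bar R :=
  ereal_sup [set D_objective mu nu (EFin \o psi) | psi in bounded_continuous].

Definition attains_D (mu nu : probability E R) (psi : E -> \bar R) : Prop :=
  D_objective mu nu psi = D_value mu nu.

Definition schrodinger_system (mubar nu : probability E R)
    (phi psi : E -> \bar R) : Prop :=
  {ae mubar, forall x,
    \int[nu]_y expeR (phi x + psi y + (dot x y)%:E) = 1} /\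
  {ae nu, forall y,
    \int[mubar]_x expeR (phi x + psi y + (dot x y)%:E) = 1}.

Definition extended_potentials (mubar nu : probability E R)
    (phi psi : E -> \bar R) : Prop :=
  (forall x, phi x = - lne (\int[nu]_y expeR (psi y + (dot x y)%:E))) /\
  (forall y, psi y = - lne (\int[mubar]_x expeR (phi x + (dot x y)%:E))).

(* To be used with p the minimizer of SP(mubar, nu), whose density determines
   phi + psi. *)
Definition schrodinger_potentials (mubar nu : probability E R)
    (p : probability (E * E)%type R) (phi psi : E -> \bar R) : Prop :=
  [/\ measurable_fun setT phi,
      measurable_fun setT psi,
      (forall C, measurable C -> p C =
        \int[mubar \x nu]_(z in C)
          expeR (phi z.1 + psi z.2 + (dot z.1 z.2)%:E)),
      schrodinger_system mubar nu phi psi &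
      extended_potentials mubar nu phi psi].

(* For measurable psi such a family of measures always exists, and it is
   determined on measurable sets. *)
Definition conditional_measures (nu : probability E R)
    (phi psi : E -> \bar R) (pc : E -> {measure set E -> \bar R}) : Prop :=
  forall x B, measurable B ->
    pc x B = \int[nu]_(y in B) expeR (phi x + psi y + (dot x y)%:E).

End problems.

(* Main.v *)
(* Put f = - ln L and w = e^psi, where L(x) = int w(y) e^{x.y} nu(dy), so that
   phi = f.  All moments of w nu being exponential, f is smooth, with gradient
   minus the barycenter T and Hessian minus the covariance of pi_x; the strict
   tangent inequality f(x + s) < f x - s.T(x), which holds because nu charges no
   hyperplane alone, gives strict concavity, injectivity of T and the fact
   that h is the unique maximizer of h.x + f h when x = T h.

   Let c(x) = sup_h (h.x + f h).  Testing (VP) against the laws of finitely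
   valued near-maximizers xi(x) shows int ln w dnu + int c dmu <= VP (Gibbs'
   inequality bounds the entropy from below), whereas VP = int f dmubar +
   int ln w dnu + MCov(mubar, mu) by optimality.  Hence along nearly optimal
   couplings q of mubar and mu the nonnegative gap c(x) - f(xb) - xb.x has
   small integral.  By a quadratic bound on f the gap is bounded below as soon
   as |T(xb) - x| is, so (T, id)_# q is a coupling of T_# mubar and mu
   concentrating on the diagonal, and T_# mubar = mu.  It follows that
   VP = int ln w dnu + int c dmu = H(m | mu x nu), and Gibbs' inequality shows
   that the middle term bounds the primal problem from below: m solves (P).
   The same inequality gives (D) <= H(m | mu x nu); equality holds because psi
   is a limit of the bounded continuous potentials
   - ln int e^{f x + x.y} mubar(dx), truncated in x and clamped. *)
Require Import Defs.
From HB Require Import structures.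
From mathcomp Require Import all_boot all_order all_algebra.
From mathcomp Require Import all_classical all_reals all_analysis.
From mathcomp Require Import measurable_realfun.
From mathcomp Require Import ring lra.

Set Implicit Arguments.
Unset Strict Implicit.
Unset Printing Implicit Defensive.

Import Order.TTheory GRing.Theory Num.Theory.
Import numFieldNormedType.Exports.

Local Open Scope classical_set_scope.
Local Open Scope ring_scope.

(** * Euclidean geometry and measurability *)

(** No duality theorem, compactness of couplings or measurable selection theorem is invoked. The
    inequality int k dQ <= H(Q | S), valid whenever int e^k dS <= 1, is used with the exponents k(x,
    y) = f(xi x) + ln w(y) + xi(x).y: with xi free it bounds the entropies of (P) and of SP alike. A
    maximizer of h.x + f h need not exist for a given x, and a measurable choice of maximizers need
    not be square integrable: hence the finitely valued maps, the supremum being recovered by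
    monotone convergence. A coupling attaining MCov is likewise avoided, which is why the law of T
    is identified through couplings close to the diagonal. The potentials are extended real
    functions; w is a version of e^psi that is positive everywhere, so that all the analysis takes
    place with real functions. As mubar has only second moments, the integral of e^{f x + x.y}
    against it need not be finite or continuous in y; truncating x turns it into the Laplace
    transform of a law with exponential moments. *)

Section euclid.
Context {R : realType} {d : nat}.
Local Notation E := ('rV[R]_d).
Implicit Types (x y : E).

Lemma dotC x y : dot x y = dot y x.
Proof. by apply: eq_bigr => i _; rewrite mulrC. Qed.

Lemma dotDr x y (z : E) : dot x (y + z) = dot x y + dot x z.
Proof. by rewrite -big_split; apply: eq_bigr => i _; rewrite mxE mulrDr. Qed.

Lemma dotZr (t : R) x y : dot x (t *: y) = t * dot x y.
Proof. by rewrite mulr_sumr; apply: eq_bigr => i _; rewrite mxE mulrCA. Qed.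

Lemma dotDl x y (z : E) : dot (x + y) z = dot x z + dot y z.
Proof. by rewrite dotC dotDr !(dotC z). Qed.

Lemma dotZl (t : R) x y : dot (t *: x) y = t * dot x y.
Proof. by rewrite dotC dotZr dotC. Qed.

Lemma dotNl x y : dot (- x) y = - dot x y.
Proof. by rewrite -scaleN1r dotZl mulN1r. Qed.

Lemma dotBl x y (z : E) : dot (x - y) z = dot x z - dot y z.
Proof. by rewrite dotDl dotNl. Qed.

Lemma dot0l x : dot 0 x = 0.
Proof. by rewrite -(scale0r 0) dotZl mul0r. Qed.

Lemma dot_basis (i : 'I_d) y : dot (basis_vec i) y = y 0 i.
Proof.
rewrite /dot (bigD1 i)//= mxE !eqxx mul1r big1 ?addr0// => j ji.
by rewrite mxE (negbTE ji) mul0r.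
Qed.

Lemma dot_ge0 x : 0 <= dot x x.
Proof. by apply: sumr_ge0 => i _; rewrite -expr2 sqr_ge0. Qed.

Lemma enorm_ge0 x : 0 <= enorm x.
Proof. exact: sqrtr_ge0. Qed.

Lemma sqr_enorm x : enorm x ^+ 2 = dot x x.
Proof. by rewrite sqr_sqrtr// dot_ge0. Qed.

Lemma coord_le_enorm x (i : 'I_d) : `|x 0 i| <= enorm x.
Proof.
rewrite -sqrtr_sqr ler_sqrt ?dot_ge0// /dot (bigD1 i)//= -expr2 lerDl.
by apply: sumr_ge0 => j _; rewrite -expr2 sqr_ge0.
Qed.

(* The l1 norm: it pairs with the Euclidean norm in a cheap Hoelder inequality,
   which is all that the exponential bounds require. *)
Definition norm1 x : R := \sum_(i < d) `|x 0 i|.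

Lemma norm1_ge0 x : 0 <= norm1 x.
Proof. exact: sumr_ge0. Qed.

Lemma dot_le_norm1 x y : `|dot x y| <= norm1 x * enorm y.
Proof.
rewrite (le_trans (ler_norm_sum _ _ _))// mulr_suml.
by apply: ler_sum => i _; rewrite normrM ler_wpM2l// coord_le_enorm.
Qed.

Lemma norm1Z (t : R) x : norm1 (t *: x) = `|t| * norm1 x.
Proof. by rewrite mulr_sumr; apply: eq_bigr => i _; rewrite mxE normrM. Qed.

Lemma norm1_basis (i : 'I_d) : norm1 (basis_vec i) = 1.
Proof.
rewrite /norm1 (bigD1 i)//= mxE !eqxx normr1 big1 ?addr0// => j ji.
by rewrite mxE (negbTE ji) normr0.
Qed.

Lemma coord_le_norm x (i : 'I_d) : `|x 0 i| <= `|x|.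
Proof.
by rewrite [leRHS]/Num.norm/= mx_normrE; apply: (le_bigmax _ _ (0, i)).
Qed.

Lemma norm1_le_norm x : norm1 x <= d%:R * `|x|.
Proof.
rewrite mulr_natl -[X in _ *+ X](card_ord d) -sumr_const.
by apply: ler_sum => i _; exact: coord_le_norm.
Qed.

Lemma norm1_le_enorm x : norm1 x <= d%:R * enorm x.
Proof.
rewrite mulr_natl -[X in _ *+ X](card_ord d) -sumr_const.
by apply: ler_sum => i _; exact: coord_le_enorm.
Qed.

Lemma dot_le_sqr x y : `|dot x y| <= dot x x + dot y y.
Proof.
rewrite (le_trans (ler_norm_sum _ _ _))// -big_split; apply: ler_sum => i _ /=.
rewrite ler_norml; apply/andP; split; nra.
Qed.

Lemma continuous_sum (X : topologicalType) (I : Type) (r : seq I)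
    (F : I -> X -> R) :
  (forall i, continuous (F i)) -> continuous (fun t => \sum_(i <- r) F i t).
Proof.
move=> cF u; elim: r => [|i r IH].
  rewrite (_ : (fun _ => _) = cst 0); first exact: cvg_cst.
  by apply/funext => t; rewrite big_nil.
rewrite (_ : (fun _ => _) = (fun t => F i t + \sum_(j <- r) F j t)).
  by apply: cvgD => //; exact: cF.
by apply/funext => t; rewrite big_cons.
Qed.

Lemma continuous_dot x : continuous (dot x).
Proof.
apply: continuous_sum => i y; apply: (@continuousM R E (cst (x 0 i))).
  exact: cst_continuous.
exact: coord_continuous.
Qed.

Lemma open_measurable_rV (A : set E) : open A -> measurable A.
Proof. exact: sub_sigma_algebra. Qed.

Lemma closed_measurable_rV (A : set E) : closed A -> measurable A.
Proof.
by move=> /closed_openC/open_measurable_rV/measurableC; rewrite setCK.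
Qed.

Lemma continuous_measurable_rV (f : E -> R) :
  continuous f -> measurable_fun setT f.
Proof.
move=> /continuousP cf; apply: (measurability _ (RGenOpens.measurableE R)).
move=> _ [_ [a [b ->] <-]]; rewrite setTI; apply: open_measurable_rV.
exact/cf/interval_open.
Qed.

Lemma measurable_coord (i : 'I_d) : measurable_fun setT (fun x : E => x 0 i).
Proof. by apply: continuous_measurable_rV => x; exact: coord_continuous. Qed.

Lemma measurable_fun_dot d' (X : measurableType d') (u v : X -> E) :
  measurable_fun setT u -> measurable_fun setT v ->
  measurable_fun setT (fun t => dot (u t) (v t)).
Proof.
move=> mu mv; apply: measurable_sum => i; apply: measurable_funM.
  exact: measurableT_comp (measurable_coord i) mu.
exact: measurableT_comp (measurable_coord i) mv.
Qed.

Lemma measurable_enorm : measurable_fun setT (@enorm R d).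
Proof.
apply: (measurableT_comp (continuous_measurable_fun (@sqrt_continuous R))).
exact: measurable_fun_dot.
Qed.

Lemma continuous_measurable_rVrV (u : E -> E) :
  continuous u -> measurable_fun setT u.
Proof.
move=> /continuousP cu; apply: (@measurability _ _ E E setT u (@open E)) => //.
move=> _ [A oA <-]; rewrite setTI; apply: open_measurable_rV; exact/cu.
Qed.

Lemma continuous_rV (X : topologicalType) (u : X -> E) :
  (forall i, continuous (fun t => u t 0 i)) -> continuous u.
Proof.
move=> cu x B [P Px PB].
have := @filter_forall X _ (fun j => (fun t => u t 0 j) @^-1` P 0 j) (nbhs x) _
  (fun j => cu j x (P 0 j) (Px 0 j)).
move=> /(_ _)/filterS; apply => t Pt; apply: PB => i j; rewrite ord1; exact: Pt.
Qed.

(** Second order bounds on exponentials come out in [norm1]; as [norm1 s] is at most d times the sup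
    norm, such a remainder is o(s) for the topology in use, and the linear part is the
    differential. *)
Lemma differentiable_remainder (f : E -> R) (D x : E) (K : R) :
  (forall s, norm1 s <= 1 -> `|f (x + s) - f x - dot D s| <= K * norm1 s ^+ 2) ->
  differentiable f x /\ forall v, 'D_v f x = dot D v.
Proof.
move=> fK.
have dlin : linear (dot D : E -> R) by move=> t y z; rewrite dotDr dotZr.
pose df : {linear E -> R} := HB.pack (dot D : E -> R)
  (GRing.isLinear.Build _ _ _ _ (dot D : E -> R) dlin).
have cdf : continuous df by exact: continuous_dot.
have E1 : f \o shift x = cst (f x) + df +o_ (0 : E) id.
  apply/eqaddoP => e e0 /=.
  have K0 : 0 < 1 + `|K| by rewrite ltr_pwDl.
  have C0 : 0 < 1 + d%:R ^+ 2 :> R by rewrite ltr_pwDl// sqr_ge0.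
  have d0 : 0 < 1 + d%:R :> R by rewrite ltr_pwDl.
  near=> s.
  have s1 : norm1 s <= 1.
    apply: (le_trans (norm1_le_norm s)).
    have : `|s| <= (1 + d%:R)^-1.
      near: s; apply: (@nbhs0_le R E); rewrite invr_gt0; exact: d0.
    move=> h; rewrite (@le_trans _ _ (d%:R * (1 + d%:R)^-1))//.
      by rewrite ler_wpM2l.
    by rewrite ler_pdivrMr// mul1r lerDr.
  (* This radius absorbs K and the factor d^2 lost between [norm1] and the sup norm; the added ones
     keep the divisors positive. *)
  have se : `|s| <= e / ((1 + `|K|) * (1 + d%:R ^+ 2)).
    near: s; apply: (@nbhs0_le R E); rewrite divr_gt0//; exact: mulr_gt0.
  have -> : (f \o shift x - (cst (f x) + df)) s = f (x + s) - f x - dot D s.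
    by change (f (s + x) - (f x + dot D s) = f (x + s) - f x - dot D s);
      rewrite [s + x]addrC opprD addrA.
  apply: (le_trans (fK _ s1)).
  have n2 : norm1 s ^+ 2 <= d%:R ^+ 2 * `|s| * `|s|.
    rewrite -mulrA -expr2 -exprMn ler_sqr ?nnegrE ?norm1_ge0 ?mulr_ge0//.
    exact: norm1_le_norm.
  have nn : 0 <= `|s| by [].
  have h1 : K * norm1 s ^+ 2 <= (1 + `|K|) * ((1 + d%:R ^+ 2) * `|s| * `|s|).
    rewrite (@le_trans _ _ ((1 + `|K|) * norm1 s ^+ 2))//.
      by rewrite ler_wpM2r ?sqr_ge0// (le_trans (ler_norm _))// lerDr.
    apply: ler_wpM2l; [exact: ltW|apply: (le_trans n2)].
    by do 2 (apply: ler_wpM2r => //); rewrite lerDr.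
  apply: (le_trans h1).
  rewrite mulrA mulrA ler_wpM2r//.
  have : (1 + `|K|) * (1 + d%:R ^+ 2) * `|s| <= e.
    by rewrite mulrC -ler_pdivlMr// mulr_gt0.
  by [].
have Ed : 'd f x = df :> (E -> R) by exact: diff_unique.
have Df : differentiable f x.
  apply/diff_locallyP; rewrite Ed; split => //.
split => // v; by rewrite deriveE// Ed.
Unshelve. all: by end_near.
Qed.

End euclid.

(** * Exponential growth and Laplace transforms *)

Section expR_remainder.
Context {R : realType}.
Implicit Type t : R.

Lemma expR_sub1_le t : expR t - 1 <= t * expR t.
Proof.
have : (1 - t) * expR t <= expR (- t) * expR t.
  by rewrite ler_wpM2r ?expR_ge0// expR_ge1Dx.
by rewrite -expRD addNr expR0 mulrBl mul1r; lra.
Qed.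

Lemma expR_remainder_ge0 t : 0 <= expR t - 1 - t.
Proof. by have := expR_ge1Dx t; lra. Qed.

Lemma expR_remainder_gt0 t : t != 0 -> 0 < expR t - 1 - t.
Proof. by move=> /expR_gt1Dx; lra. Qed.

(** The remainder is at most t (e^t - 1), since e^t - 1 <= t e^t; a bound on e^t - 1 chosen
    according to the sign of t gains the second factor t. *)
Lemma expR_remainder_le t : `|expR t - 1 - t| <= t ^+ 2 * expR `|t|.
Proof.
rewrite ger0_norm ?expR_remainder_ge0//.
have h1 := expR_sub1_le t; have h2 := expR_ge1Dx t.
have [t0|t0] := leP 0 t.
  rewrite ger0_norm//; have : t * (expR t - 1) <= t * (t * expR t).
    by rewrite ler_wpM2l.
  by rewrite expr2 -mulrA; lra.
have e1 : 1 <= expR `|t| by rewrite -expR0 ler_expR.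
have h3 : t * (expR t - 1) <= t ^+ 2 by nra.
have : t ^+ 2 * 1 <= t ^+ 2 * expR `|t| by rewrite ler_wpM2l ?sqr_ge0.
by nra.
Qed.

End expR_remainder.

Section exponential_growth.
Context {R : realType} {d : nat}.
Local Notation E := ('rV[R]_d).
Implicit Types (g h : E -> R) (x s : E).

(** The integrands of all Laplace transforms: the class is an algebra, contains coordinates and
    exponentials of linear forms, and is integrable under exponential moments. A single constant
    serves as prefactor and as rate. *)
Definition egrowth g := measurable_fun setT g /\
  exists2 a, 0 <= a & forall y, `|g y| <= a * expR (a * enorm y).

Lemma egrowthD g h : egrowth g -> egrowth h -> egrowth (fun y => g y + h y).
Proof.
move=> [mg [a a0 ga]] [mh [b b0 hb]]; split; first exact: measurable_funD.
exists (a + b); first exact: addr_ge0.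
move=> y; rewrite (le_trans (ler_normD _ _))// mulrDl lerD//.
  rewrite (le_trans (ga y))// ler_wpM2l// ler_expR ler_wpM2r ?enorm_ge0//.
  by rewrite lerDl.
rewrite (le_trans (hb y))// ler_wpM2l// ler_expR ler_wpM2r ?enorm_ge0//.
by rewrite lerDr.
Qed.

Lemma egrowthM g h : egrowth g -> egrowth h -> egrowth (fun y => g y * h y).
Proof.
move=> [mg [a a0 ga]] [mh [b b0 hb]]; split; first exact: measurable_funM.
(* One constant has to dominate both the prefactor a b and the rate a + b. *)
have c0 : 0 <= a * b + (a + b) by rewrite !addr_ge0// mulr_ge0.
exists (a * b + (a + b)) => // y.
rewrite normrM (@le_trans _ _ (a * expR (a * enorm y) * (b * expR (b * enorm y))))//.
  by apply: ler_pM.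
rewrite mulrACA -expRD -mulrDl; apply: ler_pM => //.
- exact: mulr_ge0.
- by rewrite lerDl addr_ge0.
- by rewrite ler_expR ler_wpM2r ?enorm_ge0// lerDr mulr_ge0.
Qed.

Lemma egrowth_cst (c : R) : egrowth (fun=> c).
Proof.
split=> //; exists `|c| => // y; rewrite ler_peMr//.
by rewrite -expR0 ler_expR mulr_ge0// enorm_ge0.
Qed.

Lemma egrowth_coord (i : 'I_d) : egrowth (fun y => y 0 i).
Proof.
split; first exact: measurable_coord.
exists 1 => // y; rewrite !mul1r (le_trans (coord_le_enorm y i))//.
by have := expR_ge1Dx (enorm y); lra.
Qed.

Lemma egrowth_sum (g : 'I_d -> E -> R) : (forall i, egrowth (g i)) ->
  egrowth (fun y => \sum_(i < d) g i y).
Proof.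
move=> gi; elim: (index_enum _) => [|i r IH].
  by under eq_fun do rewrite big_nil; exact: egrowth_cst.
by under eq_fun do rewrite big_cons; exact: egrowthD.
Qed.

Lemma egrowth_dot x : egrowth (dot x).
Proof.
by apply: egrowth_sum => i; apply: egrowthM (egrowth_cst _) (egrowth_coord i).
Qed.

Lemma egrowth_sqr_enorm : egrowth (fun y => enorm y ^+ 2).
Proof.
under eq_fun do rewrite sqr_enorm.
by apply: egrowth_sum => i; apply: egrowthM; exact: egrowth_coord.
Qed.

Lemma egrowth_le g (C r : R) : measurable_fun setT g -> 0 <= C ->
  (forall y, `|g y| <= C * expR (r * enorm y)) -> egrowth g.
Proof.
move=> mg C0 gC; split => //; exists (C + `|r|) => [|y]; first exact: addr_ge0.
rewrite (le_trans (gC y))//; apply: ler_pM => //; rewrite ?expR_ge0 ?lerDl//.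
rewrite ler_expR ler_wpM2r ?enorm_ge0//.
by rewrite (le_trans (ler_norm r))// lerDr.
Qed.

Lemma egrowth_expR_enorm (r : R) : egrowth (fun y => expR (r * enorm y)).
Proof.
apply: (@egrowth_le _ 1 r) => // [|y].
  apply: measurableT_comp => //.
  by apply: measurable_funM => //; exact: measurable_enorm.
by rewrite mul1r ger0_norm ?expR_ge0.
Qed.

Lemma egrowth_expR_dot x : egrowth (fun y => expR (dot x y)).
Proof.
apply: (@egrowth_le _ 1 (norm1 x)) => // [|y].
  by apply: measurableT_comp => //; apply: measurable_fun_dot.
rewrite mul1r ger0_norm ?expR_ge0// ler_expR.
exact: le_trans (ler_norm _) (dot_le_norm1 x y).
Qed.

Lemma egrowth_norm g : egrowth g -> egrowth (fun y => `|g y|).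
Proof.
move=> [mg [a a0 ga]]; split; first exact: measurableT_comp.
by exists a => // y; rewrite normr_id.
Qed.

End exponential_growth.

(* Locked: unfolding the integral during unification is prohibitively slow. *)
HB.lock Definition Lap (R : realType) (d : nat) (nu : probability 'rV[R]_d R)
  (g : 'rV[R]_d -> R) (x : 'rV[R]_d) : R := \int[nu]_y (g y * expR (dot x y)).
Canonical Lap_unlockable := Unlockable Lap.unlock.

Section laplace.
Context {R : realType} {d : nat}.
Local Notation E := ('rV[R]_d).
Variable nu : probability E R.
Hypothesis nu_exp : exponential_moments nu.
Implicit Types (g h : E -> R) (x s : E).

Lemma egrowth_integrable g : egrowth g -> nu.-integrable setT (EFin \o g).
Proof.
move=> [mg [a a0 ga]].
apply: (@le_integrable _ _ _ nu setT measurableT _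
  (fun y => a%:E * (expR (a * enorm y))%:E)%E).
- exact/measurable_EFinP.
- by move=> y _ /=; rewrite lee_fin (le_trans (ga y))// ler_norm.
- apply: integrableZl => //; apply/integrableP; split.
    apply/measurable_EFinP; exact: (egrowth_expR_enorm a).1.
  rewrite (eq_integral (fun y => (expR (a * enorm y))%:E)) => [|y _].
    exact: nu_exp.
  by rewrite /= ger0_norm ?expR_ge0.
Qed.

Lemma LapE (g : E -> R) (x : E) :
  Lap nu g x = \int[nu]_y (g y * expR (dot x y)).
Proof. by rewrite Lap.unlock. Qed.

Local Notation Lap := (Lap nu).

Lemma Lap_integrable g x : egrowth g ->
  nu.-integrable setT (EFin \o (fun y => g y * expR (dot x y))).
Proof.
by move=> gg; apply/egrowth_integrable/egrowthM => //; exact: egrowth_expR_dot.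
Qed.

Lemma Lap_EFin g x : egrowth g ->
  (Lap g x)%:E = (\int[nu]_y (g y * expR (dot x y))%:E)%E.
Proof.
by move=> gg; rewrite LapE fineK//; apply: integrable_fin_num => //; exact: Lap_integrable.
Qed.

Lemma LapD g h x : egrowth g -> egrowth h ->
  Lap (fun y => g y + h y) x = Lap g x + Lap h x.
Proof.
move=> gg gh; rewrite !LapE -RintegralD//; [|exact: Lap_integrable..].
by apply: eq_Rintegral => y _ /=; rewrite mulrDl.
Qed.

Lemma LapZ g (c : R) x : egrowth g -> Lap (fun y => c * g y) x = c * Lap g x.
Proof.
move=> gg; rewrite !LapE -RintegralZl//; last exact: Lap_integrable.
by apply: eq_Rintegral => y _ /=; rewrite mulrA.
Qed.

Lemma LapB g h x : egrowth g -> egrowth h ->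
  Lap (fun y => g y - h y) x = Lap g x - Lap h x.
Proof.
move=> gg gh; rewrite !LapE -RintegralB//; [|exact: Lap_integrable..].
by apply: eq_Rintegral => y _ /=; rewrite mulrBl.
Qed.

Lemma Lap_sum (g : 'I_d -> E -> R) x : (forall i, egrowth (g i)) ->
  Lap (fun y => \sum_(i < d) g i y) x = \sum_(i < d) Lap (g i) x.
Proof.
move=> gi; have : forall r : seq 'I_d, egrowth (fun y => \sum_(i <- r) g i y) /\
    Lap (fun y => \sum_(i <- r) g i y) x = \sum_(i <- r) Lap (g i) x.
  elim=> [|i r [IH1 IH2]].
    under eq_fun do rewrite big_nil; rewrite big_nil; split.
      exact: egrowth_cst.
    by have := @LapZ (fun=> 0) 0 x (egrowth_cst 0); rewrite !mul0r.
  under eq_fun do rewrite big_cons; rewrite big_cons; split.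
    exact: egrowthD.
  by rewrite LapD// IH2.
by move=> /(_ (index_enum _))[].
Qed.

Definition Lap_grad g x : E := \row_i Lap (fun y => g y * y 0 i) x.

Lemma dot_Lap_grad g x s : egrowth g ->
  dot (Lap_grad g x) s = Lap (fun y => g y * dot s y) x.
Proof.
move=> gg; under [in RHS]eq_fun do rewrite /dot mulr_sumr.
rewrite Lap_sum => [|i]; last first.
  by apply/egrowthM => //; apply: egrowthM (egrowth_cst _) (egrowth_coord _).
apply: eq_bigr => i _; rewrite mxE mulrC -LapZ; last first.
  by apply: egrowthM => //; exact: egrowth_coord.
by congr Lap; apply/funext => y; ring.
Qed.

(** Integrates the second order bound on e^{s.y}. Differentiability at a point would not need a
    constant uniform over an l1 ball, but the quadratic bound on ln L does. *)
Lemma Lap_remainder g (r : R) : egrowth g -> exists K, forall x s,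
  norm1 x <= r -> norm1 s <= 1 ->
  `|Lap g (x + s) - Lap g x - dot (Lap_grad g x) s| <= K * norm1 s ^+ 2.
Proof.
move=> gg.
(* In the exponent, r accounts for e^{x.y} and 1 for e^{|s.y|}. *)
pose k y := `|g y| * (enorm y ^+ 2 * expR ((r + 1) * enorm y)).
have gk : egrowth k.
  apply: egrowthM; first exact: egrowth_norm.
  by apply: egrowthM; [exact: egrowth_sqr_enorm|exact: egrowth_expR_enorm].
exists (\int[nu]_y k y) => x s xr s1.
have gs : egrowth (fun y => g y * dot s y).
  by apply: egrowthM => //; exact: egrowth_dot.
rewrite dot_Lap_grad// !LapE.
rewrite -RintegralB//; [|exact: Lap_integrable..].
rewrite -RintegralB//; last 2 first.
- have := integrableB measurableT (Lap_integrable (x + s) gg) (Lap_integrable x gg).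
  exact.
- exact: Lap_integrable.
have ik := egrowth_integrable gk.
rewrite -(RintegralZr _ measurableT ik).
have iI : nu.-integrable setT (EFin \o (fun y => g y * expR (dot (x + s) y)
   - g y * expR (dot x y) - g y * dot s y * expR (dot x y))).
  have := integrableB measurableT (integrableB measurableT
    (Lap_integrable (x + s) gg) (Lap_integrable x gg)) (Lap_integrable x gs).
  exact.
apply: (le_trans (le_normr_Rintegral measurableT iI)).
apply: le_Rintegral => //.
- exact: integrable_norm.
- have := integrableZr measurableT (norm1 s ^+ 2) ik; exact.
move=> y _; rewrite dotDl expRD.
have -> : g y * (expR (dot x y) * expR (dot s y)) - g y * expR (dot x y) -
  g y * dot s y * expR (dot x y) =
  g y * (expR (dot x y) * (expR (dot s y) - 1 - dot s y)) by ring.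
rewrite normrM /k -mulrA ler_wpM2l// normrM (gtr0_norm (expR_gt0 _)).
have e0 := enorm_ge0 y.
have dx : dot x y <= r * enorm y.
  apply: (le_trans (ler_norm _)); apply: (le_trans (dot_le_norm1 x y)).
  exact: ler_wpM2r.
have ds := dot_le_norm1 s y.
have ds1 : `|dot s y| <= enorm y.
  by apply: (le_trans ds); rewrite ler_piMl.
rewrite (@le_trans _ _ (expR (r * enorm y) *
   ((norm1 s * enorm y) ^+ 2 * expR (enorm y))))//.
  apply: ler_pM => //; rewrite ?expR_ge0 ?ler_expR//.
  apply: (le_trans (expR_remainder_le _)); apply: ler_pM => //.
  - exact: sqr_ge0.
  - rewrite -[X in X <= _]real_normK ?num_real//.
    by rewrite ler_sqr ?nnegrE// mulr_ge0// norm1_ge0.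
  - by rewrite ler_expR.
by rewrite mulrDl mul1r expRD exprMn le_eqVlt; apply/orP; left; apply/eqP; ring.
Qed.

Lemma Lap_differentiable g x : egrowth g ->
  differentiable (Lap g) x /\
  forall v, 'D_v (Lap g) x = Lap (fun y => g y * dot v y) x.
Proof.
move=> gg; have [K HK] := Lap_remainder (norm1 x) gg.
have [|D1 D2] := @differentiable_remainder R d (Lap g) (Lap_grad g x) x K.
  by move=> s s1; exact: HK.
by split => // v; rewrite D2 dot_Lap_grad.
Qed.

Lemma Lap_continuous g : egrowth g -> continuous (Lap g).
Proof.
move=> gg x; apply: differentiable_continuous.
by have [] := Lap_differentiable x gg.
Qed.

End laplace.

(** * The log-Laplace transform *)

Section integral_zero.
Context d (T : measurableType d) (R : realType).
Variable mu : {measure set T -> \bar R}.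

Lemma Rintegral_le0_ae_eq0 (u : T -> R) :
  mu.-integrable setT (EFin \o u) -> (forall x, 0 <= u x) ->
  \int[mu]_x u x <= 0 -> {ae mu, forall x, u x = 0}.
Proof.
move=> iu u0 ule0.
have Iu : (\int[mu]_x `|(EFin \o u) x| = 0)%E.
  rewrite (eq_integral (EFin \o u)) => [|x _].
    rewrite -[LHS]fineK; last exact: integrable_fin_num.
    congr EFin; apply/eqP; rewrite eq_le; apply/andP; split; first exact: ule0.
    by apply: fine_ge0; apply: integral_ge0 => x _; rewrite lee_fin.
  by rewrite /= ger0_norm.
have /(ae_eq_integral_abs mu measurableT) := Iu.
move=> /(_ (measurable_int mu iu)); apply: filterS => x /(_ I)[].
by [].
Qed.

End integral_zero.

Section log_laplace.
Context {R : realType} {d : nat}.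
Local Notation E := ('rV[R]_d).
Variable nu : probability E R.
Hypothesis nu_exp : exponential_moments nu.
Variable w : E -> R.
Hypothesis gw : egrowth w.
Hypothesis w_gt0 : forall y, 0 < w y.
Implicit Types (g h : E -> R) (x s : E).
Local Notation Lap := (Lap nu).

Lemma Lap_weight_gt0 g x : egrowth g -> (forall y, 0 < g y) -> 0 < Lap g x.
Proof.
move=> gg g0; rewrite LapE ltNge; apply/negP => L0.
have p0 y : 0 < g y * expR (dot x y) by rewrite mulr_gt0// expR_gt0.
have := Rintegral_le0_ae_eq0 (Lap_integrable nu_exp x gg) (fun y => ltW (p0 y)) L0.
have nuT : ~ nu.-negligible setT.
  move=> [N [mN N0 TN]]; have NT : N = setT by apply/seteqP; split.
  by move: N0; rewrite NT probability_setT => /eqP; rewrite onee_eq0.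
move=> H; apply: nuT; apply: negligibleS H => y _ /= yN.
by have := p0 y; rewrite yN ltxx.
Qed.

Let L_gt0 x : 0 < Lap w x. Proof. exact: Lap_weight_gt0. Qed.

(** The barycenter of pi_x, as the logarithmic gradient of L. *)
Definition mean x : E := (Lap w x)^-1 *: Lap_grad nu w x.

Lemma dot_mean s x : dot s (mean x) = Lap (fun y => w y * dot s y) x / Lap w x.
Proof. by rewrite dotZr dotC dot_Lap_grad// mulrC. Qed.

Lemma mean_coord x i : mean x 0 i = Lap (fun y => w y * y 0 i) x / Lap w x.
Proof. by rewrite !mxE mulrC. Qed.

Lemma mean_continuous : continuous mean.
Proof.
apply: continuous_rV => i.
under [X in continuous X]eq_fun do rewrite mean_coord.
move=> x; apply: (@continuousM R E).
  apply: Lap_continuous => //; apply: egrowthM => //; exact: egrowth_coord.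
apply: (@continuousV R E); first by rewrite gt_eqF.
exact: Lap_continuous.
Qed.

(** Otherwise the nonnegative function w (e^v - 1 - v) e^{x.y}, with v = s.y - s.T(x), would have a
    nonpositive integral and vanish nu-almost everywhere; as e^v - 1 - v vanishes only at v = 0, nu
    would live on the hyperplane s.y = s.T(x). *)
Lemma log_laplace_tangent s x : ~ concentrated_on_hyperplane nu -> s != 0 ->
  ln (Lap w x) + dot s (mean x) < ln (Lap w (x + s)).
Proof.
move=> nu_hyp s0; rewrite ltNge; apply/negP => Lle.
set t := dot s (mean x) in Lle.
have Lle' : expR (- t) * Lap w (x + s) <= Lap w x.
  rewrite -(ler_ln (x := expR (- t) * _)) ?posrE ?mulr_gt0 ?expR_gt0//.
  by rewrite lnM ?posrE ?expR_gt0// expRK; lra.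
pose u y := w y * (expR (dot s y - t) - 1 - (dot s y - t)).
have ge : egrowth (fun y => expR (dot s y - t)).
  under eq_fun do rewrite expRD; apply: egrowthM; last exact: egrowth_cst.
  exact: egrowth_expR_dot.
have gd : egrowth (fun y => dot s y - t).
  apply: egrowthD; [exact: egrowth_dot|exact: egrowth_cst].
have gN1 : egrowth (fun y : E => -1 : R) by exact: egrowth_cst.
have gNd : egrowth (fun y => - (dot s y - t)).
  under eq_fun do rewrite -mulN1r; exact: egrowthM.
have gu : egrowth u by apply: egrowthM => //; apply: egrowthD => //; exact: egrowthD.
(* The linear part s.y - t has integral zero under w e^{x.y} nu, by the choice of t, and drops
   out. *)
have Lu : Lap u x = expR (- t) * Lap w (x + s) - Lap w x.
  have -> : Lap u x = Lap (fun y => w y * expR (dot s y - t)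
      - (w y + (w y * dot s y - t * w y))) x.
    by congr Lap; apply/funext => y; rewrite /u; ring.
  have gwt : egrowth (fun y => t * w y) by apply: egrowthM => //; exact: egrowth_cst.
  have gwd : egrowth (fun y => w y * dot s y) by apply: egrowthM => //; exact: egrowth_dot.
  have gwB : egrowth (fun y => w y * dot s y - t * w y).
    rewrite (_ : (fun _ => _) = (fun y => w y * (dot s y - t))); first exact: egrowthM.
    by apply/funext => y; ring.
  rewrite LapB//; [|exact: egrowthM|exact: egrowthD].
  rewrite LapD// LapB// LapZ//.
  have -> : Lap (fun y => w y * dot s y) x = t * Lap w x.
    by rewrite /t dot_mean divfK// gt_eqF.
  rewrite subrr addr0; congr (_ - _).
  rewrite !LapE -RintegralZl//; last exact: Lap_integrable.
  by apply: eq_Rintegral => y _; rewrite dotDl !expRD; ring.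
have u0 y : 0 <= u y * expR (dot x y).
  by rewrite mulr_ge0 ?expR_ge0// mulr_ge0 ?expR_remainder_ge0// ltW.
have := Rintegral_le0_ae_eq0 (Lap_integrable nu_exp x gu) u0.
rewrite -LapE Lu subr_le0 => /(_ Lle') ae0.
apply: nu_hyp; exists s, t; split => //.
have mH : measurable [set y | dot s y = t].
  have := (egrowth_dot s).1 measurableT [set t] (measurable_set1 t).
  by rewrite setTI.
suff : nu (~` [set y | dot s y = t]) = 0%E.
  move=> H; have := probability_setC nu (measurableC mH).
  by rewrite setCK H sube0.
apply/negligibleP; first exact: measurableC.
apply: negligibleS ae0 => y /= yt yN; apply: yt.
apply/eqP; rewrite -subr_eq0; apply/negPn/negP => n0.
have : 0 < u y * expR (dot x y).
  by rewrite mulr_gt0 ?expR_gt0// mulr_gt0// expR_remainder_gt0.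
by rewrite yN ltxx.
Qed.

(** The inequality ln q <= q - 1 for q = L(x + s) / L(x) reduces this to the remainder of L, divided
    by L(x); what is needed in addition is a uniform lower bound for L. *)
Lemma log_laplace_quadratic (r : R) : exists2 K, 0 <= K & forall x s,
  norm1 x <= r -> norm1 s <= 1 ->
  ln (Lap w (x + s)) - ln (Lap w x) - dot s (mean x) <= K * norm1 s ^+ 2.
Proof.
have [K HK] := Lap_remainder nu_exp r gw.
have gwr : egrowth (fun y => w y * expR (- r * enorm y)).
  by apply: egrowthM => //; exact: egrowth_expR_enorm.
(* On the l1 ball of radius r, e^{x.y} >= e^{- r |y|}, so c bounds L from below. *)
pose c := Lap (fun y => w y * expR (- r * enorm y)) 0.
have c0 : 0 < c by apply: Lap_weight_gt0 => // y; rewrite mulr_gt0 ?expR_gt0.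
exists (`|K| / c) => [|x s xr s1]; first by rewrite divr_ge0// ltW.
have cL : c <= Lap w x.
  rewrite /c !LapE; apply: le_Rintegral => //; [exact: Lap_integrable..|move=> y _].
  rewrite dot0l expR0 mulr1 ler_wpM2l ?(ltW (w_gt0 _))// ler_expR mulNr.
  have := dot_le_norm1 x y; rewrite ler_norml => /andP[+ _].
  have : norm1 x * enorm y <= r * enorm y by rewrite ler_wpM2r ?enorm_ge0.
  lra.
have Lx := L_gt0 x; have Lxs := L_gt0 (x + s).
rewrite -ln_div ?posrE//.
have := HK x s xr s1; rewrite dotC => /(le_trans (ler_norm _)) Hs.
have e1 : dot s (Lap_grad nu w x) = dot s (mean x) * Lap w x.
  by rewrite dotZr mulrC mulrA divff ?mul1r// gt_eqF.
have h1 : ln (Lap w (x + s) / Lap w x) <= Lap w (x + s) / Lap w x - 1.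
  have q0 : 0 < Lap w (x + s) / Lap w x by rewrite divr_gt0.
  have := expR_ge1Dx (ln (Lap w (x + s) / Lap w x)).
  by rewrite lnK ?posrE//; lra.
have h2 : Lap w (x + s) / Lap w x - 1 - dot s (mean x) <= K * norm1 s ^+ 2 / Lap w x.
  rewrite ler_pdivlMr// !mulrBl mul1r divfK ?gt_eqF// -e1.
  exact: Hs.
have h3 : K * norm1 s ^+ 2 / Lap w x <= `|K| / c * norm1 s ^+ 2.
  apply: (@le_trans _ _ (`|K| * norm1 s ^+ 2 / Lap w x)).
    apply: ler_wpM2r; first by rewrite invr_ge0 ltW.
    by apply: ler_wpM2r; [exact: sqr_ge0|exact: ler_norm].
  rewrite [leRHS]mulrAC; apply: ler_wpM2l; first by rewrite mulr_ge0// sqr_ge0.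
  by rewrite lef_pV2 ?posrE.
lra.
Qed.

(* A class of functions stable under partial derivatives: this is what makes
   all derivatives of [- ln (Lap w)] continuous. *)
Inductive lap_class : (E -> R) -> Prop :=
| lap_class_Lap g : egrowth g -> lap_class (Lap g)
| lap_class_inv : lap_class (fun x => (Lap w x)^-1)
| lap_class_opp u : lap_class u -> lap_class (- u)
| lap_class_add u v : lap_class u -> lap_class v -> lap_class (u + v)
| lap_class_mul u v : lap_class u -> lap_class v -> lap_class (u * v).

Lemma lap_class_differentiable u : lap_class u -> forall x, differentiable u x.
Proof.
elim=> [g gg x||v _ IH x|v1 v2 _ IH1 _ IH2 x|v1 v2 _ IH1 _ IH2 x].
- by have [] := Lap_differentiable nu_exp x gg.
- move=> x; apply: differentiableV; last by rewrite gt_eqF.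
  by have [] := Lap_differentiable nu_exp x gw.
- exact: differentiableN.
- exact: differentiableD.
- exact: differentiableM.
Qed.

Lemma lap_class_derive u i : lap_class u -> lap_class ('D_(basis_vec i) u).
Proof.
have gd g : egrowth g -> egrowth (fun y => g y * dot (basis_vec i) y).
  by move=> gg; apply: egrowthM => //; exact: egrowth_dot.
have DLap g : egrowth g ->
    'D_(basis_vec i) (Lap g) = Lap (fun y => g y * dot (basis_vec i) y).
  by move=> gg; apply/funext => x; have [_ ->] := Lap_differentiable nu_exp x gg.
elim=> [g gg||v lv IH|v1 v2 l1 IH1 l2 IH2|v1 v2 l1 IH1 l2 IH2].
- by rewrite DLap//; apply/lap_class_Lap/gd.
- rewrite (_ : 'D__ _ = - ((fun x => (Lap w x)^-1) * (fun x => (Lap w x)^-1) *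
      Lap (fun y => w y * dot (basis_vec i) y))).
    apply/lap_class_opp/lap_class_mul; last exact/lap_class_Lap/gd.
    by apply: lap_class_mul; exact: lap_class_inv.
  apply/funext => x; rewrite deriveV; [|by rewrite gt_eqF|]; last first.
    by apply: diff_derivable; have [] := Lap_differentiable nu_exp x gw.
  rewrite (Lap_differentiable nu_exp x gw).2.
  by rewrite /= expr2 invfM /GRing.scale/= mulNr.
- rewrite (_ : 'D__ _ = - 'D_(basis_vec i) v); first exact: lap_class_opp.
  by apply/funext => x; rewrite deriveN//; apply/diff_derivable/lap_class_differentiable.
- rewrite (_ : 'D__ _ = 'D_(basis_vec i) v1 + 'D_(basis_vec i) v2).
    exact: lap_class_add.
  by apply/funext => x; rewrite deriveD//; apply/diff_derivable/lap_class_differentiable.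
- rewrite (_ : 'D__ _ = v1 * 'D_(basis_vec i) v2 + v2 * 'D_(basis_vec i) v1).
    by apply: lap_class_add; exact: lap_class_mul.
  by apply/funext => x; rewrite deriveM//; apply/diff_derivable/lap_class_differentiable.
Qed.

Lemma lap_class_smooth u : lap_class u -> smooth u.
Proof.
move=> lu n; elim: n u lu => [u lu x|n IH u lu].
  exact/differentiable_continuous/lap_class_differentiable.
split=> [|i]; first exact: lap_class_differentiable.
exact/IH/lap_class_derive.
Qed.

Lemma log_laplace_differentiable x :
  differentiable (fun z => - ln (Lap w z)) x /\
  forall v, 'D_v (fun z => - ln (Lap w z)) x = - dot v (mean x).
Proof.
have [dL DL] := Lap_differentiable nu_exp x gw.
have dln : differentiable (@ln R) (Lap w x).
  apply/derivable1_diffP; apply: ex_derive; exact: is_derive1_ln.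
have dc : differentiable (@ln R \o Lap w) x by exact: differentiable_comp.
have dcN := differentiableN dc.
split=> // v; rewrite (_ : (fun _ => _) = - (@ln R \o Lap w))//.
rewrite deriveN; last exact: diff_derivable.
congr (- _); rewrite deriveE// diff_comp//= -(deriveE v dL) DL dot_mean.
rewrite diff1E//=; last first.
by rewrite derive1E (derive_val (is_derive := is_derive1_ln (L_gt0 x))).
Qed.

Lemma gradient_log_laplace x : gradient (fun z => - ln (Lap w z)) x = - mean x.
Proof.
apply/rowP => i; rewrite !mxE (log_laplace_differentiable x).2 dot_basis.
by rewrite !mxE.
Qed.

(** The logarithm is not among the generators of [lap_class], but the first partial derivatives of
    ln L are quotients in that class: hence one differentiation by hand. *)
Lemma log_laplace_smooth : smooth (fun z => - ln (Lap w z)).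
Proof.
move=> [|n].
  by move=> x; apply: differentiable_continuous; have [] := log_laplace_differentiable x.
split=> [x|i]; first by have [] := log_laplace_differentiable x.
apply: lap_class_smooth; rewrite (_ : 'D__ _ =
  - (Lap (fun y => w y * y 0 i) * (fun x => (Lap w x)^-1))).
  apply/lap_class_opp/lap_class_mul; last exact: lap_class_inv.
  by apply: lap_class_Lap; apply: egrowthM => //; exact: egrowth_coord.
apply/funext => x; rewrite (log_laplace_differentiable x).2 dot_basis.
by rewrite mean_coord.
Qed.

Lemma hessian_log_laplace x : hessian (fun z => - ln (Lap w z)) x =
  - \matrix_(i, j) (Lap (fun y => w y * ((y 0 i - mean x 0 i) * (y 0 j - mean x 0 j))) x
                    / Lap w x).
Proof.
apply/matrixP => i j; rewrite [LHS]mxE [RHS]mxE [X in - X]mxE.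
have gi k : egrowth (fun y => w y * y 0 k).
  by apply: egrowthM => //; exact: egrowth_coord.
have gij : egrowth (fun y => w y * y 0 i * y 0 j).
  by apply: egrowthM => //; exact: egrowth_coord.
rewrite (_ : 'D_(basis_vec j) _ =
  - (Lap (fun y => w y * y 0 j) * (fun x => (Lap w x)^-1))); last first.
  apply/funext => z; rewrite (log_laplace_differentiable z).2 dot_basis.
  by rewrite mean_coord.
have D1 g : egrowth g -> derivable (Lap g) x (basis_vec i).
  by move=> gg; apply: diff_derivable; have [] := Lap_differentiable nu_exp x gg.
have D2 : derivable (fun x => (Lap w x)^-1) x (basis_vec i).
  apply/diff_derivable/lap_class_differentiable; exact: lap_class_inv.
rewrite deriveN; last by apply: derivableM => //; exact: D1.
rewrite deriveM//; last exact: D1.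
rewrite deriveV ?gt_eqF//; last exact: D1.
rewrite (Lap_differentiable nu_exp x gw).2 (Lap_differentiable nu_exp x (gi j)).2.
congr (- _).
set mi := mean x 0 i; set mj := mean x 0 j.
have -> : Lap (fun y => w y * dot (basis_vec i) y) x = mi * Lap w x.
  rewrite /mi mean_coord divfK ?gt_eqF//.
  by congr Lap; apply/funext => y; rewrite dot_basis.
have -> : Lap (fun y => w y * y 0 j * dot (basis_vec i) y) x =
    Lap (fun y => w y * y 0 i * y 0 j) x.
  by congr Lap; apply/funext => y; rewrite dot_basis; ring.
have Ej : Lap (fun y => w y * y 0 j) x = mj * Lap w x.
  by rewrite /mj mean_coord divfK ?gt_eqF.
have Ei : Lap (fun y => w y * y 0 i) x = mi * Lap w x.
  by rewrite /mi mean_coord divfK ?gt_eqF.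
have gZ (c : R) g : egrowth g -> egrowth (fun y => c * g y).
  by move=> gg; apply: egrowthM => //; exact: egrowth_cst.
have -> : Lap (fun y => w y * ((y 0 i - mi) * (y 0 j - mj))) x =
  Lap (fun y => w y * y 0 i * y 0 j + (- mj * (w y * y 0 i) +
    (- mi * (w y * y 0 j) + mi * mj * w y))) x.
  by congr Lap; apply/funext => y; ring.
have g3 : egrowth (fun y => - mi * (w y * y 0 j) + mi * mj * w y).
  by apply: egrowthD; exact: gZ.
have g2 : egrowth (fun y => - mj * (w y * y 0 i) +
    (- mi * (w y * y 0 j) + mi * mj * w y)).
  by apply: egrowthD => //; exact: gZ.
rewrite LapD// LapD//; last exact: gZ.
rewrite LapD//; [|exact: gZ|exact: gZ].
rewrite !LapZ// Ej Ei /GRing.scale/=.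
by field; rewrite gt_eqF.
Qed.

End log_laplace.

(** * Densities, relative entropy and Gibbs' inequality *)

Section measure_tools.
Context {R : realType}.
Local Open Scope ereal_scope.
Import HBNNSimple.

(** Densities and disintegrations are both mixtures: of the masses z(x) times the Dirac measure at
    x, and of the images of k x under y -> (x, y). The approximation by simple functions is
    therefore carried out once, here. *)
Lemma ge0_integral_mixture d1 d2 (X : measurableType d1) (Z : measurableType d2)
    (mu : {measure set X -> \bar R}) (k : X -> {measure set Z -> \bar R})
    (M : {measure set Z -> \bar R}) (f : Z -> \bar R) :
  (forall U, measurable U -> measurable_fun setT (k ^~ U)) ->
  (forall U, measurable U -> M U = \int[mu]_x k x U) ->
  (forall z, 0 <= f z) -> measurable_fun setT f ->
  \int[M]_z f z = \int[mu]_x \int[k x]_z f z.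
Proof.
move=> mk Mk f0 mf.
have nnsfunP (h : {nnsfun Z >-> R}) :
    \int[M]_z (h z)%:E = \int[mu]_x \int[k x]_z (h z)%:E.
  rewrite integralT_nnsfun sintegralE.
  under [in RHS]eq_integral do rewrite integralT_nnsfun sintegralE.
  rewrite ge0_integral_fsum//; last 2 first.
  - by move=> r; apply: measurable_funeM; exact: mk.
  - move=> r x _; have [r0|r0] := leP 0%R r; first by rewrite mule_ge0.
    by rewrite preimage_nnfun0// measure0 mule0.
  apply: eq_fsbigr => r _; have [r0|r0] := leP 0%R r.
    by rewrite ge0_integralZl//; [rewrite Mk|exact: mk].
  rewrite preimage_nnfun0// measure0 mule0 integral0_eq// => x _.
  by rewrite measure0 mule0.
pose f_ := nnsfun_approx measurableT mf.
have fE z : lim ((f_ n z)%:E @[n --> \oo]) = f z.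
  by apply/cvg_lim => //; exact: cvg_nnsfun_approx.
have limE (m : {measure set Z -> \bar R}) :
    \int[m]_z f z = lim ((\int[m]_z (f_ n z)%:E) @[n --> \oo]).
  rewrite -monotone_convergence//.
  - by apply: eq_integral => z _; rewrite fE.
  - by move=> n; exact/measurable_EFinP.
  - by move=> n z _; rewrite lee_fin.
  - by move=> z _ a b ab; rewrite lee_fin; exact/lefP/nd_nnsfun_approx.
under [in RHS]eq_integral do rewrite limE.
rewrite limE monotone_convergence//.
- by congr (lim (_ @ \oo)); apply/funext => n; exact: nnsfunP.
- move=> n; apply: measurable_fun_integral_kernel => //.
  + by move=> z; rewrite lee_fin.
  + exact/measurable_EFinP.
- by move=> n x _; apply: integral_ge0 => z _; rewrite lee_fin.
- move=> x _ a b ab; apply: ge0_le_integral => //.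
  + by move=> z _; rewrite lee_fin.
  + exact/measurable_EFinP.
  + exact/measurable_EFinP.
  + by move=> z _; rewrite lee_fin; exact/lefP/nd_nnsfun_approx.
Qed.

Section one_space.
Context d (T : measurableType d).
Implicit Types (S Q : {measure set T -> \bar R}).

Lemma ge0_integral_density S Q (z : T -> R) (f : T -> \bar R) :
  (forall x, 0 <= z x)%R -> measurable_fun setT z ->
  (forall U, measurable U -> Q U = \int[S]_(x in U) (z x)%:E) ->
  (forall x, 0 <= f x) -> measurable_fun setT f ->
  \int[Q]_x f x = \int[S]_x (f x * (z x)%:E).
Proof.
move=> z0 mz QE f0 mf.
pose k x : {measure set T -> \bar R} := mscale (NngNum (z0 x)) (dirac x).
have kE x U : k x U = (z x)%:E * (\1_U x)%:E by [].
rewrite (@ge0_integral_mixture _ _ _ _ S k)//.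
- apply: eq_integral => x _; rewrite ge0_integral_mscale// integral_dirac//.
  by rewrite diracT mul1e muleC.
- move=> U mU; apply: emeasurable_funM; first exact/measurable_EFinP.
  by apply/measurable_EFinP; exact: measurable_indic.
- move=> U mU; rewrite QE// integral_mkcond; apply: eq_integral => x _.
  rewrite kE patchE indicE; case: ifP => _; rewrite ?mule1 ?mule0//.
Qed.

Lemma integrable_density S Q (z : T -> R) (f : T -> R) :
  (forall x, 0 <= z x)%R -> measurable_fun setT z ->
  (forall U, measurable U -> Q U = \int[S]_(x in U) (z x)%:E) ->
  measurable_fun setT f ->
  S.-integrable setT (EFin \o (fun x => f x * z x)%R) ->
  Q.-integrable setT (EFin \o f) /\
  \int[Q]_x (f x)%:E = \int[S]_x (f x * z x)%:E.
Proof.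
move=> z0 mz QE mf fzi; have mEf : measurable_fun setT (EFin \o f).
  exact/measurable_EFinP.
split.
  apply/integrableP; split => //.
  rewrite (ge0_integral_density z0 mz QE)//; last exact: measurableT_comp.
  have /integrableP[_] := fzi.
  rewrite [X in (X < _)%E -> _](eq_integral (fun x => `|(EFin \o f) x| * (z x)%:E))//.
  by move=> x _ /=; rewrite normrM (ger0_norm (z0 x)).
rewrite integralE [RHS]integralE; congr (_ - _).
  rewrite (ge0_integral_density z0 mz QE)//; last exact: measurable_funepos.
  apply: eq_integral => x _; rewrite !funeposE; have [f0|f0] := leP 0%R (f x).
    by rewrite !max_l ?lee_fin// mulr_ge0.
  by rewrite !max_r ?mul0e ?lee_fin ?mulr_le0_ge0// ltW.
rewrite (ge0_integral_density z0 mz QE)//; last exact: measurable_funeneg.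
apply: eq_integral => x _; rewrite !funenegE; have [f0|f0] := leP (f x) 0%R.
  by rewrite !max_l -?EFinM ?mulNr// ?lee_fin ?oppr_ge0// mulr_le0_ge0.
by rewrite !max_r ?mul0e ?lee_fin ?oppr_le0 ?mulr_ge0// ltW.
Qed.

(** No integrability of F is assumed: it is applied to log-densities and conjugates that may be
    infinite. Replacing F by max(u, F) makes the bound hold everywhere, so that it passes to the
    positive and negative parts. *)
Lemma le_integral_ae S (u F : T -> \bar R) :
  S.-integrable setT u -> measurable_fun setT F ->
  {ae S, forall x, u x <= F x} -> \int[S]_x u x <= \int[S]_x F x.
Proof.
move=> iu mF uF; have mu := measurable_int S iu.
have mM : measurable_fun setT (fun x => maxe (u x) (F x)) by exact: measurable_maxe.
have -> : \int[S]_x F x = \int[S]_x maxe (u x) (F x).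
  apply: ae_eq_integral => //; apply: filterS uF => x uFx _.
  by rewrite max_r.
have uM x : u x <= maxe (u x) (F x) by rewrite le_max lexx.
rewrite integralE [leRHS]integralE leeB//.
  apply: ge0_le_integral => //; [exact: measurable_funepos|exact: measurable_funepos|].
  by move=> x _; rewrite !funeposE ge_max; apply/andP; split; rewrite le_max ?uM// lexx orbT.
apply: ge0_le_integral => //; [exact: measurable_funeneg|exact: measurable_funeneg|].
by move=> x _; rewrite !funenegE ge_max; apply/andP; split; rewrite le_max ?leeN2 ?uM// lexx orbT.
Qed.

Lemma measurable_lne_EFin (z : T -> R) :
  measurable_fun setT z -> measurable_fun setT (fun x => lne (z x)%:E).
Proof.
move=> mz; rewrite (_ : (fun _ => _) =
    (fun x => if (z x <= 0)%R then -oo else (ln (z x))%:E))//.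
apply: measurable_fun_ifT => //.
  by apply: measurable_fun_ler.
by apply/measurable_EFinP; exact: measurableT_comp (@measurable_ln R) mz.
Qed.

Lemma measurable_expeR (f : T -> \bar R) :
  measurable_fun setT f -> measurable_fun setT (fun x => expeR (f x)).
Proof.
move=> mf; rewrite (_ : (fun _ => _) = (fun x => if f x == -oo then 0 else
    if f x == +oo then +oo else (expR (fine (f x)))%:E)); last first.
  by apply/funext => x; case: (f x).
have mset (y : \bar R) : measurable_fun setT (fun x => f x == y).
  apply: (measurable_fun_bool true); rewrite setTI.
  have := mf measurableT [set y] (emeasurable_set1 y); rewrite setTI.
  by congr measurable; apply/seteqP; split => x /= /eqP.
apply: measurable_fun_ifT => //; apply: measurable_fun_ifT => //.
apply/measurable_EFinP; apply: measurableT_comp => //.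
exact: measurableT_comp (fine_measurable measurableT) mf.
Qed.

End one_space.

Section entropy.
Context d (T : measurableType d).
Implicit Types (S Q : probability T R).

Lemma null_dominates_measure0 (S Q : {measure set T -> \bar R}) (N : set T) :
  Q `<< S -> measurable N -> S N = 0 -> Q N = 0.
Proof.
move=> QS mN N0; apply/(measure0_null_setP Q mN)/QS.
exact/(measure0_null_setP S mN).
Qed.

Lemma integral_probability_cst (P : probability T R) (c : R) :
  \int[P]_x c%:E = c%:E.
Proof.
have := integral_cst P measurableT c%:E; rewrite /cst => ->.
by rewrite -[RHS]mule1; congr (_ * _); exact: probability_setT.
Qed.

(** The Radon-Nikodym derivative is e^k S-almost everywhere, hence Q-almost everywhere; the two
    integrands then agree, so k need not be integrable. *)
Lemma entropy_density S Q (k : T -> R) : measurable_fun setT k ->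
  (forall C, measurable C -> Q C = \int[S]_(x in C) (expR (k x))%:E) ->
  entropy Q S = \int[Q]_x (k x)%:E.
Proof.
move=> mk QE.
have QS : Q `<< S.
  move=> A SA0 B mB BA; rewrite QE//; have {SA0} := SA0 B mB BA => SA0.
  apply: null_set_integral => //; apply: measurable_funTS; apply/measurable_EFinP.
  exact: measurableT_comp.
rewrite /entropy; case: pselect => // QS'.
apply: ae_eq_integral => //.
- rewrite (_ : (fun _ => _) = (fun x => lne (fine
      (Radon_Nikodym (charge_of_finite_measure Q) S x))%:E)); last first.
    by apply/funext => x; rewrite fineK// Radon_Nikodym_fin_num.
  apply: measurable_lne_EFin.
  have iRN : S.-integrable setT (Radon_Nikodym (charge_of_finite_measure Q) S).
    exact: Radon_Nikodym_integrable.
  apply: (measurableT_comp (fine_measurable measurableT)).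
  exact: measurable_int iRN.
- exact/measurable_EFinP.
have : ae_eq S setT (Radon_Nikodym (charge_of_finite_measure Q) S)
    (fun x => (expR (k x))%:E).
  apply: integral_ae_eq => //.
  - exact: Radon_Nikodym_integrable.
  - by apply/measurable_EFinP; exact: measurableT_comp.
  - by move=> C _ mC; rewrite -Radon_Nikodym_integral//=; exact: QE.
move=> [N [mN N0 Nsub]]; exists N; split=> //.
  exact: (null_dominates_measure0 QS).
apply: subset_trans Nsub => x /= H1 H2; apply: H1 => _.
by rewrite H2// lne_EFin ?expR_gt0// expRK.
Qed.

(** With z = dQ/dS, the inequality 1 + v <= e^v at v = k - ln z gives k + 1 - e^k / z <= ln z.
    Integrating against Q, the term e^k / z contributes at most int e^k dS, which does not exceed
    1. *)
Lemma gibbs S Q (k : T -> R) : Q.-integrable setT (EFin \o k) ->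
  \int[S]_x (expR (k x))%:E <= 1 -> \int[Q]_x (k x)%:E <= entropy Q S.
Proof.
move=> ik k1; rewrite /entropy; case: pselect => /= [QS|_]; last exact: leey.
have mk : measurable_fun setT k by apply/measurable_EFinP; exact: measurable_int ik.
pose z x := fine (Radon_Nikodym_SigmaFinite.f Q S x).
have zE x : (z x)%:E = Radon_Nikodym_SigmaFinite.f Q S x.
  by rewrite fineK// Radon_Nikodym_SigmaFinite.f_fin_num.
have z0 x : (0 <= z x)%R.
  by rewrite -lee_fin zE Radon_Nikodym_SigmaFinite.f_ge0.
have mz : measurable_fun setT z.
  apply: measurableT_comp (fine_measurable measurableT) _.
  exact: measurable_int (Radon_Nikodym_SigmaFinite.f_integrable QS).
have QE U : measurable U -> Q U = \int[S]_(x in U) (z x)%:E.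
  move=> mU; rewrite (Radon_Nikodym_SigmaFinite.f_integral QS)//.
  by apply: eq_integral => x _; rewrite zE.
have mRN : measurable_fun setT (fun x => lne (Radon_Nikodym (charge_of_finite_measure Q) S x)).
  rewrite (_ : (fun _ => _) = (fun x => lne (fine
      (Radon_Nikodym (charge_of_finite_measure Q) S x))%:E)); last first.
    by apply/funext => x; rewrite fineK// Radon_Nikodym_fin_num.
  apply: measurable_lne_EFin.
  have iRN : S.-integrable setT (Radon_Nikodym (charge_of_finite_measure Q) S).
    exact: Radon_Nikodym_integrable.
  apply: (measurableT_comp (fine_measurable measurableT)).
  exact: measurable_int iRN.
(* This is e^k / z where z is positive; at a zero of z the product v z vanishes, whatever the value
   given to ln. *)
pose v x := expR (k x - ln (z x))%R.
have v0 x : (0 <= v x)%R by exact: expR_ge0.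
have mv : measurable_fun setT v.
  apply: measurableT_comp => //; apply: measurable_funB => //.
  exact: measurableT_comp (@measurable_ln R) mz.
have v1 : \int[Q]_x (v x)%:E <= 1.
  rewrite (ge0_integral_density z0 mz QE)//; last exact/measurable_EFinP.
  apply: le_trans k1; apply: ge0_le_integral => //.
  - by move=> x _; rewrite mule_ge0 ?lee_fin ?v0 ?z0.
  - by apply: emeasurable_funM; exact/measurable_EFinP.
  - by apply/measurable_EFinP; exact: measurableT_comp.
  move=> x _; rewrite -EFinM lee_fin /v.
  have [->|zn0] := eqVneq (z x) 0%R; first by rewrite mulr0 expR_ge0.
  by rewrite expRB lnK ?divfK// posrE lt_neqAle eq_sym zn0 z0.
have iv : Q.-integrable setT (EFin \o v).
  apply/integrableP; split; first exact/measurable_EFinP.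
  rewrite (eq_integral (EFin \o v)) => [|x _]; last by rewrite /= ger0_norm.
  exact: le_lt_trans v1 (ltry _).
pose u := (EFin \o k) \+ (cst 1 \- (EFin \o v)).
have i1 : Q.-integrable setT (cst 1 : T -> \bar R).
  exact: (finite_measure_integrable_cst Q (1%R)).
have i1v : Q.-integrable setT (cst 1 \- (EFin \o v)) by exact: integrableB.
have iu : Q.-integrable setT u by exact: integrableD.
apply: (@le_trans _ _ (\int[Q]_x u x)).
  have -> : \int[Q]_x u x = \int[Q]_x (k x)%:E + (1 - \int[Q]_x (v x)%:E).
    have := integralD measurableT ik i1v; rewrite /u => ->; congr (_ + _).
    have := integralB measurableT i1 iv => ->; congr (_ - _).
    exact: integral_probability_cst.
  rewrite -[leLHS]adde0 leeD2l// sube_ge0//.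
  by rewrite orbT.
apply: le_integral_ae => //.
have [N [mN N0 Nsub]] := ae_eq_Radon_Nikodym_SigmaFinite QS measurableT.
have mz0 : measurable [set x | z x = 0%R].
  by have := mz measurableT [set 0%R] (measurable_set1 0%R); rewrite setTI.
exists (N `|` [set x | z x = 0%R]); split.
- exact: measurableU.
- apply/eqP; rewrite -measure_le0 (le_trans (measureU2 _ _ _))//.
  have QN : Q N = 0 by exact: (null_dominates_measure0 QS).
  have QZ : Q [set x | z x = 0%R] = 0.
    by rewrite QE// integral0_eq// => x /= ->.
  by rewrite [X in X + _]QN [X in _ + X]QZ adde0.
move=> x /= ux; apply: contrapT => /not_orP[xN zx0]; apply: ux.
have zx : (0 < z x)%R by rewrite lt_neqAle z0 andbT eq_sym; exact/eqP.
have -> : Radon_Nikodym (charge_of_finite_measure Q) S x = (z x)%:E.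
  rewrite zE; apply: esym; apply: contrapT => H; apply: xN; apply: Nsub => /=.
  by move=> H'; apply: H; exact: H'.
rewrite lne_EFin// lee_fin /v.
have := expR_ge1Dx (k x - ln (z x)); lra.
Qed.

End entropy.

End measure_tools.

(** * Borel sets of R^d and disintegrations *)

Section borel_rV.
Context {R : realType} {d : nat}.
Local Notation E := ('rV[R]_d).

(** The index type is countable, so an almost sure statement about each box holds almost surely for
    all of them together. *)
Definition rat_box (p : 'rV[rat]_d * 'rV[rat]_d) : set E :=
  [set y | forall i, ratr (p.1 0 i) < y 0 i < ratr (p.2 0 i)].

Lemma measurable_rat_box p : measurable (rat_box p).
Proof.
rewrite (_ : rat_box p = \bigcap_(i in [set: 'I_d])
    ((fun y : E => y 0 i) @^-1` `]ratr (p.1 0 i), ratr (p.2 0 i)[)).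
  apply: fin_bigcap_measurable => // i _.
  have := @measurable_coord R d i measurableT _ (measurable_itv `]ratr (p.1 0 i), ratr (p.2 0 i)[).
  by rewrite setTI.
apply/seteqP; split => y /= H i.
  by move=> _; rewrite /= in_itv/=; exact: H.
by have := H i I; rewrite /= in_itv.
Qed.

Lemma open_rat_box (U : set E) x : open U -> U x ->
  exists2 p, rat_box p x & rat_box p `<=` U.
Proof.
move=> oU Ux; have : nbhs x U by exact: open_nbhs_nbhs.
move=> /nbhs_ballP[e /= e0 eU].
have qa i : exists q : rat, x 0 i - e / 2 < ratr q < x 0 i.
  have [|q] := @rat_in_itvoo R (x 0 i - e / 2) (x 0 i); first by rewrite ltrBlDr ltrDl divr_gt0.
  by rewrite in_itv/=; exists q.
have qb i : exists q : rat, x 0 i < ratr q < x 0 i + e / 2.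
  have [|q] := @rat_in_itvoo R (x 0 i) (x 0 i + e / 2); first by rewrite ltrDl divr_gt0.
  by rewrite in_itv/=; exists q.
have [a Ha] := choice qa; have [b Hb] := choice qb.
exists (\row_i a i, \row_i b i).
  move=> i /=; rewrite !mxE.
  by have /andP[_ ->] := Ha i; have /andP[-> _] := Hb i.
move=> y By; apply: eU; split => // j i; rewrite ord1 {j}.
have := By i; rewrite /= !mxE => /andP[h1 h2].
have /andP[h3 h4] := Ha i; have /andP[h5 h6] := Hb i.
rewrite /ball/= ltr_norml; lra.
Qed.

Lemma measurable_rat_boxE : @measurable _ E = <<s range rat_box >>.
Proof.
apply/seteqP; split.
  apply: smallest_sub; first exact: smallest_sigma_algebra.
  move=> U oU; pose F p := if `[< rat_box p `<=` U >] then rat_box p else set0.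
  have -> : U = \bigcup_p F p.
    apply/seteqP; split => [x Ux|x [p _]].
      have [p px pU] := open_rat_box oU Ux; exists p => //.
      by rewrite /F; case: asboolP.
    by rewrite /F; case: asboolP => // pU; exact: pU.
  apply: (@countable_bigcupT_measurable _ (g_sigma_algebraType (range rat_box))).
    exact: countableP.
  move=> p; rewrite /F; case: asboolP => _; last exact: measurable0.
  by apply: sub_sigma_algebra; exists p.
apply: smallest_sub; first exact: sigma_algebra_measurable.
by move=> _ [p _ <-]; exact: measurable_rat_box.
Qed.

Lemma ratr_max (p q : rat) (t : R) :
  (ratr (Num.max p q) < t) = (ratr p < t) && (ratr q < t).
Proof.
have [pq|qp] := leP p q.
  by apply/idP/andP => [h|[]//]; split=> //; apply: le_lt_trans h; rewrite ler_rat.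
by apply/idP/andP => [h|[]//]; split=> //; apply: lt_trans h; rewrite ltr_rat.
Qed.

Lemma ratr_min (p q : rat) (t : R) :
  (t < ratr (Num.min p q)) = (t < ratr p) && (t < ratr q).
Proof.
have [pq|qp] := leP p q.
  by apply/idP/andP => [h|[]//]; split=> //; apply: (lt_le_trans h); rewrite ler_rat.
by apply/idP/andP => [h|[]//]; split=> //; apply: (lt_trans h); rewrite ltr_rat.
Qed.

Lemma setI_closed_rat_box : setI_closed (range rat_box).
Proof.
move=> _ _ [p _ <-] [q _ <-].
exists (\row_i Num.max (p.1 0 i) (q.1 0 i), \row_i Num.min (p.2 0 i) (q.2 0 i)) => //.
apply/seteqP; split => y /=.
  move=> H; split => i; have := H i; rewrite /= !mxE ratr_max ratr_min
    => /andP[/andP[h1 h2] /andP[h3 h4]]; by rewrite ?h1 ?h2 ?h3 ?h4.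
move=> [H1 H2] i; rewrite /= !mxE ratr_max ratr_min.
by have /andP[-> ->] := H1 i; have /andP[-> ->] := H2 i.
Qed.

Lemma bigcup_rat_box :
  \bigcup_n rat_box (const_mx (- n%:R), const_mx n%:R) = [set: E].
Proof.
apply/seteqP; split => // y _; exists (Num.truncn `|y|).+1 => // i /=.
have : `|y 0 i| < (Num.truncn `|y|).+1%:R.
  by rewrite (le_lt_trans (coord_le_norm y i))// truncnS_gt.
by rewrite ltr_norml !mxE raddfN/= ratr_nat.
Qed.

Lemma eq_measure_rat_box (m1 m2 : {measure set E -> \bar R}) :
  (m1 setT < +oo)%E -> (forall p, m1 (rat_box p) = m2 (rat_box p)) ->
  forall A, measurable A -> m1 A = m2 A.
Proof.
move=> m1oo m12 A mA.
apply: (measure_unique (range rat_box)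
  (fun n => rat_box (const_mx (- n%:R), const_mx n%:R))) => //.
- exact: measurable_rat_boxE.
- exact: setI_closed_rat_box.
- exact: bigcup_rat_box.
- by move=> _ [p _ <-]; exact: m12.
- move=> n; apply: le_lt_trans m1oo.
  by apply: le_measure; rewrite ?inE//; exact: measurable_rat_box.
Qed.

Lemma eq_probability_closed (m1 m2 : probability E R) :
  (forall F, closed F -> m1 F = m2 F) -> forall A, measurable A -> m1 A = m2 A.
Proof.
move=> m12 A mA; apply: (measure_unique (@open E) (fun=> setT)) => //.
- by move=> U V; exact: openI.
- by move=> _; exact: openT.
- by rewrite bigcup_const//; exists 0%N.
- move=> U oU; have mU := open_measurable_rV oU.
  have cU := open_closedC oU.
  have e (m : probability E R) : m U = (1 - m (~` U))%E.
    by have := probability_setC m (measurableC mU); rewrite setCK.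
  exact: etrans (e m1) (etrans (congr1 (fun t => 1 - t)%E (m12 _ cU)) (esym (e m2))).
- by move=> _; rewrite (le_lt_trans (probability_le1 _ _))// ltry.
Qed.

End borel_rV.

Section disintegration.
Context {R : realType} {d : nat}.
Local Notation E := ('rV[R]_d).
Variables (p : probability (E * E)%type R) (alpha : probability E R).
Local Open Scope ereal_scope.

Section one_kernel.
Variable k : R.-pker E ~> E.
Hypothesis pk : disintegration p alpha k.

Lemma measurable_kernel_xsection (U : set (E * E)) : measurable U ->
  measurable_fun setT (fun x => k x (xsection U x)).
Proof.
by move=> mU; apply: measurable_fun_xsection_finite_kernel; rewrite inE.
Qed.

(** A disintegration is defined on rectangles only; these form a generating pi-system, and a Dynkin
    argument reaches all measurable sets. *)
Lemma disintegration_xsection (U : set (E * E)) : measurable U ->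
  p U = \int[alpha]_x k x (xsection U x).
Proof.
have kfin x A : measurable A -> k x A \is a fin_num.
  move=> mA; rewrite ge0_fin_numE//.
  rewrite (@le_lt_trans _ _ (k x setT))//; last by rewrite prob_kernel ltry.
  by apply: le_measure; rewrite ?inE.
move=> mU; have : <<s [set A `*` B | A in @measurable _ E & B in @measurable _ E] >> U.
  by rewrite -measurable_prod_measurableType.
move: U {mU}; apply: dynkin_induction.
- exact: measurable_prod_measurableType.
- move=> _ _ [A1 mA1 [A2 mA2 <-]] [B1 mB1 [B2 mB2 <-]].
  exists (A1 `&` B1); first exact: measurableI.
  by exists (A2 `&` B2); [exact: measurableI|rewrite setXI].
- rewrite probability_setT (eq_integral (cst 1)) => [|x _].
    by rewrite integral_probability_cst.
  by rewrite xsectionE preimage_setT prob_kernel.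
- move=> _ [A mA [B mB <-]]; rewrite pk// integral_mkcond; apply: eq_integral => x _.
  rewrite patchE; case: ifPn => xA; first by rewrite in_xsectionX.
  by rewrite notin_xsectionX// measure0.
- move=> U mU IH; rewrite probability_setC// IH.
  have iU : alpha.-integrable setT (fun x => k x (xsection U x)).
    apply/integrableP; split; first exact: measurable_kernel_xsection.
    rewrite (eq_integral (fun x => k x (xsection U x))) => [|x _].
      by rewrite -IH (le_lt_trans (probability_le1 _ _))// ltry.
    by rewrite gee0_abs.
  have i1 : alpha.-integrable setT (cst 1 : E -> \bar R).
    exact: (finite_measure_integrable_cst alpha (1%R)).
  rewrite -[X in X - _](integral_probability_cst alpha 1).
  have := integralB measurableT i1 iU => <-; apply: eq_integral => x _ /=.
  have mUx := measurable_xsection x mU.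
  have -> : xsection (~` U) x = ~` (xsection U x) by rewrite !xsectionE.
  have koo : k x setT < +oo by rewrite prob_kernel ltry.
  have kC : k x (~` xsection U x) = k x setT - k x (xsection U x).
    by have := measureD measurableT mUx koo; rewrite setTD setTI.
  by rewrite kC prob_kernel.
- move=> F mF tF IH; rewrite measure_bigcup//.
  rewrite (eq_integral (fun x => \sum_(n <oo) k x (xsection (F n) x))); last first.
    move=> x _; rewrite xsection_bigcup measure_bigcup//.
    + by apply: eq_eseriesl => i; rewrite in_setT.
    + by move=> n _; exact: measurable_xsection.
    + exact: trivIset_xsection.
  rewrite integral_nneseries//; last by move=> n; exact: measurable_kernel_xsection.
  rewrite (eq_eseriesl (Q := xpredT)); last by move=> i; rewrite in_setT.
  by apply: eq_eseriesr => n _; exact: IH.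
Qed.

Lemma measurable_kernel_integral (f : E * E -> \bar R) :
  (forall z, 0 <= f z) -> measurable_fun setT f ->
  measurable_fun setT (fun x => \int[k x]_y f (x, y)).
Proof. by move=> f0 mf; exact: measurable_fun_integral_finite_kernel. Qed.

Lemma ge0_disintegration (f : E * E -> \bar R) :
  (forall z, 0 <= f z) -> measurable_fun setT f ->
  \int[p]_z f z = \int[alpha]_x \int[k x]_y f (x, y).
Proof.
move=> f0 mf; have mp x : measurable_fun setT (pair x : E -> E * E).
  exact: pair1_measurable.
pose kp x : {measure set (E * E) -> \bar R} := pushforward (k x) (pair x).
rewrite (@ge0_integral_mixture R _ _ _ _ alpha (kp mp))//.
- apply: eq_integral => x _; rewrite ge0_integral_pushforward//.
- move=> U mU; rewrite (_ : (fun _ => _) = (fun x => k x (xsection U x))).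
    exact: measurable_kernel_xsection.
  by apply/funext => x; rewrite /= /pushforward xsectionE.
- move=> U mU; rewrite [LHS]disintegration_xsection//; apply: eq_integral => x _.
  by rewrite /= /pushforward xsectionE.
Qed.

Lemma disintegration_integral (f : E * E -> R) : p.-integrable setT (EFin \o f) ->
  [/\ {ae alpha, forall x, (k x).-integrable setT (fun y => (f (x, y))%:E)},
      measurable_fun setT (fun x => \int[k x]_y (f (x, y))%:E) &
      \int[p]_z (f z)%:E = \int[alpha]_x \int[k x]_y (f (x, y))%:E].
Proof.
move=> fi; have mf := measurable_int p fi.
have mpos := measurable_funepos mf; have mneg := measurable_funeneg mf.
have pos := ge0_disintegration (fun z => funepos_ge0 (EFin \o f) z) mpos.
have neg := ge0_disintegration (fun z => funeneg_ge0 (EFin \o f) z) mneg.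
have mp := measurable_kernel_integral (fun z => funepos_ge0 (EFin \o f) z) mpos.
have mn := measurable_kernel_integral (fun z => funeneg_ge0 (EFin \o f) z) mneg.
have ip : alpha.-integrable setT (fun x => \int[k x]_y (EFin \o f)^\+ (x, y)).
  apply/integrableP; split => //.
  rewrite (eq_integral (fun x => \int[k x]_y (EFin \o f)^\+ (x, y))) => [|x _].
    by rewrite -pos; exact: integral_funepos_lt_pinfty.
  by rewrite gee0_abs// integral_ge0.
have inn : alpha.-integrable setT (fun x => \int[k x]_y (EFin \o f)^\- (x, y)).
  apply/integrableP; split => //.
  rewrite (eq_integral (fun x => \int[k x]_y (EFin \o f)^\- (x, y))) => [|x _].
    by rewrite -neg; exact: integral_funeneg_lt_pinfty.
  by rewrite gee0_abs// integral_ge0.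
have kE x : \int[k x]_y (f (x, y))%:E = \int[k x]_y (EFin \o f)^\+ (x, y) -
    \int[k x]_y (EFin \o f)^\- (x, y).
  rewrite [LHS]integralE/=; congr (_ - _); apply: eq_integral => y _.
    by rewrite !funeposE.
  by rewrite !funenegE.
split.
  have := integrable_ae measurableT ip; have := integrable_ae measurableT inn.
  move=> hn hp; apply: filterS2 hn hp => x /(_ I) hn /(_ I) hp.
  apply/integrableP; split.
    by apply: (measurableT_comp mf); exact: pair1_measurable.
  rewrite (eq_integral (fun y => (EFin \o f)^\+ (x, y) + (EFin \o f)^\- (x, y))).
    rewrite ge0_integralD//; last 2 first.
    - by apply: (measurableT_comp mpos); exact: pair1_measurable.
    - by apply: (measurableT_comp mneg); exact: pair1_measurable.
    by rewrite lte_add_pinfty// -ge0_fin_numE// integral_ge0.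
  by move=> y _; rewrite -[RHS]/((funepos (EFin \o f) \+ funeneg (EFin \o f)) (x, y)) -fune_abse.
  rewrite (_ : (fun _ => _) = (fun x => \int[k x]_y (EFin \o f)^\+ (x, y) -
      \int[k x]_y (EFin \o f)^\- (x, y))); first exact: emeasurable_funB.
  by apply/funext => x; rewrite kE.
rewrite integralE pos neg -integralB//; apply: eq_integral => x _.
by rewrite kE.
Qed.

End one_kernel.

(** For one set the kernels agree off a null set depending on it. The countably many rational boxes
    leave a single null set, off which two finite measures agree on a generating pi-system. *)
Lemma disintegration_unique (k1 k2 : R.-pker E ~> E) :
  disintegration p alpha k1 -> disintegration p alpha k2 ->
  {ae alpha, forall x B, measurable B -> k1 x B = k2 x B}.
Proof.
move=> H1 H2.
have H q : {ae alpha, forall x, k1 x (rat_box q) = k2 x (rat_box q)}.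
  have mk (k : R.-pker E ~> E) : measurable_fun setT (fun x => k x (rat_box q)).
    exact: (measurable_kernel k _ (measurable_rat_box q)).
  have := @integral_ae_eq _ _ _ alpha setT measurableT
    (fun x => k2 x (rat_box q)) (fun x => k1 x (rat_box q)).
  move=> /(_ _ (mk k2)) HH.
  have {HH} : ae_eq alpha setT (fun x => k1 x (rat_box q)) (fun x => k2 x (rat_box q)).
    apply: HH.
      apply: (@le_integrable _ _ _ alpha setT measurableT _ (cst 1)) => //.
        move=> x _; rewrite gee0_abs// (@le_trans _ _ (k1 x setT))//.
          by apply: le_measure; rewrite ?inE//; exact: measurable_rat_box.
        by rewrite prob_kernel gee0_abs.
      exact: (finite_measure_integrable_cst alpha (1%R)).
    move=> A _ mA; rewrite -H1// -?H2//; exact: measurable_rat_box.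
  by apply: filterS => x; exact.
have [|] := pselect True => // _.
pose P n x := if @unpickle ('rV[rat]_d * 'rV[rat]_d)%type n is Some q
  then k1 x (rat_box q) = k2 x (rat_box q) else True.
have /ae_foralln : forall n, {ae alpha, forall x, P n x}.
  move=> n; rewrite /P; case: unpickle => [q|]; first exact: H.
  exact: filterE.
apply: filterS => x Px B mB; apply: eq_measure_rat_box => //.
  by rewrite prob_kernel ltry.
by move=> q; have := Px (pickle q); rewrite /P pickleK.
Qed.

End disintegration.

(** * Couplings and concave conjugates *)

Section transport.
Context {R : realType}.
Local Open Scope ereal_scope.

Lemma ge0_image_integral d1 d2 (X : measurableType d1) (Y : measurableType d2)
    (P : {measure set X -> \bar R}) (Q : {measure set Y -> \bar R})
    (phi : X -> Y) (v : Y -> \bar R) :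
  measurable_fun setT phi ->
  (forall B, measurable B -> P (phi @^-1` B) = Q B) ->
  measurable_fun setT v -> (forall y, 0 <= v y) ->
  \int[P]_x v (phi x) = \int[Q]_y v y.
Proof.
move=> mphi PQ mv v0; transitivity (\int[pushforward P phi]_y v y).
  by rewrite ge0_integral_pushforward.
by apply: eq_measure_integral => B mB _; exact: PQ.
Qed.

Lemma image_integrable d1 d2 (X : measurableType d1) (Y : measurableType d2)
    (P : {measure set X -> \bar R}) (Q : {measure set Y -> \bar R})
    (phi : X -> Y) (u : Y -> R) :
  measurable_fun setT phi ->
  (forall B, measurable B -> P (phi @^-1` B) = Q B) ->
  measurable_fun setT u ->
  P.-integrable setT (EFin \o (fun x => u (phi x))) ->
  Q.-integrable setT (EFin \o u).
Proof.
move=> mphi PQ mu /integrableP[_ uoo].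
have mEu : measurable_fun setT (EFin \o u) by exact/measurable_EFinP.
apply/integrableP; split=> //.
rewrite -(ge0_image_integral (phi := phi) (P := P))//.
exact: measurableT_comp.
Qed.

Lemma image_integral d1 d2 (X : measurableType d1) (Y : measurableType d2)
    (P : {measure set X -> \bar R}) (Q : {measure set Y -> \bar R})
    (phi : X -> Y) (u : Y -> R) :
  measurable_fun setT phi ->
  (forall B, measurable B -> P (phi @^-1` B) = Q B) ->
  Q.-integrable setT (EFin \o u) ->
  P.-integrable setT (EFin \o (fun x => u (phi x))) /\
  \int[P]_x (u (phi x))%:E = \int[Q]_y (u y)%:E.
Proof.
move=> mphi PQ /integrableP[mu uoo].
have muphi : measurable_fun setT (EFin \o (fun x => u (phi x))).
  exact: measurableT_comp mu mphi.
have eqge0 := ge0_image_integral mphi PQ.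
split.
  apply/integrableP; split => //.
  rewrite [X in (X < _)](eqge0 (fun y => `|(u y)%:E|))//.
  exact: measurableT_comp.
rewrite integralE [RHS]integralE; congr (_ - _).
  rewrite -eqge0//; last exact: measurable_funepos.
  by apply: eq_integral => x _; rewrite !funeposE.
rewrite -eqge0//; last exact: measurable_funeneg.
by apply: eq_integral => x _; rewrite !funenegE.
Qed.

End transport.

Section second_moments.
Context {R : realType} {d : nat}.
Local Notation E := ('rV[R]_d).
Local Open Scope ereal_scope.
Implicit Types (P Q alpha beta : probability E R) (p : probability (E * E)%type R).

Lemma integrable_sqr_enorm P : finite_second_moment P ->
  P.-integrable setT (EFin \o (fun x => enorm x ^+ 2)%R).
Proof.
move=> P2; apply/integrableP; split.
  by apply/measurable_EFinP; apply: measurable_funX; exact: measurable_enorm.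
rewrite (eq_integral (fun x => ((enorm x) ^+ 2)%:E)) => [//|x _].
by rewrite /= ger0_norm ?sqr_ge0.
Qed.

Lemma integrable_enorm P : finite_second_moment P ->
  P.-integrable setT (EFin \o @enorm R d).
Proof.
move=> P2; have i1 : P.-integrable setT (EFin \o cst 1%R).
  exact: finite_measure_integrable_cst.
have := integrableD measurableT i1 (integrable_sqr_enorm P2).
apply: le_integrable => //; first by apply/measurable_EFinP; exact: measurable_enorm.
move=> x _ /=; rewrite lee_fin ger0_norm ?enorm_ge0// ger0_norm.
  by have := sqr_ge0 (enorm x - 1); have := enorm_ge0 x; lra.
by rewrite addr_ge0 ?sqr_ge0.
Qed.

Lemma integrable_coord P i : finite_second_moment P ->
  P.-integrable setT (EFin \o (fun x : E => x 0%R i)).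
Proof.
move=> P2; have := integrable_enorm P2; apply: le_integrable => //.
  by apply/measurable_EFinP; exact: measurable_coord.
by move=> x _ /=; rewrite lee_fin (le_trans (coord_le_enorm x i))// ler_norm.
Qed.

Lemma measurable_dot_pair : measurable_fun setT (fun z : E * E => dot z.1 z.2).
Proof. exact: measurable_fun_dot. Qed.

Lemma coupling_integral1 alpha beta p u : coupling alpha beta p ->
  alpha.-integrable setT (EFin \o u) ->
  p.-integrable setT (EFin \o (fun z => u z.1)) /\
  \int[p]_z (u z.1)%:E = \int[alpha]_x (u x)%:E.
Proof. by move=> [p1 _] iu; apply: image_integral. Qed.

Lemma coupling_integral2 alpha beta p u : coupling alpha beta p ->
  beta.-integrable setT (EFin \o u) ->
  p.-integrable setT (EFin \o (fun z => u z.2)) /\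
  \int[p]_z (u z.2)%:E = \int[beta]_x (u x)%:E.
Proof. by move=> [_ p2] iu; apply: image_integral. Qed.

Lemma coupling_dot_integrable alpha beta p : coupling alpha beta p ->
  finite_second_moment alpha -> finite_second_moment beta ->
  p.-integrable setT (EFin \o (fun z => dot z.1 z.2)).
Proof.
move=> cp a2 b2; have [i1 _] := coupling_integral1 cp (integrable_sqr_enorm a2).
have [i2 _] := coupling_integral2 cp (integrable_sqr_enorm b2).
have := integrableD measurableT i1 i2; apply: le_integrable => //.
  by apply/measurable_EFinP; exact: measurable_dot_pair.
move=> z _ /=; rewrite lee_fin !sqr_enorm (le_trans (dot_le_sqr _ _))//.
exact: ler_norm.
Qed.

Lemma integral_dot (P : {measure set E -> \bar R}) (h : E) :
  (forall i, P.-integrable setT (fun y : E => (y 0%R i)%:E)) ->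
  \int[P]_y (dot h y)%:E = (dot h (barycenter P))%:E.
Proof.
move=> iP; rewrite (eq_integral (fun y : E => \sum_(i < d) (h 0%R i)%:E * (y 0%R i)%:E)).
  rewrite integral_sum//; last by move=> i; exact: integrableZl.
  rewrite -sumEFin; apply: eq_bigr => i _; rewrite integralZl//.
  rewrite EFinM mxE fineK//; exact: integrable_fin_num.
by move=> y _; rewrite /dot -sumEFin.
Qed.

(** Given the first coordinate, a linear form in the second integrates to its value at the
    barycenter, the coordinates being integrable under almost every k x by the second moment of
    beta. The function v is a measurable version of that value. *)
Lemma disintegration_dot alpha beta p (k : R.-pker E ~> E) (xi : E -> E) (v : E -> R) :
  coupling alpha beta p -> disintegration p alpha k -> finite_second_moment beta ->
  p.-integrable setT (EFin \o (fun z => dot (xi z.1) z.2)) ->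
  measurable_fun setT v ->
  {ae alpha, forall x, v x = dot (xi x) (barycenter (k x))} ->
  \int[p]_z (dot (xi z.1) z.2)%:E = \int[alpha]_x (v x)%:E.
Proof.
move=> cp pk b2 ixi mv vE.
have [_ mI ->] := disintegration_integral pk ixi.
apply: ae_eq_integral => //; first exact/measurable_EFinP.
have ik : {ae alpha, forall x, forall i, (k x).-integrable setT (fun y : E => (y 0%R i)%:E)}.
  have H i : {ae alpha, forall x, (k x).-integrable setT (fun y : E => (y 0%R i)%:E)}.
    have [ic _] := coupling_integral2 cp (integrable_coord i b2).
    by have [] := disintegration_integral pk ic.
  exact: filter_forall H.
by apply: filterS2 ik vE => x ikx vx _ /=; rewrite integral_dot// vx.
Qed.

End second_moments.

Section conjugate.
Context {R : realType} {d : nat}.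
Local Notation E := ('rV[R]_d).
Variable f : E -> R.
Hypothesis cf : continuous f.

(* The inner supremum of the dual problem, when f is the first potential. *)
Definition conjugate x : \bar R := ereal_sup (range (fun h => (dot h x + f h)%:E)).

(** A finite set of values makes every function of xi(x) bounded, so neither the second moment of
    the law of xi nor the integrability of f along xi is an issue. *)
Definition simple_map (xi : E -> E) := measurable_fun setT xi /\
  exists s : seq E, forall x, xi x \in s.

Lemma simple_map_bounded xi (F : E -> R) : simple_map xi ->
  exists2 M, 0 <= M & forall x, `|F (xi x)| <= M.
Proof.
move=> [_ [s xis]]; suff [M M0 HM] : exists2 M, 0 <= M & forall h, h \in s -> `|F h| <= M.
  by exists M => // x; exact: HM.
elim: s {xis} => [|h s [M M0 IH]]; first by exists 0.
exists (`|F h| + M) => [|h']; first exact: addr_ge0.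
rewrite in_cons => /predU1P[->|/IH H]; first by rewrite lerDl.
by rewrite (le_trans H)// lerDr.
Qed.

Let hn (n : nat) : E :=
  if @unpickle 'rV[rat]_d n is Some q then map_mx ratr q else 0.

Let J x h := dot h x + f h.

(** The best point among 0 and the first n rational vectors, replaced only on strict improvement: a
    measurable, finitely valued near-maximizer. Starting from 0 keeps the value above f(0) for every
    x. *)
Fixpoint select (n : nat) (x : E) : E :=
  if n is n'.+1 then
    if J x (select n' x) < J x (hn n') then hn n' else select n' x
  else 0.

Let cJ x : continuous (J x).
Proof.
move=> h; apply: (@continuousD R R E (fun h => dot h x)); last exact: cf.
rewrite (_ : (fun _ => _) = dot x); first exact: continuous_dot.
by apply/funext => y; rewrite dotC.
Qed.

Let mf : measurable_fun setT f. Proof. exact: continuous_measurable_rV. Qed.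

Let mJ (xi : E -> E) : measurable_fun setT xi -> measurable_fun setT (fun x => J x (xi x)).
Proof.
move=> mxi; apply: measurable_funD; first exact: measurable_fun_dot.
exact: measurableT_comp mf mxi.
Qed.

Lemma simple_map_select n : simple_map (select n).
Proof.
elim: n => [|n [mn [s ns]]].
  by split; [exact: measurable_cst|exists [:: 0] => x; rewrite inE].
split.
  apply: measurable_fun_ifT => //.
  by apply: measurable_fun_ltr; apply: mJ.
exists (hn n :: s) => x /=; rewrite in_cons.
by case: ifP => _; rewrite ?eqxx// ns orbT.
Qed.

Let select_nd x : nondecreasing_seq (fun n => J x (select n x)).
Proof. by apply/nondecreasing_seqP => n /=; case: ifPn => // /ltW. Qed.

Let select_ge x n : J x (hn n) <= J x (select n.+1 x).
Proof. by rewrite /=; case: ltP. Qed.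

Let dense_hn x h e : 0 < e -> exists n, J x h - e < J x (hn n).
Proof.
move=> e0; have : nbhs h [set h' | J x h - e < J x h'].
  by apply: (cvgr_gt (J x h) (@cJ x h)); rewrite ltrBlDr ltrDl.
move=> /nbhs_ballP[r /= r0 rJ].
have qa i : exists q : rat, h 0 i - r < ratr q < h 0 i.
  have [|q] := @rat_in_itvoo R (h 0 i - r) (h 0 i); first by rewrite ltrBlDr ltrDl.
  by rewrite in_itv/=; exists q.
have [a Ha] := choice qa.
exists (pickle (\row_i a i)); rewrite /hn pickleK; apply: rJ; split => // j i.
rewrite ord1 !mxE /ball/= ltr_norml; have := Ha i; lra.
Qed.

Lemma conjugate_ge x h : ((dot h x + f h)%:E <= conjugate x)%E.
Proof. by apply: ereal_sup_ubound; exists h. Qed.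

Lemma select_cvg x : ((J x (select n x))%:E @[n --> \oo] --> conjugate x)%E.
Proof.
have /ereal_nondecreasing_cvgn : nondecreasing_seq (fun n => (J x (select n x))%:E).
  by move=> m n mn; rewrite lee_fin; exact: select_nd.
rewrite (_ : ereal_sup _ = conjugate x)//.
apply/eqP; rewrite eq_le; apply/andP; split.
  by apply: ge_ereal_sup => _ [n _ <-]; exact: conjugate_ge.
apply: ge_ereal_sup => _ [h _ <-]; apply/lee_addgt0Pr => e e0.
have [n Hn] := dense_hn x h e0.
apply: (@le_trans _ _ ((J x (select n.+1 x))%:E + e%:E)%E).
  rewrite -EFinD lee_fin -lerBlDr (le_trans (ltW Hn))//; exact: select_ge.
by apply: leeD => //; apply: ereal_sup_ubound; exists n.+1.
Qed.

Lemma measurable_conjugate : measurable_fun setT conjugate.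
Proof.
apply: (emeasurable_fun_cvg (fun n x => (J x (select n x))%:E)).
  move=> n; have [mn _] := simple_map_select n.
  by apply/measurable_EFinP; exact: mJ mn.
by move=> x _; exact: select_cvg.
Qed.

Section integral_conjugate.
Variable mu : probability E R.
Hypothesis mu2 : finite_second_moment mu.
Local Open Scope ereal_scope.

Lemma simple_map_dot_integrable xi : simple_map xi ->
  mu.-integrable setT (EFin \o (fun x => dot (xi x) x)).
Proof.
move=> sxi; have [M M0 HM] := simple_map_bounded norm1 sxi.
have := integrableZl measurableT M (integrable_enorm mu2).
apply: le_integrable => //.
  by apply/measurable_EFinP; apply: measurable_fun_dot => //; exact: sxi.1.
move=> x _ /=; rewrite lee_fin normrM (le_trans (dot_le_norm1 _ _))//.
apply: ler_pM; rewrite ?norm1_ge0 ?enorm_ge0 ?ler_norm//.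
by rewrite (ger0_norm M0) (le_trans _ (HM x))// ler_norm.
Qed.

Lemma simple_map_comp_integrable (P : probability E R) xi (F : E -> R) :
  measurable_fun setT F -> simple_map xi ->
  P.-integrable setT (EFin \o (fun x => F (xi x))).
Proof.
move=> mF sxi; have [M M0 HM] := simple_map_bounded F sxi.
have := finite_measure_integrable_cst P M measurableT.
apply: le_integrable => //.
  by apply/measurable_EFinP; exact: measurableT_comp mF sxi.1.
by move=> x _ /=; rewrite lee_fin (ger0_norm M0).
Qed.

Lemma simple_map_conjugate_integrable xi : simple_map xi ->
  mu.-integrable setT (EFin \o (fun x => dot (xi x) x + f (xi x))%R).
Proof.
move=> sxi; have := integrableD measurableT (simple_map_dot_integrable sxi)
  (simple_map_comp_integrable mu mf sxi).
exact.
Qed.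

(** The values along [select] increase to the conjugate and stay above f(0); after subtracting f(0),
    monotone convergence transfers the bound from simple maps and gives integrability as well. *)
Lemma integral_conjugate_le (B : R) :
  (forall xi, simple_map xi -> \int[mu]_x (dot (xi x) x + f (xi x))%:E <= B%:E) ->
  mu.-integrable setT conjugate /\ \int[mu]_x conjugate x <= B%:E.
Proof.
move=> HB.
have J0 x n : (f 0 <= J x (select n x))%R.
  have := select_nd x (leq0n n); rewrite {1}/J/= dot0l add0r; exact.
have c0 x : 0 <= conjugate x - (f 0%R)%:E.
  rewrite sube_ge0//; have := conjugate_ge x 0%R; rewrite dot0l add0r; exact.
have mS n := (simple_map_select n).1.
have mB : measurable_fun setT (fun x => conjugate x - (f 0%R)%:E).
  by apply: emeasurable_funB => //; exact: measurable_conjugate.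
have lim : \int[mu]_x (J x (select n x) - f 0%R)%:E @[n --> \oo] -->
    \int[mu]_x (conjugate x - (f 0%R)%:E).
  rewrite (eq_integral (fun x => limn (fun n => (J x (select n x) - f 0%R)%:E))); last first.
    move=> x _; apply/esym/cvg_lim => //.
    have := cvgeB (_ : conjugate x +? - (f 0%R)%:E) (@select_cvg x) (cvg_cst (f 0%R)%:E).
    by apply; rewrite fin_num_adde_defl.
  apply: cvg_monotone_convergence => //.
  - by move=> n; apply/measurable_EFinP; apply: measurable_funB => //; exact: mJ.
  - by move=> n x _; rewrite lee_fin subr_ge0.
  - by move=> x _ a b ab; rewrite lee_fin lerB//; exact: select_nd.
have intc (c : R) : \int[mu]_x c%:E = c%:E by exact: integral_probability_cst.
have ic (c : R) : mu.-integrable setT (EFin \o cst c).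
  exact: finite_measure_integrable_cst.
have le1 : \int[mu]_x (conjugate x - (f 0%R)%:E) <= (B - f 0%R)%:E.
  rewrite -(cvg_lim _ lim)//; apply: lime_le; first by apply/cvg_ex; eexists; exact: lim.
  apply: nearW => n.
  have := integralB measurableT (simple_map_conjugate_integrable (simple_map_select n)) (ic (f 0%R)).
  rewrite /= intc => ->.
  by rewrite EFinB leeB//; exact: HB (simple_map_select n).
have icf : mu.-integrable setT (fun x => conjugate x - (f 0%R)%:E).
  apply/integrableP; split => //.
  rewrite (eq_integral (fun x => conjugate x - (f 0%R)%:E)) => [|x _].
    by rewrite (le_lt_trans le1)// ltry.
  by rewrite gee0_abs.
have eqc : conjugate = (fun x => conjugate x - (f 0%R)%:E) \+ (EFin \o cst (f 0%R)).
  by apply/funext => x; rewrite -[LHS](@subeK _ (conjugate x) (f 0%R)%:E).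
split; first by rewrite eqc; exact: integrableD.
have -> : \int[mu]_x conjugate x = \int[mu]_x (conjugate x - (f 0%R)%:E) + (f 0%R)%:E.
  rewrite [in LHS]eqc.
  have := integralD measurableT icf (ic (f 0%R)); rewrite /= intc => <-.
  by [].
by rewrite -leeBrDr.
Qed.

End integral_conjugate.

End conjugate.

(** * Weak duality *)

Section weak_duality.
Context {R : realType} {d : nat}.
Local Notation E := ('rV[R]_d).
Variable nu : probability E R.
Hypothesis nu_exp : exponential_moments nu.
Hypothesis nu2 : finite_second_moment nu.
Variable w : E -> R.
Hypothesis gw : egrowth w.
Hypothesis w_gt0 : forall y, 0 < w y.
Hypothesis iw : nu.-integrable setT (EFin \o (fun y => ln (w y))).
Local Open Scope ereal_scope.

(* The first potential attached to the second potential [ln \o w]. *)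
Definition dual_potential (h : E) : R := (- ln (Lap nu w h))%R.
Local Notation f := dual_potential.

Let L_gt0 h : (0 < Lap nu w h)%R.
Proof. exact: (Lap_weight_gt0 nu_exp h gw w_gt0). Qed.

Lemma continuous_dual_potential : continuous f.
Proof.
move=> x; apply: differentiable_continuous.
by have [] := log_laplace_differentiable nu_exp gw w_gt0 x.
Qed.
Let cf := continuous_dual_potential.

Let mf : measurable_fun setT f. Proof. exact: continuous_measurable_rV cf. Qed.

Lemma integral_expR_dual_potential h :
  \int[nu]_y (expR (f h + ln (w y) + dot h y))%:E = 1.
Proof.
rewrite (eq_integral (fun y => (expR (f h))%:E * (w y * expR (dot h y))%:E)).
  rewrite integralZl//; last exact: Lap_integrable.
  have e : (expR (f h) * Lap nu w h = 1)%R.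
    by rewrite /f expRN lnK ?posrE// mulVf// gt_eqF.
  by rewrite -Lap_EFin// -EFinM e.
by move=> y _; rewrite !expRD lnK ?posrE// -EFinM mulrA.
Qed.

Let K (xi : E -> E) (z : E * E) : R := (f (xi z.1) + ln (w z.2) + dot (xi z.1) z.2)%R.

Let mlnw : measurable_fun setT (fun y => ln (w y)).
Proof. exact: measurableT_comp (@measurable_ln R) gw.1. Qed.

Let mK xi : measurable_fun setT xi -> measurable_fun setT (K xi).
Proof.
move=> mxi; have mxi1 : measurable_fun setT (fun z : E * E => xi z.1).
  exact: measurableT_comp mxi measurable_fst.
apply: measurable_funD; last exact: measurable_fun_dot.
by apply: measurable_funD; [exact: measurableT_comp mf mxi1|
  exact: measurableT_comp mlnw measurable_snd].
Qed.

Lemma integral_expR_prod (alpha : probability E R) xi : measurable_fun setT xi ->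
  \int[alpha \x nu]_z (expR (K xi z))%:E = 1.
Proof.
move=> mxi; rewrite fubini_tonelli1//; last first.
  by apply/measurable_EFinP; apply: measurableT_comp => //; exact: mK.
rewrite /fubini_F (eq_integral (fun=> 1)) => [|x _].
  exact: integral_probability_cst.
exact: (integral_expR_dual_potential (xi x)).
Qed.

(** Gibbs' inequality for an exponent whose exponential integrates to 1 in y at each fixed x. The
    map xi is free: near-maximizers are used when the first marginal is mu, the identity when it is
    the law of a near-maximizer. *)
Lemma entropy_ge (alpha : probability E R) (p : probability (E * E)%type R) xi :
  coupling alpha nu p -> measurable_fun setT xi ->
  alpha.-integrable setT (EFin \o (fun x => f (xi x))) ->
  p.-integrable setT (EFin \o (fun z => dot (xi z.1) z.2)) ->
  \int[alpha]_x (f (xi x))%:E + \int[nu]_y (ln (w y))%:E +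
    \int[p]_z (dot (xi z.1) z.2)%:E <= entropy p (alpha \x nu).
Proof.
move=> cp mxi ifxi idot.
have [i1 e1] := coupling_integral1 cp ifxi.
have [i2 e2] := coupling_integral2 cp iw.
have i12 := integrableD measurableT i1 i2.
have iK := integrableD measurableT i12 idot.
have -> : \int[alpha]_x (f (xi x))%:E + \int[nu]_y (ln (w y))%:E +
    \int[p]_z (dot (xi z.1) z.2)%:E = \int[p]_z (K xi z)%:E.
  rewrite -e1 -e2.
  have := integralD measurableT i1 i2 => /= <-.
  by have := integralD measurableT i12 idot => /= <-.
apply: gibbs; first exact: iK.
by rewrite integral_expR_prod.
Qed.

Section fixed_mu.
Variable mu : probability E R.
Hypothesis mu2 : finite_second_moment mu.

Let b := fine (\int[nu]_y (ln (w y))%:E).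
Let bE : \int[nu]_y (ln (w y))%:E = b%:E.
Proof. by rewrite fineK//; exact: integrable_fin_num. Qed.

(** The bound V may be infinite: +oo is trivial, and -oo is excluded by the constant map 0, for
    which the tested quantity is finite. *)
Lemma weak_duality_bound (V : \bar R) :
  (forall xi, simple_map xi ->
     \int[mu]_x (dot (xi x) x + f (xi x))%:E + \int[nu]_y (ln (w y))%:E <= V) ->
  \int[nu]_y (ln (w y))%:E + \int[mu]_x conjugate f x <= V.
Proof.
move=> HV; have s0 : simple_map (fun=> 0%R : E).
  by split => //; exists [:: 0%R] => x; rewrite inE.
have := HV _ s0; case: V HV => [r| |] HV H0.
- have [|ic le] := @integral_conjugate_le R d f cf mu mu2 (r - b)%R.
    by move=> xi /HV; rewrite bE EFinB leeBrDr.
  by rewrite bE addeC -leeBrDr.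
- exact: leey.
- have := integrable_fin_num measurableT (simple_map_conjugate_integrable cf mu2 s0).
  by move: H0; rewrite bE leeNy_eq adde_eq_ninfty orbF => /eqP ->.
Qed.

(** The martingale property turns the integral of xi(x).y into that of xi(x).x, which makes the
    entropy bound one on the integrand of the conjugate. *)
Lemma weak_duality_P (p : probability (E * E)%type R) :
  martingale_coupling mu nu p ->
  \int[nu]_y (ln (w y))%:E + \int[mu]_x conjugate f x <= entropy p (mu \x nu).
Proof.
move=> [cp [k [pk bk]]]; apply: weak_duality_bound => xi sxi.
have mxi := sxi.1.
have idot : p.-integrable setT (EFin \o (fun z => dot (xi z.1) z.2)).
  have [M M0 HM] := simple_map_bounded (@norm1 R d) sxi.
  have [i2 _] := coupling_integral2 cp (integrable_enorm nu2).
  have := integrableZl measurableT M i2; apply: le_integrable => //.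
    apply/measurable_EFinP; apply: measurable_fun_dot => //.
    exact: measurableT_comp mxi measurable_fst.
  move=> z _ /=; rewrite lee_fin normrM (le_trans (dot_le_norm1 _ _))//.
  apply: ler_pM; rewrite ?norm1_ge0 ?enorm_ge0 ?ler_norm//.
  by rewrite (ger0_norm M0) (le_trans _ (HM z.1))// ler_norm.
have ifxi := simple_map_comp_integrable mu mf sxi.
have ed : \int[p]_z (dot (xi z.1) z.2)%:E = \int[mu]_x (dot (xi x) x)%:E.
  apply: (disintegration_dot cp pk nu2 idot).
    exact: measurable_fun_dot.
  by apply: filterS bk => x ->.
have := entropy_ge cp mxi ifxi idot; rewrite ed.
have := integralD measurableT (simple_map_dot_integrable mu2 sxi) ifxi => /= ->.
by rewrite addeAC [X in X + _]addeC.
Qed.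

Lemma simple_map_P2 (mxi : {mfun E >-> E}) : simple_map mxi ->
  finite_second_moment (distribution mu mxi).
Proof.
move=> sxi; rewrite /finite_second_moment.
have [M M0 HM] := simple_map_bounded (fun h : E => enorm h ^+ 2)%R sxi.
rewrite ge0_integral_distribution//=.
- apply: (@le_lt_trans _ _ (\int[mu]_x M%:E)).
    apply: ge0_le_integral => //.
    + by move=> x _; rewrite lee_fin sqr_ge0.
    + apply/measurable_EFinP; apply: measurable_funX.
      exact: measurableT_comp measurable_enorm _.
    + by move=> x _; rewrite lee_fin (le_trans _ (HM x))// ler_norm.
  by rewrite integral_probability_cst ltry.
- by apply/measurable_EFinP; apply: measurable_funX; exact: measurable_enorm.
- by move=> x; rewrite lee_fin sqr_ge0.
Qed.

(** The competitor is the law of xi under mu. Its covariance term is at least the integral of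
    xi(x).x, by the coupling (xi, id)_# mu, and [entropy_ge] with the identity map bounds its
    Schrodinger value. *)
Lemma weak_duality_VP :
  \int[nu]_y (ln (w y))%:E + \int[mu]_x conjugate f x <= VP_value mu nu.
Proof.
apply: weak_duality_bound => xi sxi.
have mxi := sxi.1.
pose X : {mfun E >-> E} := HB.pack xi (isMeasurableFun.Build _ _ _ _ xi mxi).
pose mb : probability E R := distribution mu X.
have mb2 : finite_second_moment mb by exact: simple_map_P2.
apply: (@le_trans _ _ (VP_objective mu nu mb)); last first.
  by apply: ereal_sup_ubound; exists mb.
have ifxi := simple_map_comp_integrable mu mf sxi.
have idx := simple_map_dot_integrable mu2 sxi.
have := integralD measurableT idx ifxi => /= ->.
rewrite -addeA [leLHS]addeC; apply: leeD.
  apply: le_ereal_inf_tmp => _ [p cp <-].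
  have idot := coupling_dot_integrable cp mb2 nu2.
  have ifmb : mb.-integrable setT (EFin \o (fun x => f x)).
    by apply: integrable_pushforward => //; exact/measurable_EFinP.
  rewrite /SP_objective leeBrDr; last exact: integrable_fin_num.
  have := entropy_ge (xi := idfun) cp (@measurable_id _ _ setT) ifmb idot.
  have [_ <-] := image_integral (P := mu) (Q := mb) mxi (fun B _ => erefl) ifmb.
  exact.
pose XY : {mfun E >-> (E * E)%type} := HB.pack (fun x => (xi x, x))
  (isMeasurableFun.Build _ _ _ _ (fun x => (xi x, x))
    (measurable_fun_pair mxi (@measurable_id _ _ setT))).
pose q : probability (E * E)%type R := distribution mu XY.
have cq : coupling mb mu q by split.
have idot := coupling_dot_integrable cq mb2 mu2.
have [_ ->] := image_integral (P := mu) (Q := q)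
  (measurable_fun_pair mxi (@measurable_id _ _ setT)) (fun B _ => erefl) idot.
by apply: ereal_sup_ubound; exists q.
Qed.

End fixed_mu.

End weak_duality.

(** * Schrodinger potentials *)

Section potentials.
Context {R : realType} {d : nat}.
Local Notation E := ('rV[R]_d).
Variables (mubar nu : probability E R).
Local Open Scope ereal_scope.

Lemma countable_cover_pos (P : probability E R) (B : nat -> set E) :
  (forall n, measurable (B n)) -> {ae P, forall x, exists n, B n x} ->
  exists n, 0 < P (B n).
Proof.
move=> mB PB; apply: contrapT => H.
have B0 n : P (B n) = 0.
  apply/eqP; rewrite -measure_le0 leNgt; apply/negP => Bn; apply: H; by exists n.
have nB n : {ae P, forall x, ~ B n x}.
  by exists (B n); split => // x /= /contrapT.
have /ae_foralln nBn := nB.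
have [N [mN N0 NT]] : {ae P, forall x : E, False}.
  by apply: filterS2 PB nBn => x [n Bn] /(_ n).
have NE : N = setT by apply/seteqP; split => // x _; apply: NT.
by move: N0; rewrite NE probability_setT => /eqP; rewrite onee_eq0.
Qed.

Lemma expeR_ge0 (x : \bar R) : 0 <= expeR x.
Proof. by case: x => [r| |] //=; rewrite lee_fin expR_ge0. Qed.

Lemma measurable_expeR_dot (u : E -> \bar R) (y : E) : measurable_fun setT u ->
  measurable_fun setT (fun x => expeR (u x + (dot x y)%:E)).
Proof.
move=> mu; apply: measurable_expeR; apply: emeasurable_funD => //.
apply/measurable_EFinP; exact: measurable_fun_dot.
Qed.

(* Restricting the integral to a bounded set of positive mass where phi is
   bounded below bounds the other potential linearly. *)
Lemma extended_potential_le (phi psi : E -> \bar R) : measurable_fun setT phi ->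
  {ae mubar, forall x, phi x != -oo} ->
  (forall y, psi y = - lne (\int[mubar]_x expeR (phi x + (dot x y)%:E))) ->
  exists C r : R, forall y, psi y <= (C + r * enorm y)%:E.
Proof.
move=> mphi phiNy psiE.
pose B n := [set x | (- n%:R)%:E <= phi x] `&` [set x : E | (norm1 x <= n%:R)%R].
have mnorm1 : measurable_fun setT (@norm1 R d).
  by apply: measurable_sum => i; apply: measurableT_comp => //; exact: measurable_coord.
have mB n : measurable (B n).
  apply: measurableI.
    by have := emeasurable_fun_c_infty measurableT mphi (- n%:R)%:E; rewrite setTI.
  have := measurable_fun_ler mnorm1 (measurable_cst (n%:R : R)).
  move=> /(_ measurableT [set true]); rewrite setTI.
  by apply.
have [|n Bn] := @countable_cover_pos mubar B mB.
  apply: filterS phiNy => x; case phix : (phi x) => [r| |] // _.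
    exists (Num.truncn (`|r| + norm1 x)).+1; rewrite /B/= phix lee_fin; split.
      rewrite lerNl; apply: (le_trans (ler_norm (- r))); rewrite normrN.
      by apply/ltW/(le_lt_trans _ (truncnS_gt _)); rewrite lerDl norm1_ge0.
    by apply/ltW/(le_lt_trans _ (truncnS_gt _)); rewrite lerDr.
  exists (Num.truncn (norm1 x)).+1; rewrite /B/= phix leey; split => //.
  by apply/ltW/truncnS_gt.
set b := fine (mubar (B n)).
have bE : mubar (B n) = b%:E by rewrite fineK// fin_num_measure.
have b0 : (0 < b)%R by rewrite -lte_fin -bE.
(* On B n, whose mass is b, e^{phi + x.y} >= e^{- n - n |y|}; minus the logarithm of the resulting
   lower bound is n - ln b + n |y|. *)
exists (n%:R - ln b)%R, (n%:R)%R => y; rewrite psiE leeNl -EFinN.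
have L : (expR (- n%:R - n%:R * enorm y) * b)%:E <=
    \int[mubar]_x expeR (phi x + (dot x y)%:E).
  apply: (@le_trans _ _ (\int[mubar]_(x in B n) expeR (phi x + (dot x y)%:E))); last first.
    apply: ge0_subset_integral => //; first exact: measurable_expeR_dot.
    by move=> x _; exact: expeR_ge0.
  rewrite EFinM -bE -integral_cst//; apply: ge0_le_integral => //.
  - by move=> x _; rewrite lee_fin expR_ge0.
  - by apply: measurable_funTS; exact: measurable_expeR_dot.
  move=> x [/= px xn].
  have h : (- n%:R - n%:R * enorm y)%:E <= phi x + (dot x y)%:E.
    rewrite EFinB; apply: leeD => //; rewrite lee_fin lerNl.
    apply: (le_trans (ler_norm _)); rewrite normrN (le_trans (dot_le_norm1 x y))//.
    by rewrite ler_wpM2r ?enorm_ge0.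
  by move: h; case: (phi x + _) => [t| |] //=; rewrite ?lee_fin ?ler_expR ?leey.
have c0 : (0 < expR (- n%:R - n%:R * enorm y) * b)%R by rewrite mulr_gt0 ?expR_gt0.
have <- : lne (expR (- n%:R - n%:R * enorm y) * b)%:E = (- (n%:R - ln b + n%:R * enorm y))%:E.
  by rewrite lne_EFin// lnM ?posrE ?expR_gt0// expRK; congr EFin; ring.
rewrite lee_lne//; rewrite in_itv/= leey andbT; first by rewrite lee_fin ltW.
by apply: le_trans L; rewrite lee_fin ltW.
Qed.

Hypothesis nu_exp : exponential_moments nu.
Variables (p : probability (E * E)%type R) (phi psi : E -> \bar R).
Hypothesis pot : schrodinger_potentials mubar nu p phi psi.

(** Where psi is infinite, [fine] returns 0 and the weight is 1: it is positive everywhere and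
    differs from e^psi on a nu-null set only. *)
Definition potential_weight (y : E) : R := expR (fine (psi y)).
Local Notation w := potential_weight.
Local Notation f := (dual_potential nu w).

Lemma ln_potential_weight y : ln (w y) = fine (psi y).
Proof. by rewrite /w expRK. Qed.

Lemma potential_weight_gt0 y : (0 < w y)%R.
Proof. exact: expR_gt0. Qed.

Let mphi : measurable_fun setT phi. Proof. by case: pot. Qed.
Let mpsi : measurable_fun setT psi. Proof. by case: pot. Qed.

Let psi_le : exists C r : R, forall y, psi y <= (C + r * enorm y)%:E.
Proof.
have [_ _ _ [sys _] [_ psiE]] := pot.
apply: (extended_potential_le mphi _ psiE); apply: filterS sys => x Hx.
apply/eqP => phix; move: Hx; rewrite integral0_eq => [/eqP|y _].
  by rewrite eq_sym onee_eq0.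
by rewrite phix !addNye.
Qed.

(** The linear upper bound excludes +oo; where psi is -oo, the integral in the second Schrodinger
    equation would be 0 and not 1. *)
Lemma psi_fin_num : {ae nu, forall y, psi y \is a fin_num}.
Proof.
have [_ _ _ [_ sys] _] := pot; have [C [r psi_ub]] := psi_le.
apply: filterS sys => y Hy.
case py : (psi y) => [t| |] //; first by have := psi_ub y; rewrite py.
move: Hy; rewrite integral0_eq => [/eqP|x _].
  by rewrite eq_sym onee_eq0.
by rewrite py addeNy addNye.
Qed.

Lemma psiE : {ae nu, forall y, psi y = (ln (w y))%:E}.
Proof. by apply: filterS psi_fin_num => y py; rewrite ln_potential_weight fineK. Qed.

Lemma egrowth_potential_weight : egrowth w.
Proof.
have [C [r psi_ub]] := psi_le.
apply: (@egrowth_le _ _ _ (expR `|C|) `|r|).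
- by apply: measurableT_comp => //; apply: measurableT_comp (fine_measurable measurableT) mpsi.
- exact: expR_ge0.
- move=> y; rewrite gtr0_norm ?potential_weight_gt0// /w -expRD ler_expR.
  have e0 := enorm_ge0 y.
  have h : (0 <= `|C| + `|r| * enorm y)%R by rewrite addr_ge0// mulr_ge0.
  case py : (psi y) => [t| |] //=.
  have := psi_ub y; rewrite py lee_fin => /le_trans; apply.
  by apply: lerD; [exact: ler_norm|apply: ler_wpM2r => //; exact: ler_norm].
Qed.
Let gw := egrowth_potential_weight.

Lemma integral_expeR_psi (h : E) :
  \int[nu]_y expeR (psi y + (dot h y)%:E) = (Lap nu w h)%:E.
Proof.
rewrite Lap_EFin//; apply: ge0_ae_eq_integral => //.
- rewrite (_ : (fun _ => _) = (fun y => expeR (psi y + (dot y h)%:E))).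
    exact: measurable_expeR_dot.
  by apply/funext => y; rewrite dotC.
- apply/measurable_EFinP; apply: measurable_funM; first exact: gw.1.
  exact: (egrowth_expR_dot h).1.
- by move=> y _; exact: expeR_ge0.
- by move=> y _; rewrite lee_fin mulr_ge0 ?expR_ge0.
- by apply: filterS psiE => y -> _ /=; rewrite expRD lnK ?posrE// potential_weight_gt0.
Qed.

Lemma phiE x : phi x = (f x)%:E.
Proof.
have [_ _ _ _ [-> _]] := pot.
rewrite integral_expeR_psi lne_EFin//.
exact: (Lap_weight_gt0 nu_exp x gw potential_weight_gt0).
Qed.

Lemma psi_mubarE y : psi y = - lne (\int[mubar]_x (expR (f x + dot x y))%:E).
Proof.
have [_ _ _ _ [_ ->]] := pot.
by congr (- lne _); apply: eq_integral => x _; rewrite phiE.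
Qed.

Let mf : measurable_fun setT f.
Proof.
apply: continuous_measurable_rV.
exact: (@continuous_dual_potential _ _ _ nu_exp _ gw potential_weight_gt0).
Qed.

Definition potential_exponent (z : E * E) : R := (f z.1 + ln (w z.2) + dot z.1 z.2)%R.

Lemma measurable_potential_exponent : measurable_fun setT potential_exponent.
Proof.
apply: measurable_funD; last exact: measurable_fun_dot.
apply: measurable_funD; first exact: measurableT_comp mf measurable_fst.
apply: (measurableT_comp (f := fun y => ln (w y))) measurable_snd.
exact: measurableT_comp (@measurable_ln R) gw.1.
Qed.

Lemma potential_density C : measurable C ->
  p C = \int[mubar \x nu]_(z in C) (expR (potential_exponent z))%:E.
Proof.
move=> mC; have [_ _ pE _ _] := pot; rewrite pE//.
apply: ge0_ae_eq_integral => //.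
- apply: measurable_funTS; apply: measurable_expeR; apply: emeasurable_funD.
    apply: emeasurable_funD; first exact: measurableT_comp mphi measurable_fst.
    exact: measurableT_comp mpsi measurable_snd.
  by apply/measurable_EFinP; exact: measurable_fun_dot.
- apply: measurable_funTS; apply/measurable_EFinP; apply: measurableT_comp => //.
  exact: measurable_potential_exponent.
- by move=> z _; exact: expeR_ge0.
have [N [mN N0 Nsub]] := psiE.
exists (setT `*` N); split; first exact: measurableX.
  apply: (etrans (product_measure1E mubar nu measurableT mN)).
  by rewrite [X in _ * X]N0 mule0.
move=> z /= Hz; split => //; apply: Nsub => /= pz; apply: Hz => _.
by rewrite phiE pz.
Qed.

Lemma conditional_density (pc : E -> {measure set E -> \bar R}) :
  conditional_measures nu phi psi pc -> forall x B, measurable B ->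
  pc x B = \int[nu]_(y in B) (expR (potential_exponent (x, y)))%:E.
Proof.
move=> pcE x B mB; rewrite pcE//; apply: ge0_ae_eq_integral => //.
- apply: measurable_funTS; apply: measurable_expeR; apply: emeasurable_funD.
    exact: emeasurable_funD.
  by apply/measurable_EFinP; exact: measurable_fun_dot.
- apply: measurable_funTS; apply/measurable_EFinP; apply: measurableT_comp => //.
  by apply: (measurableT_comp measurable_potential_exponent); exact: pair1_measurable.
- by move=> z _; exact: expeR_ge0.
- by apply: filterS psiE => y -> _; rewrite phiE.
Qed.

End potentials.

(** * Value of the Schrodinger problem *)

Section integrability.
Context d (T : measurableType d) (R : realType) (mu : {measure set T -> \bar R}).
Local Open Scope ereal_scope.

Lemma integral_fin_num_integrable (u : T -> R) : measurable_fun setT u ->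
  \int[mu]_x (u x)%:E \is a fin_num -> mu.-integrable setT (EFin \o u).
Proof.
move=> mu'; have mEu : measurable_fun setT (EFin \o u) by exact/measurable_EFinP.
rewrite integralE fin_numB => /andP[fp fn].
apply/integrableP; split => //.
rewrite (eq_integral (fun x => (EFin \o u)^\+ x + (EFin \o u)^\- x)) => [|x _]; last first.
  by rewrite -[RHS]/((funepos (EFin \o u) \+ funeneg (EFin \o u)) x) -fune_abse.
rewrite ge0_integralD//; last 2 first.
- exact: measurable_funepos.
- exact: measurable_funeneg.
by rewrite lte_add_pinfty// -ge0_fin_numE// integral_ge0.
Qed.

(** Integrability of a sum passes to its terms under one-sided bounds: U - u is nonnegative and at
    most (U + V) - (u + v). *)
Lemma integrable_split (u v U V : T -> R) : measurable_fun setT u ->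
  mu.-integrable setT (EFin \o U) -> mu.-integrable setT (EFin \o V) ->
  (forall x, u x <= U x)%R -> (forall x, v x <= V x)%R ->
  mu.-integrable setT (EFin \o (fun x => u x + v x)%R) ->
  mu.-integrable setT (EFin \o u).
Proof.
move=> mu' iU iV uU vV iuv.
have i1 : mu.-integrable setT (EFin \o (fun x => U x - u x)%R).
  have := integrableB measurableT (integrableD measurableT iU iV) iuv.
  apply: le_integrable => //.
    by apply/measurable_EFinP; apply: measurable_funB => //;
       apply/measurable_EFinP; exact: measurable_int iU.
  move=> x _ /=; rewrite lee_fin; have := uU x; have := vV x => h1 h2.
  by rewrite !ger0_norm; lra.
have := integrableB measurableT iU i1; apply: eq_integrable => // x _ /=.
by rewrite -EFinB; congr EFin; ring.
Qed.

End integrability.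

Section schrodinger_value.
Context {R : realType} {d : nat}.
Local Notation E := ('rV[R]_d).
Variables (mubar nu : probability E R).
Hypothesis nu_exp : exponential_moments nu.
Hypothesis nu_hyp : ~ concentrated_on_hyperplane nu.
Hypothesis nu2 : finite_second_moment nu.
Hypothesis mubar2 : finite_second_moment mubar.
Variable w : E -> R.
Hypothesis gw : egrowth w.
Hypothesis w_gt0 : forall y, 0 < w y.
Local Notation f := (dual_potential nu w).
Local Open Scope ereal_scope.

Lemma dual_potential_tangent x s : s != 0%R ->
  (f (x + s) < f x - dot s (mean nu w x))%R.
Proof.
move=> s0; have := log_laplace_tangent nu_exp gw w_gt0 x nu_hyp s0.
by rewrite /dual_potential; lra.
Qed.

Lemma dual_potential_le x s : (f (x + s) <= f x - dot s (mean nu w x))%R.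
Proof.
have [->|s0] := eqVneq s 0%R; last exact/ltW/dual_potential_tangent.
by rewrite addr0 dot0l subr0.
Qed.

Let mf : measurable_fun setT f.
Proof.
by apply: continuous_measurable_rV; exact: (@continuous_dual_potential _ _ _ nu_exp _ gw).
Qed.

(** Finite entropy only gives integrability of f(x) + ln w(y) + x.y as a whole. Both potentials grow
    at most linearly from above, f by its tangent at 0 and ln w by the exponential growth of w, so
    second moments suffice to separate them. *)
Lemma potentials_integrable (p : probability (E * E)%type R) :
  coupling mubar nu p ->
  (forall C, measurable C -> p C = \int[mubar \x nu]_(z in C)
     (expR (f z.1 + ln (w z.2) + dot z.1 z.2))%:E) ->
  entropy p (mubar \x nu) \is a fin_num ->
  [/\ mubar.-integrable setT (EFin \o f),
      nu.-integrable setT (EFin \o (fun y => ln (w y))) &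
      entropy p (mubar \x nu) = \int[mubar]_x (f x)%:E + \int[nu]_y (ln (w y))%:E
        + \int[p]_z (dot z.1 z.2)%:E].
Proof.
move=> cp pE.
have mlnw : measurable_fun setT (fun y => ln (w y)).
  exact: measurableT_comp (@measurable_ln R) gw.1.
have mf1 : measurable_fun setT (fun z : E * E => f z.1).
  exact: measurableT_comp mf measurable_fst.
have mg2 : measurable_fun setT (fun z : E * E => ln (w z.2)).
  exact: measurableT_comp mlnw measurable_snd.
have mk : measurable_fun setT (fun z : E * E => (f z.1 + ln (w z.2) + dot z.1 z.2)%R).
  by apply: measurable_funD; [exact: measurable_funD|exact: measurable_dot_pair].
rewrite (entropy_density mk pE) => /(integral_fin_num_integrable mk) ik.
have idot := coupling_dot_integrable cp mubar2 nu2.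
have is_ : p.-integrable setT (EFin \o (fun z => f z.1 + ln (w z.2))%R).
  have := integrableB measurableT ik idot; apply: eq_integrable => // z _ /=.
  by rewrite -EFinB addrK.
pose a1 := (`|f 0| + norm1 (mean nu w 0%R))%R.
have fU x : (f x <= a1 * (1 + enorm x))%R.
  have := dual_potential_le 0%R x; rewrite add0r => /le_trans; apply.
  have h1 := ler_norm (f 0%R).
  have h2 := dot_le_norm1 (mean nu w 0%R) x; rewrite dotC in h2.
  have h3 := ler_norm (- dot x (mean nu w 0%R)); rewrite normrN in h3.
  have h4 : (0 <= `|f 0| * enorm x)%R by rewrite mulr_ge0// enorm_ge0.
  have h5 : (0 <= norm1 (mean nu w 0%R))%R by exact: norm1_ge0.
  rewrite /a1 mulrDl !mulrDr !mulr1; lra.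
have [a2 gU] : exists a2 : R, forall y, (ln (w y) <= a2 * (1 + enorm y))%R.
  have [_ [a a0 wa]] := gw; exists a => y.
  have h : (w y <= a * expR (a * enorm y))%R by apply: le_trans (ler_norm _) (wa y).
  have {}a0 : (0 < a)%R.
    rewrite lt_neqAle a0 andbT eq_sym; apply/eqP => az.
    by move: h; rewrite az mul0r leNgt w_gt0.
  have : (ln (w y) <= ln (a * expR (a * enorm y)))%R.
    by rewrite ler_ln ?posrE ?mulr_gt0 ?expR_gt0.
  rewrite lnM ?posrE ?expR_gt0// expRK; have := ln_sublinear a0; lra.
have iE (P : probability E R) (P2 : finite_second_moment P) (a : R) :
    P.-integrable setT (EFin \o (fun x => a * (1 + enorm x))%R).
  have i1 : P.-integrable setT (EFin \o cst 1%R).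
    exact: finite_measure_integrable_cst.
  have := integrableZl measurableT a (integrableD measurableT i1 (integrable_enorm P2)).
  exact.
have [iU1 _] := coupling_integral1 cp (iE _ mubar2 a1).
have [iU2 _] := coupling_integral2 cp (iE _ nu2 a2).
have if1 : p.-integrable setT (EFin \o (fun z => f z.1)).
  exact: (integrable_split mf1 iU1 iU2 (fun z => fU z.1) (fun z => gU z.2) is_).
have ig2 : p.-integrable setT (EFin \o (fun z => ln (w z.2))).
  apply: (integrable_split mg2 iU2 iU1 (fun z => gU z.2) (fun z => fU z.1)).
  by apply: eq_integrable is_ => // z _ /=; rewrite addrC.
have if_ : mubar.-integrable setT (EFin \o f).
  exact: (image_integrable measurable_fst cp.1 mf if1).
have ig_ : nu.-integrable setT (EFin \o (fun y => ln (w y))).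
  exact: (image_integrable measurable_snd cp.2 mlnw ig2).
split => //.
have [_ <-] := coupling_integral1 cp if_.
have [_ <-] := coupling_integral2 cp ig_.
have := integralD measurableT if1 ig2 => /= <-.
by have := integralD measurableT is_ idot => /= <-.
Qed.

End schrodinger_value.

(** * Equality of laws from couplings close to the diagonal *)

Section close_couplings.
Context {R : realType} {d : nat}.
Local Notation E := ('rV[R]_d).
Local Open Scope ereal_scope.

Let nbh (F : set E) (e : R) := [set x | exists2 y, F y & `|x - y| < e]%R.

Let open_nbh F e : open (nbh F e).
Proof.
rewrite openE => x [y Fy xy]; rewrite /interior.
have e0 : (0 < e - `|x - y|)%R by rewrite subr_gt0.
apply/nbhs_ballP; exists (e - `|x - y|)%R => //= z.
rewrite -ball_normE/= => xz; exists y => //.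
have -> : (z - y = (x - y) - (x - z))%R by rewrite opprB [RHS]addrC addrA subrK.
by rewrite (le_lt_trans (ler_normB _ _))// -ltrBrDl.
Qed.

Let le_closed (m1 m2 : probability E R) :
  (forall (e eta : R) F, (0 < e)%R -> (0 < eta)%R -> closed F ->
     m1 F <= m2 (nbh F e) + eta%:E) ->
  forall F, closed F -> m1 F <= m2 F.
Proof.
move=> H F cF.
have mn e : measurable (nbh F e) by apply: open_measurable_rV; exact: open_nbh.
pose G n := nbh F n.+1%:R^-1.
have GF : \bigcap_n G n = F.
  apply/seteqP; split => [x Gx|x Fx n _]; last first.
    by exists x => //; rewrite subrr normr0 invr_gt0.
  rewrite (closure_id F).1// => B /nbhs_ballP[e /= e0 eB].
  have [n ne] : exists n, (n.+1%:R^-1 < e :> R)%R.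
    exists (Num.truncn e^-1); rewrite invf_plt ?posrE//; exact: truncnS_gt.
  have [y Fy xy] := Gx n I; exists y; split => //; apply: eB.
  by rewrite -ball_normE/=; exact: lt_trans xy ne.
have cvgG : m2 (G n) @[n --> \oo] --> m2 F.
  rewrite -GF; apply: nonincreasing_cvg_mu => //.
  - by rewrite (le_lt_trans (probability_le1 m2 (mn _)))// ltry.
  - by move=> n; exact: mn.
  - by rewrite GF; exact: closed_measurable_rV.
  - apply/nonincreasing_seqP => n; apply/subsetPset => x [y Fy xy]; exists y => //.
    by rewrite (lt_le_trans xy)// lef_pV2 ?posrE// ler_nat.
apply/lee_addgt0Pr => eta eta0.
rewrite -leeBlDr// -(cvg_lim _ cvgG)//; apply: lime_ge.
  by apply/cvg_ex; eexists; exact: cvgG.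
by apply: nearW => n; rewrite leeBlDr//; apply: H => //; rewrite invr_gt0.
Qed.

Lemma measurable_far_pairs (e : R) :
  measurable [set z : E * E | exists i, e <= `|z.1 0 i - z.2 0 i|]%R.
Proof.
rewrite (_ : [set _ | _] = \bigcup_i [set z : E * E | e <= `|z.1 0 i - z.2 0 i|]%R).
  apply: countable_bigcupT_measurable => [|i]; first exact: countableP.
  have mi : measurable_fun setT (fun z : E * E => `|z.1 0 i - z.2 0 i|)%R.
    apply: measurableT_comp => //; apply: measurable_funB.
      exact: measurableT_comp (measurable_coord i) measurable_fst.
    exact: measurableT_comp (measurable_coord i) measurable_snd.
  have := measurable_fun_ler (measurable_cst e) mi.
  by move=> /(_ measurableT [set true]); rewrite setTI; apply.
by apply/seteqP; split => [z [i iz]|z [i _ iz]]; exists i.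
Qed.

Lemma eq_probability_close_couplings (m1 m2 : probability E R) :
  (forall e eta : R, (0 < e)%R -> (0 < eta)%R ->
     exists2 q : probability (E * E)%type R, coupling m1 m2 q &
       q [set z : E * E | exists i, e <= `|z.1 0 i - z.2 0 i|]%R <= eta%:E) ->
  forall A, measurable A -> m1 A = m2 A.
Proof.
move=> H; apply: eq_probability_closed => F cF.
have mF := closed_measurable_rV cF.
have mn e : measurable (nbh F e) by apply: open_measurable_rV; exact: open_nbh.
have nfar (z : E * E) e : (0 < e)%R ->
    ~ (exists i, e <= `|z.1 0 i - z.2 0 i|)%R -> (`|z.1 - z.2| < e)%R.
  move=> e0 H'; rewrite [ltLHS]/Num.norm/= mx_normrE; apply: bigmax_lt => //.
  move=> [i j] _ /=; rewrite ord1 !mxE ltNge; apply/negP => ej.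
  by apply: H'; exists j.
have mfst A : measurable A -> measurable (fst @^-1` A : set (E * E)).
  by move=> mA; have := @measurable_fst _ _ E E measurableT _ mA; rewrite setTI.
have msnd A : measurable A -> measurable (snd @^-1` A : set (E * E)).
  by move=> mA; have := @measurable_snd _ _ E E measurableT _ mA; rewrite setTI.
apply/eqP; rewrite eq_le; apply/andP; split; apply: le_closed => // e eta F' e0 eta0 cF'.
  have mF' := closed_measurable_rV cF'.
  have mn' : measurable (nbh F' e) by apply: open_measurable_rV; exact: open_nbh.
  have [q [q1 q2] qe] := H e eta e0 eta0.
  rewrite -q1// -q2// (le_trans _ (leeD2l _ qe))//.
  rewrite (le_trans _ (measureU2 q (msnd _ mn') (measurable_far_pairs e)))//.
  rewrite /pushforward; apply: le_measure; rewrite ?inE//.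
  - exact: mfst.
  - by apply: measurableU; [exact: msnd|exact: measurable_far_pairs].
  move=> z /= Fz; have [ez|ez] := pselect (exists i, e <= `|z.1 0 i - z.2 0 i|)%R; first by right.
  by left; exists z.1 => //; rewrite distrC; exact: nfar.
have mF' := closed_measurable_rV cF'.
have mn' : measurable (nbh F' e) by apply: open_measurable_rV; exact: open_nbh.
have [q [q1 q2] qe] := H e eta e0 eta0.
rewrite -q1// -q2// (le_trans _ (leeD2l _ qe))//.
rewrite (le_trans _ (measureU2 q (mfst _ mn') (measurable_far_pairs e)))//.
rewrite /pushforward; apply: le_measure; rewrite ?inE//.
- exact: msnd.
- by apply: measurableU; [exact: mfst|exact: measurable_far_pairs].
move=> z /= Fz; have [ez|ez] := pselect (exists i, e <= `|z.1 0 i - z.2 0 i|)%R; first by right.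
by left; exists z.2 => //; exact: nfar.
Qed.

End close_couplings.

(** * The barycentric map transports the optimal measure *)

Section markov_inequality.
Context d (T : measurableType d) (R : realType) (P : probability T R).
Local Open Scope ereal_scope.

Lemma integral_markov (u : T -> R) (a : R) : (0 < a)%R ->
  measurable_fun setT u -> {ae P, forall x, 0 <= u x}%R ->
  P [set x | a <= u x]%R <= \int[P]_x (u x)%:E * (a^-1)%:E.
Proof.
move=> a0 mu u0; have mEu : measurable_fun setT (EFin \o u) by exact/measurable_EFinP.
have := le_integral_abse P measurableT mEu a0.
rewrite setTI.
rewrite (_ : \int[P]_x _ = \int[P]_x (u x)%:E); last first.
  apply: ae_eq_integral => //; first exact: measurableT_comp.
  by apply: filterS u0 => x ux _ /=; rewrite ger0_norm.
move=> H; rewrite lee_pdivlMr// muleC; apply: le_trans H.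
apply: lee_wpmul2l; first by rewrite lee_fin ltW.
apply: le_measure; rewrite ?inE.
- have := measurable_fun_ler (measurable_cst a) mu.
  by move=> /(_ measurableT [set true]); rewrite setTI; apply.
- have mn : measurable_fun setT (fun x => `|u x|)%R by exact: measurableT_comp.
  have := measurable_fun_ler (measurable_cst a) mn.
  by move=> /(_ measurableT [set true]); rewrite setTI; apply.
- by move=> x /= ax; rewrite lee_fin (le_trans ax)// ler_norm.
Qed.

Lemma tail_small (u : T -> R) (a : R) : (0 < a)%R ->
  P.-integrable setT (EFin \o u) -> (forall x, 0 <= u x)%R ->
  exists2 r : R, (0 < r)%R & P [set x | r <= u x]%R <= a%:E.
Proof.
move=> a0 iu u0; set I := fine (\int[P]_x (u x)%:E).
have IE : \int[P]_x (u x)%:E = I%:E by rewrite fineK//; exact: integrable_fin_num.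
have I0 : (0 <= I)%R by apply: fine_ge0; apply: integral_ge0 => x _; rewrite lee_fin.
have r0 : (0 < (I + 1) / a)%R by rewrite divr_gt0// ltr_wpDl.
exists ((I + 1) / a)%R => //.
apply: le_trans (integral_markov r0 _ _) _.
- by apply/measurable_EFinP; exact: measurable_int iu.
- exact: nearW.
rewrite IE -EFinM lee_fin invfM invrK mulrA ler_piMl ?(ltW a0)//.
by rewrite ler_pdivrMr ?ltr_wpDl// mul1r lerDl.
Qed.

End markov_inequality.

Section optimal_coupling.
Context {R : realType} {d : nat}.
Local Notation E := ('rV[R]_d).
Variables (mu nu mubar : probability E R) (p : probability (E * E)%type R).
Hypothesis mu2 : finite_second_moment mu.
Hypothesis nu2 : finite_second_moment nu.
Hypothesis nu_exp : exponential_moments nu.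
Hypothesis nu_hyp : ~ concentrated_on_hyperplane nu.
Variable w : E -> R.
Hypothesis gw : egrowth w.
Hypothesis w_gt0 : forall y, 0 < w y.
Local Notation f := (dual_potential nu w).
Local Notation T := (mean nu w).
Local Open Scope ereal_scope.
Hypothesis VP_fin : VP_value mu nu \is a fin_num.
Hypothesis mubar_opt : solves_VP mu nu mubar.
Hypothesis p_opt : solves_SP mubar nu p.
Hypothesis pE : forall C, measurable C -> p C = \int[mubar \x nu]_(z in C)
  (expR (f z.1 + ln (w z.2) + dot z.1 z.2))%:E.

Let cf : continuous f. Proof. exact: (@continuous_dual_potential _ _ _ nu_exp _ gw). Qed.
Let mf : measurable_fun setT f. Proof. exact: continuous_measurable_rV cf. Qed.
Let mT : measurable_fun setT T.
Proof. by apply: continuous_measurable_rVrV; exact: mean_continuous. Qed.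
Let mubar2 : finite_second_moment mubar. Proof. by case: mubar_opt. Qed.
Let cp : coupling mubar nu p. Proof. by case: p_opt. Qed.

Let SP_fin : SP_value mubar nu \is a fin_num.
Proof.
have [_ Ve] := mubar_opt; move: VP_fin.
by rewrite -Ve /VP_objective fin_numD => /andP[].
Qed.

Lemma MCov_fin_num : MCov mubar mu \is a fin_num.
Proof.
have [_ Ve] := mubar_opt; move: VP_fin.
by rewrite -Ve /VP_objective fin_numD => /andP[].
Qed.

Lemma optimal_potentials :
  [/\ mubar.-integrable setT (EFin \o f),
      nu.-integrable setT (EFin \o (fun y => ln (w y))) &
      entropy p (mubar \x nu) = \int[mubar]_x (f x)%:E + \int[nu]_y (ln (w y))%:E
        + \int[p]_z (dot z.1 z.2)%:E].
Proof.
apply: potentials_integrable => //.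
have [_ pv] := p_opt; move: SP_fin; rewrite -pv /SP_objective.
by rewrite fin_numB => /andP[].
Qed.

Let if_ : mubar.-integrable setT (EFin \o f). Proof. by case: optimal_potentials. Qed.
Let iw : nu.-integrable setT (EFin \o (fun y => ln (w y))).
Proof. by case: optimal_potentials. Qed.
Let fin_f : \int[mubar]_x (f x)%:E \is a fin_num.
Proof. exact: integrable_fin_num. Qed.
Let fin_w : \int[nu]_y (ln (w y))%:E \is a fin_num.
Proof. exact: integrable_fin_num. Qed.

Lemma VP_valueE : VP_value mu nu =
  \int[mubar]_x (f x)%:E + \int[nu]_y (ln (w y))%:E + MCov mubar mu.
Proof.
have [_ <-] := mubar_opt; rewrite /VP_objective; congr (_ + _).
have [_ <-] := p_opt; rewrite /SP_objective.
have [_ _ ->] := optimal_potentials.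
by rewrite addeK//; apply: integrable_fin_num => //; exact: coupling_dot_integrable cp mubar2 nu2.
Qed.

Let wd := weak_duality_VP nu_exp nu2 gw w_gt0 iw mu2.

Lemma conjugate_dual_integrable : mu.-integrable setT (conjugate f).
Proof.
have Vb : VP_value mu nu - \int[nu]_y (ln (w y))%:E \is a fin_num.
  by rewrite fin_numB VP_fin.
have [] // := @integral_conjugate_le R d f cf mu mu2
  (fine (VP_value mu nu - \int[nu]_y (ln (w y))%:E)).
move=> xi sxi; rewrite fineK// leeBrDr// addeC (le_trans _ wd)// leeD2l//.
apply: le_integral_ae.
- exact: simple_map_conjugate_integrable.
- exact: measurable_conjugate.
- by apply: nearW => x; exact: conjugate_ge.
Qed.

Let c x := fine (conjugate f x).

Lemma ae_conjugateE : {ae mu, forall x, conjugate f x = (c x)%:E}.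
Proof.
have := integrable_ae measurableT conjugate_dual_integrable.
by apply: filterS => x /(_ I) cx; rewrite /c fineK.
Qed.

Let mc : measurable_fun setT c.
Proof.
by apply: (measurableT_comp (fine_measurable measurableT)); exact: measurable_conjugate.
Qed.

Let icE : \int[mu]_x conjugate f x = \int[mu]_x (c x)%:E.
Proof.
apply: ae_eq_integral => //; first exact: measurable_conjugate.
  exact/measurable_EFinP.
by apply: filterS ae_conjugateE => x cx _.
Qed.

Let ic : mu.-integrable setT (EFin \o c).
Proof.
apply/integrableP; split; first exact/measurable_EFinP.
have /integrableP[_] := conjugate_dual_integrable.
apply: le_lt_trans; rewrite le_eqVlt; apply/orP; left; apply/eqP.
apply: ae_eq_integral => //; first exact/measurableT_comp/measurable_EFinP.
  by apply: measurableT_comp => //; exact: measurable_conjugate.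
by apply: filterS ae_conjugateE => x cx _ /=; rewrite cx.
Qed.

Let gap (z : E * E) : R := (c z.2 - f z.1 - dot z.1 z.2)%R.

Let mgap : measurable_fun setT gap.
Proof.
apply: measurable_funB; last exact: measurable_dot_pair.
apply: measurable_funB; first exact: measurableT_comp mc measurable_snd.
exact: measurableT_comp mf measurable_fst.
Qed.

(* If the conjugate were almost attained at z.1, first order optimality would
   force z.2 = T z.1; the quadratic bound makes this quantitative. *)
Let gap_large (r e : R) : (0 < e)%R -> exists2 t : R, (0 < t)%R &
  forall z i, conjugate f z.2 = (c z.2)%:E -> (norm1 z.1 <= r)%R ->
  (e <= `|T z.1 0%R i - z.2 0%R i|)%R -> (t <= gap z)%R.
Proof.
move=> e0; have [K K0 HK] := log_laplace_quadratic nu_exp gw w_gt0 r.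
(* t <= 1 keeps the displacement in the range of the quadratic bound, and t <= e / (2 (K + 1)) makes
   the loss K t^2 at most half of the linear gain t e. *)
pose t := Num.min 1%R (e / (2 * (K + 1)))%R.
have K1 : (0 < 2 * (K + 1))%R by rewrite mulr_gt0// ltr_wpDl.
have t0 : (0 < t)%R by rewrite lt_min ltr01 divr_gt0.
have t1 : (t <= 1)%R by rewrite ge_min lexx.
have tK : (t * (2 * (K + 1)) <= e)%R.
  by rewrite -ler_pdivlMr// ge_min lexx orbT.
exists (t * e / 2)%R => [|z i cz zr ez]; first by rewrite !mulr_gt0.
(* The conjugate is tested at z.1 + b e_i, a displacement of size t along the discrepant coordinate
   with the sign of z.2 - T z.1. *)
pose b : R := if (0 <= z.2 0 i - T z.1 0 i)%R then t else (- t)%R.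
have bE : (b * (z.2 0 i - T z.1 0 i) = t * `|T z.1 0 i - z.2 0 i|)%R.
  rewrite distrC /b; case: ifPn => [h|]; first by rewrite ger0_norm.
  by rewrite -ltNge => h; rewrite ltr0_norm// mulNr mulrN.
have bt : (`|b| = t)%R by rewrite /b; case: ifP => _; rewrite ?normrN gtr0_norm.
have nb : norm1 (b *: basis_vec i : E) = t by rewrite norm1Z norm1_basis mulr1.
have := HK z.1 (b *: basis_vec i)%R zr; rewrite nb => /(_ t1).
have := conjugate_ge f z.2 (z.1 + b *: basis_vec i)%R; rewrite cz lee_fin.
rewrite dotDl !dotZl !dot_basis /gap /dual_potential => h1 h2.
have h3 : (t * e <= t * `|T z.1 0 i - z.2 0 i|)%R by rewrite ler_pM2l.
have h4 : (K * t ^+ 2 <= t * e / 2)%R.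
  have : (t * (t * (2 * (K + 1))) <= t * e)%R by rewrite ler_pM2l.
  have : (0 <= t ^+ 2)%R by exact: sqr_ge0.
  rewrite expr2; nra.
move: bE; rewrite mulrBr; lra.
Qed.

Lemma conjugate_fine_integrable :
  mu.-integrable setT (EFin \o (fun x => fine (conjugate f x))) /\
  \int[mu]_x conjugate f x = \int[mu]_x (fine (conjugate f x))%:E.
Proof. by split; [exact: ic|exact: icE]. Qed.

Section any_coupling.
Variable q : probability (E * E)%type R.
Hypothesis cq : coupling mubar mu q.

Let ae_c2 : {ae q, forall z, conjugate f z.2 = (c z.2)%:E}.
Proof.
have [N [mN N0 Nsub]] := ae_conjugateE.
exists (snd @^-1` N); split.
- by have := @measurable_snd _ _ E E measurableT _ mN; rewrite setTI.
- by have := cq.2 _ mN; rewrite /pushforward => ->.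
- by move=> z Hz; exact: Nsub.
Qed.

Let gap_ge0 : {ae q, forall z, 0 <= gap z}%R.
Proof.
apply: filterS ae_c2 => z cz; have := conjugate_ge f z.2 z.1.
by rewrite cz lee_fin /gap; lra.
Qed.

Let gapE : \int[q]_z (gap z)%:E =
  \int[mu]_x conjugate f x - \int[mubar]_x (f x)%:E - \int[q]_z (dot z.1 z.2)%:E.
Proof.
have [i2 e2] := coupling_integral2 cq ic.
have [i1 e1] := coupling_integral1 cq if_.
have idot := coupling_dot_integrable cq mubar2 mu2.
rewrite icE -e2 -e1.
have := integralB measurableT i2 i1 => /= <-.
by have := integralB measurableT (integrableB measurableT i2 i1) idot => /= <-.
Qed.

Let int_conj_fin : \int[mu]_x conjugate f x \is a fin_num.
Proof. by rewrite icE; exact: integrable_fin_num. Qed.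

Let dot_fin : \int[q]_z (dot z.1 z.2)%:E \is a fin_num.
Proof. by apply: integrable_fin_num => //; exact: coupling_dot_integrable cq mubar2 mu2. Qed.

Lemma coupling_dot_le_conjugate :
  \int[q]_z (dot z.1 z.2)%:E + \int[mubar]_x (f x)%:E <= \int[mu]_x conjugate f x.
Proof.
have : 0 <= \int[q]_z (gap z)%:E.
  rewrite -(integral0 q setT); apply: le_integral_ae => //.
  - exact: integrable0.
  - exact/measurable_EFinP.
rewrite gapE.
move: dot_fin int_conj_fin fin_f => /fineK <- /fineK <- /fineK <-.
by rewrite -?EFinD -?EFinN -?EFinD !lee_fin; lra.
Qed.

Lemma gap_integral_le (a : R) : (MCov mubar mu - a%:E <= \int[q]_z (dot z.1 z.2)%:E) ->
  \int[q]_z (gap z)%:E <= a%:E.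
Proof.
have := wd; rewrite VP_valueE gapE.
move: MCov_fin_num dot_fin int_conj_fin fin_f fin_w.
move=> /fineK <- /fineK <- /fineK <- /fineK <- /fineK <-.
by rewrite -?EFinD -?EFinN -?EFinD !lee_fin; lra.
Qed.

(** Three sets cover the bad pairs: z.1 outside the ball on which t is uniform, a tail event for
    mubar; gap at least t, controlled by Markov's inequality; and the null set where the conjugate
    is infinite. *)
Lemma far_from_barycenter_le (r e t a : R) : (0 < t)%R ->
  (forall z i, conjugate f z.2 = (c z.2)%:E -> (norm1 z.1 <= r)%R ->
    (e <= `|T z.1 0%R i - z.2 0%R i|)%R -> (t <= gap z)%R) ->
  (MCov mubar mu - a%:E <= \int[q]_z (dot z.1 z.2)%:E) ->
  exists2 S : set (E * E), measurable S & q S <= mubar [set x | r <= d%:R * enorm x]%R + (a / t)%:E /\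
    [set z : E * E | exists i, e <= `|T z.1 0%R i - z.2 0%R i|]%R `<=` S.
Proof.
move=> t0 Ht Ha; have [N [mN N0 Nsub]] := ae_c2.
pose A := [set x : E | r <= d%:R * enorm x]%R.
have mA : measurable A.
  have me : measurable_fun setT (fun x : E => d%:R * enorm x)%R.
    by apply: measurable_funM => //; exact: measurable_enorm.
  have := measurable_fun_ler (measurable_cst r) me.
  by move=> /(_ measurableT [set true]); rewrite setTI; apply.
pose B := [set z | t <= gap z]%R.
have mB : measurable B.
  have := measurable_fun_ler (measurable_cst t) mgap.
  by move=> /(_ measurableT [set true]); rewrite setTI; apply.
have mA1 : measurable (fst @^-1` A : set (E * E)).
  by have := @measurable_fst _ _ E E measurableT _ mA; rewrite setTI.
have mAB : measurable (fst @^-1` A `|` B) by exact: measurableU.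
exists (fst @^-1` A `|` B `|` N); first exact: measurableU.
split; last first.
  move=> z [i iz]; have [cz|cz] := pselect (conjugate f z.2 = (c z.2)%:E).
    left; have [zr|zr] := leP (norm1 z.1) r; first by right; exact: Ht iz.
    by left; apply/ltW/(lt_le_trans zr)/norm1_le_enorm.
  by right; exact: Nsub.
apply: (le_trans (measureU2 q mAB mN)); rewrite [X in _ + X]N0 adde0.
apply: (le_trans (measureU2 q mA1 mB)); apply: leeD.
  by rewrite -[leLHS]/(pushforward q fst A) cq.1.
apply: (le_trans (integral_markov t0 mgap gap_ge0)).
by rewrite EFinM; apply: lee_wpmul2r; [rewrite lee_fin invr_ge0 ltW|exact: gap_integral_le].
Qed.

End any_coupling.

Lemma mean_image B : measurable B -> mubar (T @^-1` B) = mu B.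
Proof.
pose TX : {mfun E >-> E} := HB.pack T (isMeasurableFun.Build _ _ _ _ T mT).
pose m1 : probability E R := distribution mubar TX.
move=> mB; rewrite -[LHS]/(m1 B); apply: eq_probability_close_couplings mB => e eta e0 eta0.
have eta2 : (0 < eta / 2)%R by rewrite divr_gt0.
have ide : mubar.-integrable setT (EFin \o (fun x => d%:R * enorm x)%R).
  have := integrableZl measurableT (d%:R : R) (integrable_enorm mubar2); exact.
have [|r r0 Pr] := tail_small eta2 ide; first by move=> x; rewrite mulr_ge0 ?enorm_ge0.
have [t t0 Ht] := gap_large r e0.
(* Half of eta is spent on the tail of mubar. A coupling within t (eta / 2) of the supremum spends
   the other half, since Markov's inequality divides the gap by t. *)
have a0 : (0 < t * (eta / 2))%R by rewrite mulr_gt0.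
have [_ [q cq <-] Hq] := ub_ereal_sup_adherent a0 MCov_fin_num.
have [S mS [qS Ssub]] := far_from_barycenter_le cq t0 Ht (ltW Hq).
have mTs : measurable_fun setT (fun z : E * E => (T z.1, z.2)).
  apply: measurable_fun_pair; last exact: measurable_snd.
  exact: measurableT_comp mT measurable_fst.
pose TS : {mfun (E * E)%type >-> (E * E)%type} := HB.pack (fun z : E * E => (T z.1, z.2))
  (isMeasurableFun.Build _ _ _ _ _ mTs).
pose q' : probability (E * E)%type R := distribution q TS.
exists q'.
  split=> [A mA|A mA]; last exact: cq.2.
  have mTA : measurable (T @^-1` A) by have := mT measurableT mA; rewrite setTI.
  exact: cq.1 mTA.
apply: (@le_trans _ _ (q S)).
  rewrite -[leLHS]/(q [set z : E * E | exists i, e <= `|T z.1 0 i - z.2 0 i|]%R).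
  apply: le_measure; rewrite ?inE//.
  have := mTs measurableT _ (measurable_far_pairs e); rewrite setTI; exact.
apply: (le_trans qS); rewrite (le_trans (leeD2r _ Pr))// -EFinD lee_fin.
by rewrite mulrAC mulfV ?gt_eqF// mul1r -splitr.
Qed.

(** One inequality is weak duality. For the other, xb.x <= c(x) - f(xb) integrated along every
    coupling bounds [MCov]. *)
Lemma VP_value_conjugate :
  VP_value mu nu = \int[nu]_y (ln (w y))%:E + \int[mu]_x conjugate f x.
Proof.
apply/eqP; rewrite eq_le [X in _ && X]wd andbT VP_valueE.
rewrite addeAC [leLHS]addeC; apply: leeD2l.
rewrite addeC -leeBrDr//; apply: ge_ereal_sup => _ [q cq <-].
by rewrite leeBrDr//; exact: coupling_dot_le_conjugate.
Qed.

End optimal_coupling.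

(** * Borel images of injective continuous maps *)

Section injective_image.
Context {R : realType} {d : nat}.
Local Notation E := ('rV[R]_d).
Variable T : E -> E.
Hypothesis cT : continuous T.
Hypothesis injT : injective T.

Let box (n : nat) : set E := [set x | `|x| <= n%:R].

Let closed_box n : closed (box n).
Proof.
rewrite (_ : box n = closed_ball_ (@Num.norm R E) (0 : E) n%:R).
  exact: closed_closed_ball_.
by apply/seteqP; split => x; rewrite /box/closed_ball_/= sub0r normrN.
Qed.

Let bigcup_box : \bigcup_n box n = [set: E].
Proof.
apply/seteqP; split => // x _; exists (Num.truncn `|x|).+1 => //=.
by apply/ltW/truncnS_gt.
Qed.

Let compact_closed_box (F : set E) n : closed F -> compact (F `&` box n).
Proof.
move=> cF; apply: bounded_closed_compact; last exact: closedI.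
exists n%:R; split => // r nr x [_ /=]; rewrite /box/= => xn.
by rewrite (le_trans xn)// ltW.
Qed.

(** R^d is sigma-compact, so the image of a closed set is a countable union of compact sets. This
    elementary fact, with injectivity, takes the place of the Lusin-Souslin theorem. *)
Lemma closed_image_measurable (F : set E) : closed F -> measurable (T @` F).
Proof.
move=> cF; rewrite -[F]setIT -bigcup_box setI_bigcupr image_bigcup.
apply: bigcup_measurable => n _; apply: closed_measurable_rV.
apply: compact_closed; first exact: norm_hausdorff.
by apply: continuous_compact; [exact: continuous_subspaceT|exact: compact_closed_box].
Qed.

(* The sets with Borel image form a sigma-algebra by injectivity. *)
Lemma injective_image_measurable (B : set E) : measurable B -> measurable (T @` B).
Proof.
pose G := [set B : set E | measurable (T @` B)].
have GC A : G A -> G (~` A).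
  move=> GA; rewrite /G/= (_ : T @` (~` A) = range T `\` T @` A).
    by apply: measurableD => //; apply: closed_image_measurable; exact: closedT.
  apply/seteqP; split => [_ [x Ax <-]|_ [[x _ <-] nx]].
    by split; [exists x|move=> [z Az /injT zx]; apply: Ax; rewrite -zx].
  by exists x => // Ax; apply: nx; exists x.
have : smallest (sigma_algebra setT) (@open E) `<=` G.
  apply: smallest_sub.
    split.
    - by rewrite /G/= image_set0.
    - by move=> A GA; rewrite setTD; exact: GC.
    - by move=> F GF; rewrite /G/= image_bigcup; apply: bigcup_measurable => n _; exact: GF.
  move=> U oU; rewrite -[U]setCK; apply: GC; rewrite /G/=.
  by apply: closed_image_measurable; rewrite closedC.
exact.
Qed.

(* [left_inverse] sends the points outside the range to 0. *)
Definition left_inverse (x : E) : E :=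
  if pselect (exists z, T z = x) is left h then projT1 (cid h) else 0.

Lemma left_inverseK : cancel T left_inverse.
Proof.
move=> x; rewrite /left_inverse; case: pselect => [h|]; last by case; exists x.
by apply: injT; rewrite (projT2 (cid h)).
Qed.

Lemma left_inverse_range x : range T x -> T (left_inverse x) = x.
Proof. by move=> [z _ <-]; rewrite left_inverseK. Qed.

Lemma measurable_left_inverse : measurable_fun setT left_inverse.
Proof.
move=> _ B mB; rewrite setTI.
have mr : measurable (range T) by exact: injective_image_measurable.
(* The default value 0 adds the complement of the range exactly when B contains 0. *)
rewrite (_ : _ @^-1` B = T @` B `|` (~` range T `&` [set x | B 0])).
  apply: measurableU; first exact: injective_image_measurable.
  apply: measurableI; first exact: measurableC.
  have [B0|B0] := pselect (B 0); [rewrite (_ : [set _ | _] = setT)|rewrite (_ : [set _ | _] = set0)] => //.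
  - by apply/seteqP; split.
  - by apply/seteqP; split.
apply/seteqP; split => x /=.
  rewrite /left_inverse; case: pselect => [h|h] Bx.
    by left; exists (projT1 (cid h)) => //; rewrite (projT2 (cid h)).
  by right; split => // -[z _ zx]; apply: h; exists z.
move=> [[z Bz <-]|[nx B0]]; first by rewrite left_inverseK.
rewrite /left_inverse; case: pselect => // -[z zx].
by case: nx; exists z.
Qed.

End injective_image.

(** * Conditional measures *)

Section density_kernel.
Context {R : realType} {d : nat}.
Local Notation E := ('rV[R]_d).
Local Open Scope ereal_scope.

Lemma measurable_integral_xsection (nu : probability E R) (C : set (E * E))
    (g : E * E -> \bar R) : measurable C -> (forall z, 0 <= g z) ->
  measurable_fun setT g ->
  measurable_fun setT (fun x => \int[nu]_(y in xsection C x) g (x, y)).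
Proof.
move=> mC g0 mg.
rewrite (_ : (fun _ => _) = fubini_F nu (g \_ C)).
  apply: measurable_fun_fubini_tonelli_F => //.
    by apply/(measurable_restrictT _ mC); exact: measurable_funTS.
  by move=> z; rewrite erestrict_ge0.
apply/funext => x; rewrite /fubini_F [LHS]integral_mkcond.
by apply: eq_integral => y _; rewrite /patch mem_xsection.
Qed.

Lemma integral_product_xsection (alpha nu : probability E R) (C : set (E * E))
    (g : E * E -> \bar R) : measurable C -> (forall z, 0 <= g z) ->
  measurable_fun setT g ->
  \int[alpha \x nu]_(z in C) g z =
  \int[alpha]_x \int[nu]_(y in xsection C x) g (x, y).
Proof.
move=> mC g0 mg; rewrite integral_mkcond fubini_tonelli1.
- rewrite /fubini_F; apply: eq_integral => x _; rewrite [RHS]integral_mkcond.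
  by apply: eq_integral => y _; rewrite /patch mem_xsection.
- by apply/(measurable_restrictT _ mC); exact: measurable_funTS.
- by move=> z; rewrite erestrict_ge0.
Qed.

Lemma exists_prob_kernel (k : E -> {measure set E -> \bar R}) :
  (forall U, measurable U -> measurable_fun setT (k ^~ U)) ->
  (forall x, k x setT = 1) ->
  exists K : R.-pker E ~> E, forall x U, K x U = k x U.
Proof.
move=> mk k1.
pose K1 : kernel E E R := HB.pack k (isKernel.Build _ _ _ _ _ k mk).
pose K2 : R.-pker E ~> E := HB.pack (Kernel.sort K1) K1 (Kernel_isProbability.Build _ _ _ _ _ (Kernel.sort K1) k1).
by exists K2.
Qed.

Variables (nu : probability E R) (K : E * E -> R).
Hypothesis mK : measurable_fun setT K.
Let eK z := (expR (K z))%:E.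
Let meK : measurable_fun setT eK.
Proof. by apply/measurable_EFinP; exact: measurableT_comp. Qed.
Let eK_ge0 z : 0 <= eK z. Proof. by rewrite lee_fin expR_ge0. Qed.
Variable k : E -> {measure set E -> \bar R}.
Hypothesis kE : forall x B, measurable B -> k x B = \int[nu]_(y in B) eK (x, y).

Lemma measurable_density_kernel U : measurable U -> measurable_fun setT (k ^~ U).
Proof.
move=> mU; rewrite (_ : k ^~ U = fun x => \int[nu]_(y in xsection (setT `*` U) x) eK (x, y)).
  by apply: measurable_integral_xsection => //; exact: measurableX.
by apply/funext => x; rewrite kE// in_xsectionX// inE.
Qed.

Variables (alpha : probability E R) (p : probability (E * E)%type R).

Lemma density_disintegration :
  (forall C, measurable C -> p C = \int[alpha \x nu]_(z in C) eK z) ->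
  forall A B, measurable A -> measurable B ->
    p (A `*` B) = \int[alpha]_(x in A) k x B.
Proof.
move=> pE A B mA mB; rewrite pE; last exact: measurableX.
rewrite integral_product_xsection//; last exact: measurableX.
rewrite [RHS]integral_mkcond; apply: eq_integral => x _; rewrite /patch.
case: ifPn => xA; first by rewrite in_xsectionX// kE.
by rewrite notin_xsectionX// integral_set0.
Qed.

Lemma disintegration_density (kp : R.-pker E ~> E) :
  (forall x U, kp x U = k x U) -> disintegration p alpha kp ->
  forall C, measurable C -> p C = \int[alpha \x nu]_(z in C) eK z.
Proof.
move=> kpE pk C mC; rewrite (disintegration_xsection pk mC) integral_product_xsection//.
by apply: eq_integral => x _; rewrite kpE kE//; exact: measurable_xsection.
Qed.

End density_kernel.

Section conditional_moments.
Context {R : realType} {d : nat}.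
Local Notation E := ('rV[R]_d).
Variables (nu : probability E R) (w : E -> R).
Hypothesis nu_exp : exponential_moments nu.
Hypothesis gw : egrowth w.
Hypothesis w_gt0 : forall y, 0 < w y.
Local Notation f := (dual_potential nu w).
Local Notation T := (mean nu w).
Local Open Scope ereal_scope.
Variable k : E -> {measure set E -> \bar R}.
Hypothesis kE : forall x B, measurable B ->
  k x B = \int[nu]_(y in B) (expR (f x + ln (w y) + dot x y))%:E.

Lemma conditional_setT x : k x setT = 1.
Proof. by rewrite kE//; exact: integral_expR_dual_potential. Qed.

(** Integrals under pi_x become quotients of Laplace transforms, the form taken by the derivatives
    of ln L; this is how gradient and Hessian are matched with barycenter and covariance. *)
Lemma conditional_integral x g : egrowth g ->
  (k x).-integrable setT (EFin \o g) /\
  \int[k x]_y (g y)%:E = (Lap nu (fun y => w y * g y) x / Lap nu w x)%R%:E.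
Proof.
move=> gg; have gwg : egrowth (fun y => w y * g y)%R by exact: egrowthM.
have ig := Lap_integrable nu_exp x gwg.
have e y : (g y * expR (f x + ln (w y) + dot x y) =
    (Lap nu w x)^-1 * (w y * g y * expR (dot x y)))%R.
  rewrite !expRD lnK ?posrE// /dual_potential expRN lnK ?posrE; first by ring.
  exact: Lap_weight_gt0.
have mz : measurable_fun setT (fun y => expR (f x + ln (w y) + dot x y)).
  apply: measurableT_comp => //; apply: measurable_funD; last exact: measurable_fun_dot.
  by apply: measurable_funD => //; exact: measurableT_comp (@measurable_ln R) gw.1.
have iz : nu.-integrable setT
    (EFin \o (fun y => g y * expR (f x + ln (w y) + dot x y))%R).
  have := integrableZl measurableT (Lap nu w x)^-1 ig; apply: eq_integrable => // y _ /=.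
  by rewrite e EFinM.
have [i1 ->] := integrable_density (fun y => expR_ge0 _) mz (kE x) gg.1 iz.
split => //; rewrite (eq_integral (fun y =>
    (Lap nu w x)^-1%:E * (w y * g y * expR (dot x y))%:E)).
  by rewrite integralZl// -Lap_EFin// -EFinM mulrC.
by move=> y _; rewrite e EFinM.
Qed.

Lemma barycenter_conditional x : barycenter (k x) = T x.
Proof.
apply/rowP => i; rewrite mean_coord mxE /Rintegral.
by have [_ ->] := conditional_integral x (egrowth_coord i).
Qed.

Lemma covariance_conditional x : (covariance_matrix (k x) =
  \matrix_(i, j) (Lap nu (fun y => w y * ((y 0 i - T x 0 i) * (y 0 j - T x 0 j))) x
                  / Lap nu w x))%R.
Proof.
apply/matrixP => i j; rewrite [LHS]mxE [RHS]mxE barycenter_conditional /Rintegral.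
have g1 l : egrowth (fun y : E => y 0 l - T x 0 l)%R.
  by apply: egrowthD; [exact: egrowth_coord|exact: egrowth_cst].
by have [_ ->] := conditional_integral x (egrowthM (g1 i) (g1 j)).
Qed.

Lemma conditional_second_moment x : finite_second_moment (k x).
Proof.
rewrite /finite_second_moment.
by have [_ ->] := conditional_integral x (@egrowth_sqr_enorm R d); rewrite ltry.
Qed.

End conditional_moments.

(** * Primal optimality *)

Section primal_optimizer.
Context {R : realType} {d : nat}.
Local Notation E := ('rV[R]_d).
Variables (mu nu mubar : probability E R) (p : probability (E * E)%type R).
Hypothesis mu2 : finite_second_moment mu.
Hypothesis nu2 : finite_second_moment nu.
Hypothesis nu_exp : exponential_moments nu.
Hypothesis nu_hyp : ~ concentrated_on_hyperplane nu.
Variable w : E -> R.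
Hypothesis gw : egrowth w.
Hypothesis w_gt0 : forall y, 0 < w y.
Local Notation f := (dual_potential nu w).
Local Notation T := (mean nu w).
Local Open Scope ereal_scope.
Hypothesis VP_fin : VP_value mu nu \is a fin_num.
Hypothesis mubar_opt : solves_VP mu nu mubar.
Hypothesis p_opt : solves_SP mubar nu p.
Let K (z : E * E) : R := (f z.1 + ln (w z.2) + dot z.1 z.2)%R.
Hypothesis pE : forall C, measurable C -> p C = \int[mubar \x nu]_(z in C)
  (expR (f z.1 + ln (w z.2) + dot z.1 z.2))%:E.
Variable k : E -> {measure set E -> \bar R}.
Hypothesis kE : forall x B, measurable B ->
  k x B = \int[nu]_(y in B) (expR (f x + ln (w y) + dot x y))%:E.
Variable m : probability (E * E)%type R.
Hypothesis mE : forall C, measurable C -> m C = pushforward p (fun z => (T z.1, z.2)) C.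

(** Add the strict tangent inequalities at the two points: if the barycenters coincide, everything
    cancels. *)
Lemma mean_injective : injective T.
Proof.
move=> x x' Txx; apply/eqP; rewrite -subr_eq0; apply/negPn/negP => s0.
have := dual_potential_tangent nu_exp nu_hyp gw w_gt0 x' s0.
have s1 : (x' - x != 0)%R by rewrite -opprB oppr_eq0.
have := dual_potential_tangent nu_exp nu_hyp gw w_gt0 x s1.
rewrite !subrKC Txx -(opprB x x') dotNl; lra.
Qed.

Lemma conjugate_mean x : conjugate f (T x) = (dot x (T x) + f x)%:E.
Proof.
apply/eqP; rewrite eq_le [X in _ && X]conjugate_ge andbT.
apply: ge_ereal_sup => _ [h _ <-]; rewrite lee_fin.
have := dual_potential_le nu_exp nu_hyp gw w_gt0 x (h - x)%R.
by rewrite subrKC dotBl; lra.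
Qed.

Let opt := optimal_potentials nu2 nu_exp nu_hyp gw w_gt0 VP_fin mubar_opt p_opt pE.

Local Notation S := (left_inverse T).

Let cT : continuous T. Proof. exact: mean_continuous. Qed.
Let mT : measurable_fun setT T. Proof. exact: continuous_measurable_rVrV. Qed.
Let mS : measurable_fun setT S.
Proof. by apply: measurable_left_inverse => //; exact: mean_injective. Qed.
Let cf : continuous f. Proof. exact: (@continuous_dual_potential _ _ _ nu_exp _ gw). Qed.
Let mf : measurable_fun setT f. Proof. exact: continuous_measurable_rV cf. Qed.
Let mKxi (xi : E -> E) : measurable_fun setT xi ->
  measurable_fun setT (fun z : E * E => f (xi z.1) + ln (w z.2) + dot (xi z.1) z.2)%R.
Proof.
move=> mxi; have mxi1 : measurable_fun setT (fun z : E * E => xi z.1).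
  exact: measurableT_comp mxi measurable_fst.
apply: measurable_funD; last exact: measurable_fun_dot.
apply: measurable_funD; first exact: measurableT_comp mf mxi1.
apply: (measurableT_comp (f := fun y => ln (w y))) measurable_snd.
exact: measurableT_comp (@measurable_ln R) gw.1.
Qed.
Let mK : measurable_fun setT K. Proof. exact: (mKxi (@measurable_id _ _ setT)). Qed.

Let T_image := mean_image mu2 nu2 nu_exp nu_hyp gw w_gt0 VP_fin mubar_opt p_opt pE.

(** mu is the image of mubar under T, and the range is Borel because T is continuous and
    injective. *)
Lemma ae_range_mean : {ae mu, forall x, range T x}.
Proof.
have mr : measurable (range T).
  by apply: injective_image_measurable => //; exact: mean_injective.
exists (~` range T); split; [exact: measurableC| |by []].
have := probability_setC mu (measurableC mr); rewrite setCK => H.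
rewrite -T_image; last exact: measurableC.
rewrite (_ : _ @^-1` _ = set0) ?measure0//.
by apply/seteqP; split => // x /= nx; apply: nx; exists x.
Qed.

Let TS : E * E -> E * E := fun z => (T z.1, z.2).
Let mTS : measurable_fun setT TS.
Proof.
apply: measurable_fun_pair; last exact: measurable_snd.
exact: measurableT_comp mT measurable_fst.
Qed.

Let cp : coupling mubar nu p. Proof. by case: p_opt. Qed.

Lemma image_coupling : coupling mu nu m.
Proof.
split=> A mA.
- rewrite /pushforward mE.
    have mTA : measurable (T @^-1` A) by have := mT measurableT mA; rewrite setTI.
    by rewrite -T_image// -cp.1.
  by have := @measurable_fst _ _ E E measurableT _ mA; rewrite setTI.
- rewrite /pushforward mE; first by rewrite -cp.2.
  by have := @measurable_snd _ _ E E measurableT _ mA; rewrite setTI.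
Qed.

(** As S inverts T, conditioning on T(xb) amounts to conditioning on xb, so the kernel of p is
    carried over by composition with S. *)
Lemma image_kernel : exists2 km : R.-pker E ~> E,
  disintegration m mu km & forall x U, km x U = k (S x) U.
Proof.
have mk := measurable_density_kernel mK (fun x B mB => kE x mB).
have [|x|km kmE] := @exists_prob_kernel _ _ (fun x => k (S x)).
- by move=> U mU; exact: measurableT_comp (mk U mU) mS.
- exact: (conditional_setT nu_exp gw w_gt0 kE).
exists km => // A B mA mB.
have mAB : measurable (A `*` B) by exact: measurableX.
have mTA : measurable (T @^-1` A) by have := mT measurableT mA; rewrite setTI.
rewrite mE// -[LHS]/(p ((T @^-1` A) `*` B)).
rewrite (density_disintegration mK (fun x B mB => kE x mB) pE mTA mB).
rewrite [LHS]integral_mkcond [RHS]integral_mkcond.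
rewrite -(ge0_image_integral (P := mubar) mT T_image).
- apply: eq_integral => x _; rewrite /patch.
  have -> : (T x \in A) = (x \in T @^-1` A) by apply/idP/idP; rewrite !inE.
  by case: ifP => // _; rewrite kmE left_inverseK//; exact: mean_injective.
- apply/(measurable_restrictT _ mA); apply: measurable_funTS; exact: measurable_kernel.
- by move=> x; rewrite erestrict_ge0.
Qed.

Lemma image_kernel_unique (km : R.-pker E ~> E) : disintegration m mu km ->
  {ae mu, forall x, range T x /\ forall B, measurable B -> km x B = k (S x) B}.
Proof.
have [km' dm' kmE'] := image_kernel => dm.
apply: filterS2 ae_range_mean (disintegration_unique dm dm') => x rx H.
by split => // B mB; rewrite -kmE' H.
Qed.

Lemma image_martingale : martingale_coupling mu nu m.
Proof.
split; first exact: image_coupling.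
have [km dm kmE] := image_kernel; exists km; split => //.
apply: filterS ae_range_mean => x rx.
have -> : barycenter (km x) = barycenter (k (S x)).
  congr barycenter; apply: eq_measure; apply/funext => U; exact: kmE.
by rewrite (barycenter_conditional nu_exp gw w_gt0 kE) left_inverse_range//; exact: mean_injective.
Qed.

(** The density of m with respect to mu x nu is that of p read through S, by the kernel found above;
    pulled back by (T, id) the two log-densities coincide. Injectivity of T is what prevents a loss
    of entropy. *)
Lemma image_entropy : entropy m (mu \x nu) = entropy p (mubar \x nu).
Proof.
have [km dm kmE] := image_kernel.
have mKS := mKxi mS.
have kSE x B : measurable B -> k (S x) B = \int[nu]_(y in B)
  (expR (f (S x) + ln (w y) + dot (S x) y))%:E by exact: kE.
have mD := disintegration_density mKS kSE kmE dm.
have Kfin : entropy p (mubar \x nu) \is a fin_num.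
  have [i_f i_w ->] := opt; rewrite 2!fin_numD; apply/andP; split.
    by apply/andP; split; exact: integrable_fin_num.
  by apply: integrable_fin_num => //; exact: coupling_dot_integrable cp mubar_opt.1 nu2.
move: Kfin; rewrite (entropy_density mKS mD) (entropy_density mK pE) => Kfin.
have iK := integral_fin_num_integrable mK Kfin.
have KT z : K z = (f (S (TS z).1) + ln (w (TS z).2) + dot (S (TS z).1) (TS z).2)%R.
  by rewrite /TS/= left_inverseK//; exact: mean_injective.
have mTSE B : measurable B -> p (TS @^-1` B) = m B by move=> mB; rewrite mE.
have iKS : m.-integrable setT
    (EFin \o (fun z => f (S z.1) + ln (w z.2) + dot (S z.1) z.2)%R).
  apply: (image_integrable mTS mTSE mKS).
  by apply: eq_integrable iK => // z _ /=; rewrite KT.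
have [_ <-] := image_integral mTS mTSE iKS.
by apply: eq_integral => z _; rewrite KT.
Qed.

(** Under p the conditional barycenter of y is T(x), so x.y integrates like x.T(x). Since c(T x) =
    x.T(x) + f(x) and T carries mubar to mu, the entropy becomes int ln w dnu + int c dmu. *)
Lemma entropy_VP_value : entropy p (mubar \x nu) = VP_value mu nu.
Proof.
have [i_f i_w ->] := opt.
rewrite (VP_value_conjugate mu2 nu2 nu_exp nu_hyp gw w_gt0 VP_fin mubar_opt p_opt pE).
have [ic ->] := conjugate_fine_integrable mu2 nu2 nu_exp nu_hyp gw w_gt0 VP_fin mubar_opt p_opt pE.
have [icT <-] := image_integral mT T_image ic.
have cE x : fine (conjugate f (T x)) = (dot x (T x) + f x)%R by rewrite conjugate_mean.
have idT : mubar.-integrable setT (EFin \o (fun x => dot x (T x))).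
  have := integrableB measurableT icT i_f; apply: eq_integrable => // x _ /=.
  by rewrite cE -EFinB addrK.
have -> : \int[p]_z (dot z.1 z.2)%:E = \int[mubar]_x (dot x (T x))%:E.
  have [kp kpE] := exists_prob_kernel
    (measurable_density_kernel mK (fun x B mB => kE x mB))
    (conditional_setT nu_exp gw w_gt0 kE).
  have dkp : disintegration p mubar kp.
    move=> A B mA mB.
    rewrite (density_disintegration mK (fun x B mB => kE x mB) pE mA mB).
    by apply: eq_integral => x _; rewrite kpE.
  apply: (disintegration_dot (xi := idfun) cp dkp nu2).
  - exact: coupling_dot_integrable cp mubar_opt.1 nu2.
  - exact: measurable_fun_dot.
  apply: nearW => x; congr dot.
  have -> : barycenter (kp x) = barycenter (k x).
    congr barycenter; apply: eq_measure; apply/funext => U; exact: kpE.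
  by rewrite (barycenter_conditional nu_exp gw w_gt0 kE).
under [X in _ = _ + X]eq_integral do rewrite cE.
have := integralD measurableT idT i_f => /= ->.
by rewrite [X in X + _ = _]addeC -addeA; congr (_ + _); exact: addeC.
Qed.

Lemma image_solves_P : solves_P mu nu m.
Proof.
split; first exact: image_martingale.
have [_ i_w _] := opt.
rewrite image_entropy; apply/eqP; rewrite eq_le; apply/andP; split.
  rewrite entropy_VP_value.
  rewrite (VP_value_conjugate mu2 nu2 nu_exp nu_hyp gw w_gt0 VP_fin mubar_opt p_opt pE).
  by apply: le_ereal_inf_tmp => _ [m' mm' <-]; exact: weak_duality_P.
rewrite -image_entropy; apply: ereal_inf_lbound; exists m => //; exact: image_martingale.
Qed.

End primal_optimizer.

(** * Bounded continuous approximations of the dual potential *)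

Section dominated_real.
Context d (X : measurableType d) (R : realType) (P : {measure set X -> \bar R}).

Lemma dominated_Rintegral_cvg (F : nat -> X -> R) (L G : X -> R) :
  (forall n, measurable_fun setT (F n)) -> measurable_fun setT L ->
  {ae P, forall x, F n x @[n --> \oo] --> L x} ->
  P.-integrable setT (EFin \o G) ->
  {ae P, forall x, forall n, `|F n x| <= G x} ->
  P.-integrable setT (EFin \o L) /\
  \int[P]_x F n x @[n --> \oo] --> \int[P]_x L x.
Proof.
move=> mF mL FL iG FG.
have mEF n : measurable_fun setT (EFin \o F n) by exact/measurable_EFinP.
have mEL : measurable_fun setT (EFin \o L) by exact/measurable_EFinP.
have [||iL _ H] := dominated_convergence measurableT mEF mEL _ iG.
- apply: filterS FL => x FLx _; apply: cvg_EFin; first exact: nearW.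
  exact: FLx.
- by apply: filterS FG => x FGx n _; rewrite /= lee_fin.
split => //; rewrite /Rintegral.
apply: fine_cvg; rewrite fineK; first exact: H.
exact: integrable_fin_num.
Qed.

End dominated_real.

Lemma Rintegral_probability_cst d (X : measurableType d) (R : realType)
    (P : probability X R) (c : R) : \int[P]_x c = c.
Proof. by rewrite /Rintegral integral_probability_cst. Qed.

Lemma jensen_expR d (X : measurableType d) (R : realType) (P : probability X R)
    (u : X -> R) : P.-integrable setT (EFin \o u) ->
  P.-integrable setT (EFin \o (expR \o u)) ->
  \int[P]_x u x <= ln (\int[P]_x expR (u x)).
Proof.
move=> iu ieu; set c := \int[P]_x u x.
have i1 : P.-integrable setT (EFin \o (fun=> expR c * (1 - c))).
  exact: finite_measure_integrable_cst.
have i2 : P.-integrable setT (EFin \o (fun x => expR c * u x)).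
  have := integrableZl measurableT (expR c) iu; exact.
have cE : \int[P]_x (expR c * (1 - c) + expR c * u x) = expR c.
  by rewrite RintegralD// Rintegral_probability_cst RintegralZl// -/c; ring.
have H : expR c <= \int[P]_x expR (u x).
  rewrite -[leLHS]cE; apply: le_Rintegral => //.
    have := integrableD measurableT i1 i2; exact.
  move=> x _; have := expR_ge1Dx (u x - c).
  rewrite -(ler_pM2l (expR_gt0 c)) -expRD subrKC; lra.
rewrite -[leLHS]expRK ler_ln ?posrE ?expR_gt0//.
exact: lt_le_trans (expR_gt0 c) H.
Qed.

Section clamp.
Context {R : realType}.
Implicit Types (n : nat) (t u l : R).

Definition clamp n t : R := Num.max (- n%:R) (Num.min n%:R t).

Lemma clamp_id n t : `|t| <= n%:R -> clamp n t = t.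
Proof. by rewrite ler_norml => /andP[h1 h2]; rewrite /clamp min_r// max_r. Qed.

Lemma clamp_bounded n t : `|clamp n t| <= n%:R.
Proof.
rewrite ler_norml /clamp le_max lexx/= ge_max ge_min lexx andbT.
by rewrite lerNl (le_trans _ (ler0n _ _))// oppr_le0.
Qed.

Lemma norm_clamp n t : `|clamp n t| <= `|t|.
Proof.
have [tn|nt] := leP `|t| n%:R; first by rewrite clamp_id.
exact: le_trans (clamp_bounded n t) (ltW nt).
Qed.

Lemma clamp_le n t u : 0 <= u -> t <= u -> clamp n t <= u.
Proof.
move=> u0 tu; rewrite /clamp ge_max ge_min tu orbT andbT.
by rewrite (le_trans _ u0)// oppr_le0.
Qed.

Lemma clamp_cvg (v : nat -> R) l :
  v n @[n --> \oo] --> l -> clamp n (v n) @[n --> \oo] --> l.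
Proof.
move=> vl; apply: (cvg_trans _ (vl)); apply: near_eq_cvg.
have lt : `|l| < `|l| + 1 by rewrite ltrDl.
near=> n; rewrite clamp_id//.
apply: (@le_trans _ _ (`|l| + 1)).
  by apply/ltW; near: n; have /cvgr_norm_lt := vl; apply.
near: n; exists (Num.truncn (`|l| + 1)).+1 => // n /= ln.
by apply/ltW/(lt_le_trans (truncnS_gt _)); rewrite ler_nat.
Unshelve. all: by end_near. Qed.

End clamp.

Section bounded_approximation.
Context {R : realType} {d : nat}.
Local Notation E := ('rV[R]_d).
Variables (mubar nu : probability E R).
Hypothesis mubar2 : finite_second_moment mubar.
Hypothesis nu2 : finite_second_moment nu.
Hypothesis nu_exp : exponential_moments nu.
Hypothesis nu_hyp : ~ concentrated_on_hyperplane nu.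
Variable w : E -> R.
Hypothesis gw : egrowth w.
Hypothesis w_gt0 : forall y, 0 < w y.
Local Notation f := (dual_potential nu w).
Hypothesis if_ : mubar.-integrable setT (EFin \o f).
Hypothesis iw : nu.-integrable setT (EFin \o (fun y => ln (w y))).
Hypothesis wE : {ae nu, forall y,
  (\int[mubar]_x (expR (f x + dot x y))%:E = (w y)^-1%:E)%E}.

Let cf : continuous f. Proof. exact: (@continuous_dual_potential _ _ _ nu_exp _ gw). Qed.
Let mf : measurable_fun setT f. Proof. exact: continuous_measurable_rV cf. Qed.

(** Far points are sent to 0 and not projected: an integrand then keeps its value or takes its value
    at 0, and adding the latter gives a dominating function uniform in n. *)
Definition truncate (n : nat) (x : E) : E := if norm1 x <= n%:R then x else 0.

Lemma measurable_norm1 : measurable_fun setT (@norm1 R d).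
Proof.
by apply: measurable_sum => i; apply: measurableT_comp => //; exact: measurable_coord.
Qed.

Lemma measurable_truncate n : measurable_fun setT (truncate n).
Proof.
apply: measurable_fun_ifT => //; first exact: measurable_fun_ler measurable_norm1 _.
Qed.

Lemma norm1_truncate n x : norm1 (truncate n x) <= norm1 x.
Proof.
rewrite /truncate; case: ifP => // _.
by rewrite -(scale0r x) norm1Z normr0 mul0r norm1_ge0.
Qed.

Lemma truncate_cvg x : \forall n \near \oo, truncate n x = x.
Proof.
exists (Num.truncn (norm1 x)).+1 => // n /= xn; rewrite /truncate ifT//.
apply/ltW/(lt_le_trans (truncnS_gt _)); by rewrite ler_nat.
Qed.

Let mtr n : {mfun E >-> E} := HB.pack (truncate n)
  (isMeasurableFun.Build _ _ _ _ _ (measurable_truncate n)).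
Let mubar_ n : probability E R := distribution mubar (mtr n).

Lemma norm1_truncate_le n x : norm1 (truncate n x) <= n%:R.
Proof.
rewrite /truncate; case: ifP => // _.
by rewrite -(scale0r x) norm1Z normr0 mul0r.
Qed.

Lemma enorm_le_norm1 (x : E) : enorm x <= norm1 x.
Proof.
have [->|e0] := eqVneq (enorm x) 0; first exact: norm1_ge0.
have e1 : 0 < enorm x by rewrite lt_neqAle eq_sym e0 enorm_ge0.
rewrite -(ler_pM2r e1) -expr2 sqr_enorm.
exact: le_trans (ler_norm _) (dot_le_norm1 x x).
Qed.

Let mubar_exp n : exponential_moments (mubar_ n).
Proof.
move=> q q0; rewrite ge0_integral_distribution//=.
- apply: (@le_lt_trans _ _ (\int[mubar]_x (expR (q * n%:R))%:E)%E).
    apply: ge0_le_integral => //.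
    + apply/measurable_EFinP; apply: measurableT_comp => //.
      apply: measurable_funM => //.
      exact: measurableT_comp measurable_enorm (measurable_truncate n).
    + move=> x _; rewrite lee_fin ler_expR ler_wpM2l//.
      exact: le_trans (enorm_le_norm1 _) (norm1_truncate_le n x).
  by rewrite integral_probability_cst ltry.
- apply/measurable_EFinP; apply: measurableT_comp => //.
  by apply: measurable_funM => //; exact: measurable_enorm.
Qed.

Let truncate_integral n u : egrowth u ->
  mubar.-integrable setT (EFin \o (fun x => u (truncate n x))) /\
  \int[mubar]_x u (truncate n x) = \int[mubar_ n]_x u x.
Proof.
move=> gu; have [i e] := image_integral (P := mubar) (Q := mubar_ n)
  (measurable_truncate n) (fun B _ => erefl) (egrowth_integrable (mubar_exp n) gu).
by split => //; rewrite /Rintegral e.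
Qed.

Let ge : egrowth (fun x => expR (f x)).
Proof.
apply: (@egrowth_le _ _ _ (expR (f 0)) (norm1 (mean nu w 0))).
- exact: measurableT_comp.
- exact: expR_ge0.
move=> y; rewrite ger0_norm ?expR_ge0// -expRD ler_expR.
have := dual_potential_le nu_exp nu_hyp gw w_gt0 0 y; rewrite add0r => /le_trans; apply.
rewrite lerD2l; have := dot_le_norm1 (mean nu w 0) y.
by rewrite dotC ler_norml => /andP[+ _]; lra.
Qed.

(** Since e^f grows at most exponentially, by its tangent at 0, and the truncated law is bounded,
    this is again a Laplace transform, now with the truncated law in place of nu and y as the
    variable. *)
Let Z n := Lap (mubar_ n) (fun x => expR (f x)).
Let Z_gt0 n y : 0 < Z n y.
Proof.
by apply: (Lap_weight_gt0 (mubar_exp n) y ge) => x; exact: expR_gt0.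
Qed.
Let cZ n : continuous (Z n). Proof. exact: (Lap_continuous (mubar_exp n) ge). Qed.

Let integrand y x := expR (f x + dot x y).

Let mintegrand y : measurable_fun setT (integrand y).
Proof.
by apply: measurableT_comp => //; apply: measurable_funD => //; exact: measurable_fun_dot.
Qed.

Let gintegrand y : egrowth (integrand y).
Proof.
rewrite (_ : integrand y = fun x => expR (f x) * expR (dot y x)).
  by apply: egrowthM => //; exact: egrowth_expR_dot.
by apply/funext => x; rewrite /integrand expRD [dot y _]dotC.
Qed.

Let ZE n y : Z n y = \int[mubar]_x integrand y (truncate n x).
Proof.
rewrite /Z LapE (truncate_integral n (gintegrand y)).2.
by apply: eq_Rintegral => x _; rewrite /integrand expRD [dot y _]dotC.
Qed.

(* Jensen's inequality bounds the potentials of the truncated measures from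
   above, uniformly in n. *)
Let Z_ge : exists2 A, 0 <= A & exists r, forall n y, - ln (Z n y) <= A + r * enorm y.
Proof.
have imf : mubar.-integrable setT (EFin \o (fun x => `|f x|)) by exact: integrable_norm.
have inorm1 : mubar.-integrable setT (EFin \o @norm1 R d).
  have := integrableZl measurableT (d%:R : R) (integrable_enorm mubar2).
  apply: le_integrable => //; first by apply/measurable_EFinP; exact: measurable_norm1.
  move=> x _ /=; rewrite lee_fin ger0_norm ?norm1_ge0//.
  exact: le_trans (norm1_le_enorm x) (ler_norm _).
exists (\int[mubar]_x `|f x| + `|f 0|).
  by rewrite addr_ge0//; apply: Rintegral_ge0.
exists (\int[mubar]_x norm1 x) => n y.
pose B x := `|f x| + `|f 0| + enorm y * norm1 x.
have i0 : mubar.-integrable setT (EFin \o (fun=> `|f 0|)).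
  exact: finite_measure_integrable_cst.
have i2 : mubar.-integrable setT (EFin \o (fun x => enorm y * norm1 x)).
  have := integrableZl measurableT (enorm y) inorm1; exact.
have i1 : mubar.-integrable setT (EFin \o (fun x => `|f x| + `|f 0|)).
  have := integrableD measurableT imf i0; exact.
have iB : mubar.-integrable setT (EFin \o B).
  have := integrableD measurableT i1 i2; exact.
pose u x := f (truncate n x) + dot (truncate n x) y.
have uB x : `|u x| <= B x.
  apply: (le_trans (ler_normD _ _)); apply: lerD.
    by rewrite /truncate; case: ifP => _; rewrite ?lerDl ?lerDr.
  rewrite (le_trans (dot_le_norm1 _ _))// mulrC ler_wpM2l ?enorm_ge0//.
  exact: norm1_truncate.
have iu : mubar.-integrable setT (EFin \o u).
  apply: le_integrable iB => //.
    apply/measurable_EFinP; apply: (measurableT_comp (f := fun x => f x + dot x y)).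
      by apply: measurable_funD => //; exact: measurable_fun_dot.
    exact: measurable_truncate.
  by move=> x _; rewrite /= lee_fin (le_trans (uB x))// ler_norm.
have ieu : mubar.-integrable setT (EFin \o (expR \o u)).
  exact: (truncate_integral n (gintegrand y)).1.
have := jensen_expR iu ieu; rewrite -ZE => H.
have : - (\int[mubar]_x u x) <= \int[mubar]_x B x.
  have iuN : mubar.-integrable setT (EFin \o (fun x => - u x)).
    have := integrableN iu; exact.
  rewrite -mulN1r -RintegralZl//.
  apply: le_Rintegral => //.
    by apply: eq_integrable iuN => // x _ /=; rewrite mulN1r.
  move=> x _; rewrite mulN1r; apply: le_trans (uB x).
  by rewrite -normrN ler_norm.
have -> : \int[mubar]_x B x = \int[mubar]_x `|f x| + `|f 0| + enorm y * \int[mubar]_x norm1 x.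
  rewrite RintegralD// RintegralD// RintegralZl//; congr (_ + _ + _).
  exact: Rintegral_probability_cst.
by rewrite [enorm y * _]mulrC; lra.
Qed.

Let good y := (\int[mubar]_x (expR (f x + dot x y))%:E = (w y)^-1%:E)%E.

Let good_integrable y : good y -> mubar.-integrable setT (EFin \o integrand y).
Proof.
move=> gy; apply/integrableP; split; first exact/measurable_EFinP.
rewrite (eq_integral (EFin \o integrand y)) => [|x _].
  by rewrite [X in (X < _)%E]gy ltry.
by rewrite /= ger0_norm// expR_ge0.
Qed.

Let good_integral y : good y -> \int[mubar]_x integrand y x = (w y)^-1.
Proof. by move=> gy; rewrite /Rintegral [X in fine X]gy. Qed.

Let dominator_integrable y : good y ->
  mubar.-integrable setT (EFin \o (fun x => integrand y x + expR (f 0))).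
Proof.
move=> gy; have i0 : mubar.-integrable setT (EFin \o (fun=> expR (f 0))).
  exact: finite_measure_integrable_cst.
have := integrableD measurableT (good_integrable gy) i0; exact.
Qed.

Let integrand_le n y x : integrand y (truncate n x) <= integrand y x + expR (f 0).
Proof.
rewrite /truncate; case: ifP => _; first by rewrite lerDl expR_ge0.
by rewrite /integrand dot0l addr0 lerDr expR_ge0.
Qed.

Let Z_le n y : good y -> Z n y <= (w y)^-1 + expR (f 0).
Proof.
move=> gy; rewrite ZE.
have -> : (w y)^-1 + expR (f 0) = \int[mubar]_x (integrand y x + expR (f 0)).
  rewrite RintegralD//; last 2 first.
  - exact: good_integrable.
  - exact: finite_measure_integrable_cst.
  by rewrite good_integral// Rintegral_probability_cst.
apply: le_Rintegral => //; first exact: (truncate_integral n (gintegrand y)).1.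
exact: dominator_integrable.
Qed.

Let Z_cvg y : good y -> - ln (Z n y) @[n --> \oo] --> ln (w y).
Proof.
move=> gy; rewrite -[X in _ --> X]opprK -lnV ?posrE//; apply: cvgN.
apply: (cvg_comp (fun n => Z n y)); last first.
  by apply: continuous_ln; rewrite invr_gt0.
rewrite -(good_integral gy); under eq_fun do rewrite ZE.
apply: (dominated_Rintegral_cvg _ _ _ (dominator_integrable gy) _).2 => //.
- by move=> n; exact: measurableT_comp (mintegrand y) (measurable_truncate n).
- apply: nearW => x; apply: cvg_near_cst.
  by apply: filterS (truncate_cvg x) => n ->.
- apply: nearW => x n; rewrite ger0_norm ?expR_ge0//; exact: integrand_le.
Qed.

Definition bounded_potential n y := clamp n (- ln (Z n y)).

Lemma bounded_potential_bounded n y : `|bounded_potential n y| <= n%:R.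
Proof. exact: clamp_bounded. Qed.

Lemma bounded_potential_continuous n : continuous (bounded_potential n).
Proof.
move=> y.
have cln : {for y, continuous (fun y => - ln (Z n y))}.
  have c : {for y, continuous (@ln R \o Z n)}.
    by apply: continuous_comp; [exact: cZ|exact: continuous_ln].
  exact: cvgN c.
have c1 : {for y, continuous (fun=> n%:R : R^o)} by exact: cst_continuous.
have c2 : {for y, continuous (fun=> - n%:R : R^o)} by exact: cst_continuous.
exact: (continuous_max c2 (continuous_min c1 cln)).
Qed.

Let ae_bounded_potential_cvg :
  {ae nu, forall y, bounded_potential n y @[n --> \oo] --> ln (w y)}.
Proof. by apply: filterS wE => y gy; apply: clamp_cvg; exact: Z_cvg. Qed.

Let mbounded_potential n : measurable_fun setT (bounded_potential n).
Proof. by apply: continuous_measurable_rV; exact: bounded_potential_continuous. Qed.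

Lemma bounded_potential_cvg :
  \int[nu]_y bounded_potential n y @[n --> \oo] --> \int[nu]_y ln (w y).
Proof.
have [A A0 [r Hr]] := Z_ge.
(* The linear part is the upper bound from [Z_ge]. For the lower one, Z n y <= 1 / w(y) + e^{f 0} <=
   2 e^{|ln w(y)| + |f 0|}, which explains ln 2. *)
pose G y := A + `|r| * enorm y + (`|ln (w y)| + (`|f 0| + ln 2)).
have iG : nu.-integrable setT (EFin \o G).
  have i1 : nu.-integrable setT (EFin \o (fun=> A)) by exact: finite_measure_integrable_cst.
  have i2 := integrableZl measurableT `|r| (integrable_enorm nu2).
  have i3 : nu.-integrable setT (EFin \o (fun y => `|ln (w y)|)) by exact: integrable_norm.
  have i4 : nu.-integrable setT (EFin \o (fun=> `|f 0| + ln 2)).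
    exact: finite_measure_integrable_cst.
  have := integrableD measurableT (integrableD measurableT i1 i2) (integrableD measurableT i3 i4).
  exact.
apply: (dominated_Rintegral_cvg _ _ ae_bounded_potential_cvg iG _).2 => //.
  exact: measurableT_comp (@measurable_ln R) gw.1.
apply: filterS wE => y gy n; apply: le_trans (norm_clamp _ _) _.
have e0 := enorm_ge0 y.
have ln2 : 0 <= ln (2 : R) by rewrite ln_ge0 ?ler1n.
have re : r * enorm y <= `|r| * enorm y by rewrite ler_wpM2r ?ler_norm.
have re0 : 0 <= `|r| * enorm y by rewrite mulr_ge0.
have lw0 : 0 <= `|ln (w y)| by [].
have f0 : 0 <= `|f 0| by [].
rewrite ler_norml; apply/andP; split; last by have := Hr n y; rewrite /G; lra.
rewrite lerN2; apply: (@le_trans _ _ (`|ln (w y)| + (`|f 0| + ln 2))); last by rewrite /G; lra.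
have e1 : (w y)^-1 <= expR (`|ln (w y)| + `|f 0|).
  rewrite -[(w y)^-1]lnK ?posrE ?invr_gt0// ler_expR lnV ?posrE//.
  by have := ler_norm (- ln (w y)); rewrite normrN; lra.
have e2 : expR (f 0) <= expR (`|ln (w y)| + `|f 0|).
  by rewrite ler_expR; have := ler_norm (f 0); lra.
have e3 : Z n y <= 2 * expR (`|ln (w y)| + `|f 0|) by have := Z_le n gy; lra.
have := e3; rewrite -ler_ln ?posrE ?mulr_gt0 ?expR_gt0//.
by rewrite lnM ?posrE ?expR_gt0// expRK; lra.
Qed.

(** The approximations enter through their exponentials, so the upper bound [Z_ge] alone provides
    domination; clamping preserves it because the bound is made nonnegative. *)
Lemma dual_bounded_potential_cvg h :
  dual_potential nu (fun y => expR (bounded_potential n y)) h @[n --> \oo] --> f h.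
Proof.
have [A A0 [r Hr]] := Z_ge.
apply: cvgN; apply: (cvg_comp (fun n => Lap nu (fun y => expR (bounded_potential n y)) h)); last first.
  by apply: continuous_ln; exact: (Lap_weight_gt0 nu_exp h gw w_gt0).
rewrite LapE; under eq_fun do rewrite LapE.
have gG : egrowth (fun y : E => expR A * expR (`|r| * enorm y)).
  by apply: egrowthM; [exact: egrowth_cst|exact: egrowth_expR_enorm].
have medot : measurable_fun setT (fun y : E => expR (dot h y)).
  exact: (egrowth_expR_dot h).1.
apply: (dominated_Rintegral_cvg _ _ _ (Lap_integrable nu_exp h gG) _).2.
- by move=> n; apply: measurable_funM => //; exact: measurableT_comp.
- by apply: measurable_funM => //; exact: gw.1.
- apply: filterS ae_bounded_potential_cvg => y Hy; apply: cvgMl.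
  rewrite -[X in _ --> X](lnK (x := w y)) ?posrE//.
  apply: (cvg_comp (fun n => bounded_potential n y)); first exact: Hy.
  exact: continuous_expR.
- apply: nearW => y n; rewrite ger0_norm ?mulr_ge0 ?expR_ge0// ler_wpM2r ?expR_ge0//.
  rewrite -expRD ler_expR; apply: clamp_le.
    by rewrite addr_ge0// mulr_ge0// enorm_ge0.
  apply: (le_trans (Hr n y)); rewrite lerD2l ler_wpM2r ?enorm_ge0//; exact: ler_norm.
Qed.

End bounded_approximation.

(** * The dual problem *)

Section dual_problem.
Context {R : realType} {d : nat}.
Local Notation E := ('rV[R]_d).
Variables (mu nu : probability E R).
Hypothesis mu2 : finite_second_moment mu.
Hypothesis nu2 : finite_second_moment nu.
Hypothesis nu_exp : exponential_moments nu.
Local Open Scope ereal_scope.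

Lemma D_innerE (psi : E -> \bar R) (w : E -> R) x h : (0 < Lap nu w h)%R ->
  \int[nu]_y expeR (psi y + (dot h y)%:E) = (Lap nu w h)%:E ->
  D_inner nu psi x h = (dot h x + dual_potential nu w h)%:E.
Proof. by move=> L0 LE; rewrite /D_inner LE lne_EFin. Qed.

Lemma sup_D_inner (psi : E -> \bar R) (w : E -> R) x :
  (forall h, 0 < Lap nu w h)%R ->
  (forall h, \int[nu]_y expeR (psi y + (dot h y)%:E) = (Lap nu w h)%:E) ->
  ereal_sup (range (D_inner nu psi x)) = conjugate (dual_potential nu w) x.
Proof.
move=> L0 LE; rewrite (_ : D_inner nu psi x =
  fun h => (dot h x + dual_potential nu w h)%:E)//.
by apply/funext => h; exact: D_innerE.
Qed.

Lemma D_objectiveE (psi : E -> \bar R) (w : E -> R) :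
  (forall h, 0 < Lap nu w h)%R ->
  (forall h, \int[nu]_y expeR (psi y + (dot h y)%:E) = (Lap nu w h)%:E) ->
  D_objective mu nu psi = \int[nu]_y psi y + \int[mu]_x conjugate (dual_potential nu w) x.
Proof.
move=> L0 LE; rewrite /D_objective; congr (_ + _); apply: eq_integral => x _.
exact: sup_D_inner.
Qed.

Section bounded.
Variable psi : E -> R.
Hypothesis bc : bounded_continuous psi.
Local Notation w := (fun y => expR (psi y)).

Let mpsi : measurable_fun setT psi.
Proof. by apply: continuous_measurable_rV; case: bc. Qed.

Lemma egrowth_expR_bounded : egrowth w.
Proof.
have [_ [M HM]] := bc; apply: (@egrowth_le _ _ _ (expR M) 0%R).
- exact: measurableT_comp.
- exact: expR_ge0.
move=> y; rewrite mul0r expR0 mulr1 ger0_norm ?expR_ge0// ler_expR.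
exact: le_trans (ler_norm _) (HM y).
Qed.

Lemma integrable_ln_expR_bounded : nu.-integrable setT (EFin \o (fun y => ln (w y))).
Proof.
have [_ [M HM]] := bc.
have iM : nu.-integrable setT (EFin \o (fun=> M)) by exact: finite_measure_integrable_cst.
apply: le_integrable iM => //.
  apply/measurable_EFinP; rewrite (_ : (fun _ => _) = psi)//.
  by apply/funext => y; rewrite expRK.
by move=> y _; rewrite /= expRK lee_fin (le_trans (HM y))// ler_norm.
Qed.

Lemma D_objective_bounded : D_objective mu nu (EFin \o psi) =
  \int[nu]_y (ln (w y))%:E + \int[mu]_x conjugate (dual_potential nu w) x.
Proof.
rewrite (@D_objectiveE _ w).
- by congr (_ + _); apply: eq_integral => y _; rewrite expRK.
- move=> h; apply: (Lap_weight_gt0 nu_exp h egrowth_expR_bounded) => y; exact: expR_gt0.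
move=> h; rewrite (Lap_EFin nu_exp h egrowth_expR_bounded).
by apply: eq_integral => y _; rewrite /= expRD.
Qed.

End bounded.

Lemma D_value_le_entropy (m : probability (E * E)%type R) :
  martingale_coupling mu nu m -> D_value mu nu <= entropy m (mu \x nu).
Proof.
move=> mm; apply: ge_ereal_sup => _ [psi bc <-]; rewrite D_objective_bounded//.
apply: weak_duality_P => //.
- exact: egrowth_expR_bounded.
- by move=> y; exact: expR_gt0.
- exact: integrable_ln_expR_bounded.
Qed.

Lemma near_all (g_ : nat -> E -> R) (g : E -> R) (e : R) (s : seq E) : (0 < e)%R ->
  (forall h, g_ n h @[n --> \oo] --> g h) ->
  \forall n \near \oo, forall h, h \in s -> (g h - e <= g_ n h)%R.
Proof.
move=> e0 Hg; elim: s => [|a s IH]; first exact: nearW.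
have Ha : \forall n \near \oo, (g a - e <= g_ n a)%R.
  by apply: (cvgr_ge _ (Hg a)); rewrite ltrBlDr ltrDl.
apply: filterS2 Ha IH => n Hn IHn h; rewrite inE => /orP[/eqP ->//|]; exact: IHn.
Qed.

(** The dual potentials converge only pointwise, and convergence of the conjugates is never claimed:
    a simple map visits finitely many h, on which the convergence is uniform, and
    [weak_duality_bound] needs no more. *)
Lemma D_value_ge (w : E -> R) (psi_ : nat -> E -> R) :
  egrowth w -> (forall y, 0 < w y)%R ->
  nu.-integrable setT (EFin \o (fun y => ln (w y))) ->
  (forall n, bounded_continuous (psi_ n)) ->
  (\int[nu]_y psi_ n y @[n --> \oo] --> \int[nu]_y ln (w y))%R ->
  (forall h, dual_potential nu (fun y => expR (psi_ n y)) h @[n --> \oo]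
     --> dual_potential nu w h) ->
  \int[nu]_y (ln (w y))%:E + \int[mu]_x conjugate (dual_potential nu w) x
    <= D_value mu nu.
Proof.
move=> gw w_gt0 iw bc cvg_int cvg_dual.
apply: (weak_duality_bound nu_exp gw w_gt0 iw mu2) => xi sxi.
have [mxi [s xis]] := sxi.
apply/lee_addgt0Pr => e e0; have e2 : (0 < e / 2)%R by rewrite divr_gt0.
have : \forall n \near \oo, (\int[nu]_y ln (w y) - e / 2 <= \int[nu]_y psi_ n y)%R.
  by apply: (cvgr_ge _ cvg_int); rewrite ltrBlDr ltrDl.
move=> /filterI /(_ (near_all s e2 cvg_dual)) [N _ /(_ N (leqnn N))[Hint Hdual]].
set wN := fun y => expR (psi_ N y).
have gwN : egrowth wN by exact: egrowth_expR_bounded (bc N).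
have wN0 y : (0 < wN y)%R by exact: expR_gt0.
have iwN := integrable_ln_expR_bounded (bc N).
have mf v : egrowth v -> (forall y, 0 < v y)%R -> measurable_fun setT (dual_potential nu v).
  move=> gv v0; apply: continuous_measurable_rV.
  exact: (@continuous_dual_potential _ _ _ nu_exp _ gv).
have cN : continuous (dual_potential nu wN).
  exact: (@continuous_dual_potential _ _ _ nu_exp _ gwN).
have cw : continuous (dual_potential nu w).
  exact: (@continuous_dual_potential _ _ _ nu_exp _ gw).
have iJ := simple_map_conjugate_integrable cw mu2 sxi.
have iJN := simple_map_conjugate_integrable cN mu2 sxi.
have ie : mu.-integrable setT (EFin \o (fun=> e / 2)%R).
  exact: finite_measure_integrable_cst.
apply: (@le_trans _ _ ((\int[mu]_x (dot (xi x) x + dual_potential nu wN (xi x))%:E + (e / 2)%:E)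
    + (\int[nu]_y (ln (wN y))%:E + (e / 2)%:E))).
  apply: leeD.
    rewrite -(integral_probability_cst mu (e / 2)).
    have := integralD measurableT iJN ie => /= <-.
    apply: le_integral => //; first exact: integrableD.
    move=> x _ /=; rewrite -EFinD lee_fin.
    by have := Hdual _ (xis x); lra.
  have fw : \int[nu]_y (ln (w y))%:E \is a fin_num by exact: integrable_fin_num.
  have fwN : \int[nu]_y (ln (wN y))%:E \is a fin_num by exact: integrable_fin_num.
  rewrite -(fineK fw) -(fineK fwN) -EFinD lee_fin.
  have -> : fine (\int[nu]_y (ln (wN y))%:E) = (\int[nu]_y psi_ N y)%R.
    by rewrite /Rintegral; congr fine; apply: eq_integral => y _; rewrite /wN expRK.
  by move: Hint; rewrite /Rintegral; lra.
rewrite addeACA -EFinD -splitr leeD2r//.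
apply: (@le_trans _ _ (D_objective mu nu (EFin \o psi_ N))); last first.
  by apply: ereal_sup_ubound; exists (psi_ N).
rewrite (D_objective_bounded (bc N)) [leRHS]addeC leeD2r//.
apply: le_integral_ae.
- exact: iJN.
- exact: measurable_conjugate.
- by apply: nearW => x; exact: conjugate_ge.
Qed.

End dual_problem.

(** The extension formula for psi, solved for the integral: a finite psi excludes the values 0 and
    +oo, after which ln is injective. *)
Lemma potential_weight_reciprocal (R : realType) (d : nat)
    (mubar nu : probability 'rV[R]_d R) (p : probability ('rV[R]_d * 'rV[R]_d)%type R)
    (phi psi : 'rV[R]_d -> \bar R) :
  exponential_moments nu -> schrodinger_potentials mubar nu p phi psi ->
  {ae nu, forall y,
    (\int[mubar]_x (expR (dual_potential nu (potential_weight psi) x + dot x y))%:E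
     = (potential_weight psi y)^-1%:E)%E}.
Proof.
move=> nu_exp pot; apply: filterS (psiE pot) => y py.
have := psi_mubarE nu_exp pot y; rewrite py.
set Z := (\int[mubar]_x _)%E; have w0 := potential_weight_gt0 psi y.
case: Z => [r| |] //=; case: ifPn => // ; rewrite -ltNge => r0 [e].
congr EFin; have : ln (potential_weight psi y)^-1 = ln r by rewrite lnV ?posrE// e opprK.
by move/ln_inj => ->; rewrite ?posrE ?invr_gt0.
Qed.

(** Weigh by t and 1 - t the strict tangent inequalities at the intermediate point; the linear terms
    cancel. *)
Lemma dual_potential_strictly_concave (R : realType) (d : nat)
    (nu : probability 'rV[R]_d R) (w : 'rV[R]_d -> R) :
  exponential_moments nu -> ~ concentrated_on_hyperplane nu ->
  egrowth w -> (forall y, 0 < w y) -> strictly_concave (dual_potential nu w).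
Proof.
move=> nu_exp nu_hyp gw w_gt0 t x y /andP[t0 t1] xy.
set z := t *: x + (1 - t) *: y.
have xy0 : x - y != 0 by rewrite subr_eq0.
have s1 : (1 - t) *: (x - y) != 0 by rewrite scaler_eq0 negb_or xy0 andbT; lra.
have s2 : - t *: (x - y) != 0 by rewrite scaler_eq0 negb_or xy0 andbT; lra.
have := dual_potential_tangent nu_exp nu_hyp gw w_gt0 z s1.
have := dual_potential_tangent nu_exp nu_hyp gw w_gt0 z s2.
have -> : z + (1 - t) *: (x - y) = x.
  by apply/rowP => i; rewrite !mxE; ring.
have -> : z + - t *: (x - y) = y by apply/rowP => i; rewrite !mxE; ring.
have t1' : 0 < 1 - t by rewrite subr_gt0.
by rewrite !dotZl -(ltr_pM2l t1') => h1; rewrite -(ltr_pM2l t0); move: h1; lra.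
Qed.

Theorem proposition3p3 (R : realType) (d : nat)
    (mu nu : probability 'rV[R]_d R)
    (mu_P2 : finite_second_moment mu)
    (nu_P2 : finite_second_moment nu)
    (mu_le_nu : convex_order mu nu)
    (nu_exp : exponential_moments nu)
    (nu_hyp : ~ concentrated_on_hyperplane nu)
    (VP_fin : VP_value mu nu \is a fin_num)
    (mubar : probability 'rV[R]_d R)
    (mubar_opt : solves_VP mu nu mubar)
    (p : probability ('rV[R]_d * 'rV[R]_d)%type R)
    (p_opt : solves_SP mubar nu p)
    (phi psi : 'rV[R]_d -> \bar R)
    (potentials : schrodinger_potentials mubar nu p phi psi)
    (pc : 'rV[R]_d -> {measure set 'rV[R]_d -> \bar R})
    (pcE : conditional_measures nu phi psi pc)
    (T : 'rV[R]_d -> 'rV[R]_d)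
    (TE : forall x, T x = barycenter (pc x))
    (m : probability ('rV[R]_d * 'rV[R]_d)%type R)
    (mE : forall C, measurable C ->
      m C = pushforward p (fun z => (T z.1, z.2)) C) :
  let f := fine \o phi in
  let A := range (fun x => - gradient f x) in
  [/\
    [/\ (forall x, phi x \is a fin_num),
        strictly_concave f,
        smooth f,
        (forall x, [/\ finite_second_moment (pc x),
                       - gradient f x = T x &
                       hessian f x = - covariance_matrix (pc x)]) &
        injective T /\
        (forall B, measurable B -> pushforward mubar T B = mu B)],
    (forall h : 'rV[R]_d -> 'rV[R]_d,
      cancel (fun x => - gradient f x) h ->
      forall k : R.-pker 'rV[R]_d ~> 'rV[R]_d, disintegration m mu k ->
      {ae mu, forall x, A x /\
        (forall B, measurable B -> k x B = pc (h x) B)}),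
    solves_P mu nu m,
    attains_D mu nu psi &
    (forall h : 'rV[R]_d -> 'rV[R]_d,
      cancel (fun x => - gradient f x) h ->
      {ae mu, forall x,
        [/\ A x,
            D_inner nu psi x (h x) = ereal_sup (range (D_inner nu psi x)) &
            forall h', D_inner nu psi x h' = ereal_sup (range (D_inner nu psi x)) ->
              h' = h x]})].
Proof.
move=> f A; pose w := potential_weight psi.
have gw : egrowth w := egrowth_potential_weight potentials.
have w_gt0 y : 0 < w y := potential_weight_gt0 psi y.
have fE : f = dual_potential nu w.
  by apply/funext => x; rewrite /f /= (phiE nu_exp potentials).
have pE := potential_density nu_exp potentials.
have kE := conditional_density nu_exp potentials pcE.
have TmE : T = mean nu w.
  by apply/funext => x; rewrite TE (barycenter_conditional nu_exp gw w_gt0 kE).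
have gradE x : - gradient f x = mean nu w x.
  by rewrite fE (gradient_log_laplace nu_exp gw w_gt0) opprK.
have injT : injective (mean nu w) := mean_injective nu_exp nu_hyp gw w_gt0.
have mmE C : measurable C -> m C = pushforward p (fun z => (mean nu w z.1, z.2)) C.
  by rewrite -TmE; exact: mE.
have AE : A = range (mean nu w) 
  by rewrite /A; under eq_fun do rewrite gradE.
(* The values of h are prescribed only on the range of T, which suffices because mu gives it full
   mass. *)
have inverseE h : cancel (fun x => - gradient f x) h ->
    forall x, range (mean nu w) x -> h x = left_inverse (mean nu w) x.
  move=> fh _ [x _ <-]; rewrite left_inverseK//.
  by rewrite -{1}gradE fh.
have [if_ iw _] := optimal_potentials nu_P2 nu_exp nu_hyp gw w_gt0 VP_fin mubar_opt p_opt pE.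
have LE := integral_expeR_psi nu_exp potentials.
have L0 h : 0 < Lap nu w h := Lap_weight_gt0 nu_exp h gw w_gt0.
have ae_range := ae_range_mean mu_P2 nu_P2 nu_exp nu_hyp gw w_gt0 VP_fin mubar_opt p_opt pE.
split.
- split.
  + by move=> x; rewrite (phiE nu_exp potentials).
  + by rewrite fE; exact: dual_potential_strictly_concave.
  + by rewrite fE; exact: (log_laplace_smooth nu_exp gw w_gt0).
  + move=> x; split.
    * exact: (conditional_second_moment nu_exp gw w_gt0 kE).
    * by rewrite gradE TmE.
    * by rewrite fE (hessian_log_laplace nu_exp gw w_gt0)
         (covariance_conditional nu_exp gw w_gt0 kE).
  + rewrite TmE; split=> // B mB.
    exact: (mean_image mu_P2 nu_P2 nu_exp nu_hyp gw w_gt0 VP_fin mubar_opt p_opt pE).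
- move=> h fh k dk.
  have := image_kernel_unique mu_P2 nu_P2 nu_exp nu_hyp gw w_gt0 VP_fin mubar_opt
    p_opt pE kE mmE dk.
  apply: filterS => x [rx Hx]; split; first by rewrite AE.
  by move=> B mB; rewrite (inverseE h fh x rx) Hx.
- exact: (image_solves_P mu_P2 nu_P2 nu_exp nu_hyp gw w_gt0 VP_fin mubar_opt p_opt
    pE kE mmE).
- rewrite /attains_D (D_objectiveE _ L0 LE).
  have -> : (\int[nu]_y psi y = \int[nu]_y (ln (w y))%:E)%E.
    apply: ae_eq_integral => //; first by case: potentials.
      by apply/measurable_EFinP; apply: measurableT_comp (@measurable_ln R) gw.1.
    by apply: filterS (psiE potentials) => y py _.
  apply/eqP; rewrite eq_le; apply/andP; split.
    have wE := potential_weight_reciprocal nu_exp potentials.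
    apply: (D_value_ge mu_P2 nu_exp gw w_gt0 iw (psi_ := bounded_potential mubar nu w)).
    + move=> n; split; first exact: bounded_potential_continuous.
      by exists n%:R => y; exact: bounded_potential_bounded.
    + exact: (bounded_potential_cvg mubar_opt.1 nu_P2 nu_exp nu_hyp gw w_gt0 if_ iw wE).
    + exact: (dual_bounded_potential_cvg mubar_opt.1 nu_exp nu_hyp gw w_gt0 if_ wE).
  (* The value of D at psi is that of (VP), hence the entropy of p and then of m; weak duality at
     the single coupling m bounds (D) by the latter. *)
  rewrite -(VP_value_conjugate mu_P2 nu_P2 nu_exp nu_hyp gw w_gt0 VP_fin mubar_opt
    p_opt pE).
  rewrite -(entropy_VP_value mu_P2 nu_P2 nu_exp nu_hyp gw w_gt0 VP_fin mubar_opt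
    p_opt pE kE).
  rewrite -(image_entropy mu_P2 nu_P2 nu_exp nu_hyp gw w_gt0 VP_fin mubar_opt
    p_opt pE kE mmE).
  apply: D_value_le_entropy => //.
  exact: (image_martingale mu_P2 nu_P2 nu_exp nu_hyp gw w_gt0 VP_fin mubar_opt
    p_opt pE kE mmE).
- move=> h fh; apply: filterS ae_range => _ [x _ <-].
  have hx : h (mean nu w x) = x by rewrite -gradE fh.
  rewrite (sup_D_inner _ L0 LE) (conjugate_mean nu_exp nu_hyp gw w_gt0) hx.
  split; first by rewrite AE; exists x.
    exact: D_innerE.
  (* Another maximizer would contradict the strict tangent inequality at x. *)
  move=> h'; rewrite (D_innerE _ (L0 h') (LE h')) => -[e]; apply/eqP.
  rewrite -subr_eq0; apply/negPn/negP => s0.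
  have := dual_potential_tangent nu_exp nu_hyp gw w_gt0 x s0.
  by rewrite subrKC dotBl; lra.
Qed.
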